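(* Let $M^{2n+1}(f,\xi,\eta,g)$ be a $K$-contact manifold. Let $\mathcal D_1$ and $\mathcal D_2$ be distributions orthogonal and complementary in $f(TM)$, each of them invariant under $f$, and let $\mathcal D_3=\ker f$ be spanned by the Reeb field $\xi$. Suppose that $T^{\rm mix}_{13}=T^{\rm mix}_{23}=0$ and $P_2T_1=P_1T_2=P_1h_2=P_2h_1=0$. Then $g$ is a critical point of the action $J_{\mathcal D_1,\mathcal D_2}$ with respect to volume-preserving variations of metric keeping the orthogonality of $\mathcal D_1$ and $\mathcal D_2$.
   Context: $K$-contact manifold $M^{2n+1}(f,\xi,\eta,g)$: a vector field $\xi$ (the Reeb field), a one-form $\eta$ with $\eta(\xi)=1$, a $(1,1)$-tensor $f$ of rank $2n$ with $f^2=-\mathrm{id}+\eta\otimes\xi$, $f\xi=0$, $\eta\circ f=0$, and a Riemannian metric $g$ with $g(fX,fY)=g(X,Y)-\eta(X)\eta(Y)$, such that $d\eta=\Phi$, where $\Phi(X,Y)=g(X,fY)$, and $\xi$ is a Killing vector field. $\nabla$ is the Levi-Civita connection, $P_m$ the orthoprojector onto $\mathcal D_m$, $P_m^\perp=\mathrm{id}-P_m$; $h_m(X,Y)=\frac12P_m^\perp(\nabla_{P_mX}P_mY+\nabla_{P_mY}P_mX)$, $T_m(X,Y)=\frac12P_m^\perp(\nabla_{P_mX}P_mY-\nabla_{P_mY}P_mX)$, $\tilde T_m(X,Y)=\frac12P_m(\nabla_{P_m^\perp X}P_m^\perp Y-\nabla_{P_m^\perp Y}P_m^\perp X)$, and for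 $\{i,j,k\}=\{1,2,3\}$, $T^{\rm mix}_{ij}(X,Y)=\tilde T_k(P_iX,P_jY)+\tilde T_k(P_jX,P_iY)$. For local orthonormal frames $\{E_a\}$ of $\mathcal D_1$ and $\{\mathcal E_i\}$ of $\mathcal D_2$, the mutual curvature is $S_{\mathcal D_1,\mathcal D_2}=\sum_{a,i}g(R(E_a,\mathcal E_i)\mathcal E_i,E_a)$ (sum of sectional curvatures of the planes $E_a\wedge\mathcal E_i$). The action is $J_{\mathcal D_1,\mathcal D_2}(g)=\int_MS_{\mathcal D_1,\mathcal D_2}\,d\mathrm{vol}_g$, on metrics making $\mathcal D_1,\mathcal D_2$ orthogonal; if $M$ is non-compact one integrates over an arbitrary relatively compact domain $\Omega$ containing the support of the variation. A variation is a smooth family $g_t$, $|t|<\varepsilon$, of Riemannian metrics with $g_0=g$, $g_t=g$ outside $\Omega$ ($\Omega=M$ if $M$ is compact); it is volume-preserving if $\mathrm{Vol}(\Omega,g_t)=\mathrm{Vol}(\Omega,g)$ for all $t$. $g$ is critical with respect to a class of variations if $\frac{d}{dt}J_{\mathcal D_1,\mathcal D_2}(g_t)|_{t=0}=0$ for all variations in the class. *)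

(* Defs.v *)
From HB Require Import structures.
From mathcomp Require Import all_boot all_order all_algebra.
From mathcomp Require Import all_classical all_reals all_analysis.

Set Implicit Arguments.
Unset Strict Implicit.
Unset Printing Implicit Defensive.

Import Order.TTheory GRing.Theory Num.Theory.
Import numFieldNormedType.Exports.

Local Open Scope classical_set_scope.
Local Open Scope ring_scope.

(* C^oo on the open set U: all iterated directional derivatives exist and are
   continuous on U. *)
Definition smooth_on (R : realType) (V W : normedModType R) (U : set V)
    (f : V -> W) : Prop :=
  forall (vs : seq V) (x : V), U x ->
    let h := foldr (fun v k => 'D_v k) f vs in
    {for x, continuous h} /\ forall v : V, derivable h x v.

(* Integral of a nonnegative Borel function over R^m for Lebesgue measure, as an
   iterated integral (Tonelli). *)
Fixpoint integral_rV (R : realType) (m : nat) : ('rV[R]_m -> \bar R) -> \bar R :=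
  match m with
  | 0%N => fun f => f 0
  | k.+1 => fun f =>
      (\int[lebesgue_measure]_t
         integral_rV (fun v : 'rV[R]_k => f (row_mx (t : R)%:M v)))%E
  end.

(* Riemannian geometry in an open set of R^m. Points and tangent vectors are row
   vectors; a (1,1)-tensor F acts by v |-> v *m F, a one-form w by v |-> v *m w
   (w a column), and a subspace of the tangent space is the row space of a
   matrix. *)
Section Chart.
Variables (R : realType) (m : nat).
Local Notation vec := 'rV[R]_m.
Implicit Types (X Y Z : vec -> vec) (G P D : vec -> 'M[R]_m).

Definition dot (A : 'M[R]_m) (u v : vec) : R := (u *m A *m v^T) 0 0.

Definition bracket X Y : vec -> vec := fun x => 'D_(X x) Y x - 'D_(Y x) X x.

Definition christoffel G (x : vec) (k i j : 'I_m) : R :=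
  let pd (a b c : 'I_m) := 'D_(delta_mx 0 a) (fun y => G y b c) x in
  2^-1 * \sum_l invmx (G x) k l * (pd i j l + pd j i l - pd l i j).

Definition nabla G X Y : vec -> vec := fun x =>
  'D_(X x) Y x +
  \row_k \sum_i \sum_j X x 0 i * Y x 0 j * christoffel G x k i j.

Definition curvature G X Y Z : vec -> vec := fun x =>
  nabla G X (nabla G Y Z) x - nabla G Y (nabla G X Z) x
  - nabla G (bracket X Y) Z x.

(* R(u, v)w for tangent vectors at x: R is tensorial, so any extension will do;
   we extend by constant components. *)
Definition riem G (x u v w : vec) : vec :=
  curvature G (fun=> u) (fun=> v) (fun=> w) x.

(* L_Z g (X, Y) *)
Definition lie_metric G Z X Y (x : vec) : R :=
  'D_(Z x) (fun y => dot (G y) (X y) (Y y)) x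
  - dot (G x) (bracket Z X x) (Y x) - dot (G x) (X x) (bracket Z Y x).

(* d eta (X, Y), normalised with the factor 1/2 as is usual in contact metric
   geometry *)
Definition dform (eta : vec -> 'cV[R]_m) X Y (x : vec) : R :=
  let ev Z y := (Z y *m eta y) 0 0 in
  2^-1 * ('D_(X x) (ev Y) x - 'D_(Y x) (ev X) x - ev (bracket X Y) x).

Definition orthoproj G D : vec -> 'M[R]_m := fun x =>
  proj_mx (D x) (kermx (G x *m (D x)^T)).

Definition perp P : vec -> 'M[R]_m := fun x => 1%:M - P x.

Definition papply P X : vec -> vec := fun x => X x *m P x.

(* h_m, T_m, tilde T_m, T^mix_ij; P, Pi, Pj, Pk stand for the orthoprojectors *)
Definition hten G P X Y : vec -> vec := fun x =>
  2^-1 *: ((nabla G (papply P X) (papply P Y) x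
            + nabla G (papply P Y) (papply P X) x) *m perp P x).

Definition Tten G P X Y : vec -> vec := fun x =>
  2^-1 *: ((nabla G (papply P X) (papply P Y) x
            - nabla G (papply P Y) (papply P X) x) *m perp P x).

Definition Ttilde G P X Y : vec -> vec := fun x =>
  2^-1 *: ((nabla G (papply (perp P) X) (papply (perp P) Y) x
            - nabla G (papply (perp P) Y) (papply (perp P) X) x) *m P x).

Definition Tmix G Pi Pj Pk X Y : vec -> vec := fun x =>
  Ttilde G Pk (papply Pi X) (papply Pj Y) x
  + Ttilde G Pk (papply Pj X) (papply Pi Y) x.

(* The rows form an A-orthonormal basis of the row space of D. *)
Definition is_onframe (A D : 'M[R]_m) (E : 'M[R]_(\rank D, m)) : Prop :=
  (E == D)%MS /\ E *m A *m E^T = 1%:M.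

Definition onframe (A D : 'M[R]_m) : 'M[R]_(\rank D, m) :=
  xget 0 [set E | is_onframe A E].

Definition chart_mutual_curvature G D1 D2 (x : vec) : R :=
  let E := onframe (G x) (D1 x) in
  let F := onframe (G x) (D2 x) in
  \sum_a \sum_i
    dot (G x) (riem G x (row a E) (row i F) (row i F)) (row a E).

End Chart.

(* Smooth manifolds of dimension m: nonempty, Hausdorff, second countable, with
   an atlas of homeomorphisms chart i : dom i -> im i of inverse param i. *)
Record manifold (R : realType) (m : nat) := Manifold {
  carrier :> ptopologicalType;
  carrier_hausdorff : hausdorff_space carrier;
  carrier_second_countable : @second_countable carrier;
  idx : Type;
  dom : idx -> set carrier;
  im : idx -> set 'rV[R]_m;
  chart : idx -> carrier -> 'rV[R]_m;
  param : idx -> 'rV[R]_m -> carrier;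
  dom_open : forall i, open (dom i);
  im_open : forall i, open (im i);
  dom_cover : forall p, exists i, dom i p;
  chart_im : forall i p, dom i p -> im i (chart i p);
  param_dom : forall i x, im i x -> dom i (param i x);
  chartK : forall i p, dom i p -> param i (chart i p) = p;
  paramK : forall i x, im i x -> chart i (param i x) = x;
  chart_continuous : forall i p, dom i p -> {for p, continuous (chart i)};
  param_continuous : forall i x, im i x -> {for x, continuous (param i)};
  transition_smooth : forall i j,
    smooth_on [set x | im i x /\ dom j (param i x)] (chart j \o param i) }.

Section Manifold.
Variables (R : realType) (m : nat) (M : manifold R m).

(* Tensor fields are given by their components in each chart, related on
   overlaps by the Jacobian of the transition maps; the components are
   irrelevant outside im i. *)
Definition field (T : Type) := idx M -> 'rV[R]_m -> T.

Definition smooth_field a b (A : field 'M[R]_(a, b)) : Prop :=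
  forall i, smooth_on (im i) (A i).

Definition transition (i j : idx M) : 'rV[R]_m -> 'rV[R]_m :=
  chart j \o param i.

(* rel x (Jacobian of the transition at x) (its value at x) on overlaps *)
Definition on_overlaps
    (rel : idx M -> idx M -> 'rV[R]_m -> 'M[R]_m -> 'rV[R]_m -> Prop) : Prop :=
  forall i j x, im i x -> dom j (param i x) ->
    rel i j x (jacobian (transition i j) x) (transition i j x).

Definition is_vector_field (v : field 'rV[R]_m) : Prop :=
  smooth_field v /\
  on_overlaps (fun i j x J y => v j y = v i x *m J).

Definition is_one_form (w : field 'cV[R]_m) : Prop :=
  smooth_field w /\
  on_overlaps (fun i j x J y => w i x = J *m w j y).

Definition is_endo_field (F : field 'M[R]_m) : Prop :=
  smooth_field F /\
  on_overlaps (fun i j x J y => F i x *m J = J *m F j y).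

Definition is_metric (g : field 'M[R]_m) : Prop :=
  [/\ smooth_field g,
      on_overlaps (fun i j x J y => g i x = J *m g j y *m J^T),
      forall i x, im i x -> (g i x)^T = g i x &
      forall i x, im i x -> forall v : 'rV[R]_m, v != 0 -> 0 < dot (g i x) v v].

Definition is_distribution (D : field 'M[R]_m) : Prop :=
  on_overlaps (fun i j x J y => (D j y == D i x *m J)%MS) /\
  exists k : nat, forall i x, im i x ->
    \rank (D i x) = k /\
    exists (U : set 'rV[R]_m) (E : 'rV[R]_m -> 'M[R]_(k, m)),
      [/\ open U, U x, U `<=` im i, smooth_on U E &
          forall y, U y -> (E y == D i y)%MS].

Definition orthogonal_distr (g D1 D2 : field 'M[R]_m) : Prop :=
  forall i x, im i x -> D1 i x *m g i x *m (D2 i x)^T = 0.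

Definition tensor_eq0 b
    (T : idx M -> ('rV[R]_m -> 'rV[R]_m) -> ('rV[R]_m -> 'rV[R]_m) ->
         'rV[R]_m -> 'rV[R]_b) : Prop :=
  forall i X Y, smooth_on (im i) X -> smooth_on (im i) Y ->
    forall x, im i x -> T i X Y x = 0.

Definition chart_at (p : M) : idx M := projT1 (cid (dom_cover p)).

Definition mutual_curvature (g D1 D2 : field 'M[R]_m) (p : M) : R :=
  let i := chart_at p in
  chart_mutual_curvature (g i) (D1 i) (D2 i) (chart i p).

Definition borel := g_sigma_algebraType (@open M).

(* mu is the Riemannian measure of g, i.e. sqrt(det g) dx in every chart; this
   determines mu, as the charts cover M and M is second countable. *)
Definition is_riemannian_volume (g : field 'M[R]_m)
    (mu : {measure set borel -> \bar R}) : Prop :=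
  forall i (A : set borel), measurable A -> A `<=` dom i ->
    mu A = integral_rV (fun x =>
      (\1_(im i `&` (param i @^-1` A)) x * Num.sqrt (\det (g i x)))%:E).

(* J(g), mu being the Riemannian measure of g *)
Definition action (mu : {measure set borel -> \bar R})
    (Omega : set borel) (g D1 D2 : field 'M[R]_m) : R :=
  \int[mu]_(p in Omega) mutual_curvature g D1 D2 p.

Definition is_domain (Omega : set M) : Prop :=
  (compact [set: M] /\ Omega = [set: M]) \/
  [/\ ~ compact [set: M], open Omega, connected Omega &
      compact (closure Omega)].

Definition is_variation (g : field 'M[R]_m) (Omega : set M) (eps : R)
    (gt : R -> field 'M[R]_m) : Prop :=
  [/\ 0 < eps,
      forall t, `|t| < eps -> is_metric (gt t),
      forall i, smooth_on
        [set q : (R * 'rV[R]_m)%type | `|q.1| < eps /\ im i q.2]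
        (fun q => gt q.1 i q.2),
      forall i x, im i x -> gt 0 i x = g i x &
      closure [set p : M | exists t i,
        [/\ `|t| < eps, dom i p & gt t i (chart i p) != g i (chart i p)]]
      `<=` Omega].

Definition critical_volume_preserving (g D1 D2 : field 'M[R]_m) : Prop :=
  forall (Omega : set M) (eps : R) (gt : R -> field 'M[R]_m)
         (mu : R -> {measure set borel -> \bar R}),
    is_domain Omega ->
    is_variation g Omega eps gt ->
    (forall t, `|t| < eps -> orthogonal_distr (gt t) D1 D2) ->
    (forall t, `|t| < eps -> is_riemannian_volume (gt t) (mu t)) ->
    (forall t, `|t| < eps -> mu t Omega = mu 0 Omega) ->
    is_derive (0 : R) (1 : R) (fun t => action (mu t) Omega (gt t) D1 D2) 0.

End Manifold.

Arguments field {R m} M T.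

Record is_K_contact (R : realType) (n : nat) (M : manifold R (2 * n).+1)
    (f : field M 'M[R]_((2 * n).+1)) (xi : field M 'rV[R]_((2 * n).+1))
    (eta : field M 'cV[R]_((2 * n).+1)) (g : field M 'M[R]_((2 * n).+1))
    : Prop := IsKContact {
  kc_f : is_endo_field f;
  kc_xi : is_vector_field xi;
  kc_eta : is_one_form eta;
  kc_g : is_metric g;
  kc_rank : forall i x, im i x -> \rank (f i x) = (2 * n)%N;
  kc_eta_xi : forall i x, im i x -> xi i x *m eta i x = 1%:M;
  kc_f2 : forall i x, im i x -> f i x *m f i x = - 1%:M + eta i x *m xi i x;
  kc_f_xi : forall i x, im i x -> xi i x *m f i x = 0;
  kc_eta_f : forall i x, im i x -> f i x *m eta i x = 0;
  kc_compat : forall i x, im i x -> forall u v : 'rV[R]_((2 * n).+1),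
    dot (g i x) (u *m f i x) (v *m f i x)
    = dot (g i x) u v - (u *m eta i x) 0 0 * (v *m eta i x) 0 0;
  kc_contact : forall i X Y, smooth_on (im i) X -> smooth_on (im i) Y ->
    forall x, im i x ->
      dform (eta i) X Y x = dot (g i x) (X x) (Y x *m f i x);
  kc_killing : forall i X Y, smooth_on (im i) X -> smooth_on (im i) Y ->
    forall x, im i x -> lie_metric (g i) (xi i) X Y x = 0 }.

(* Main.v *)
Require Import Defs.
From HB Require Import structures.
From mathcomp Require Import all_boot all_order all_algebra.
From mathcomp Require Import all_classical all_reals all_analysis.
From mathcomp Require Import perm measurable_realfun ring lra.
Set Implicit Arguments.
Unset Strict Implicit.
Unset Printing Implicit Defensive.
Import Order.TTheory GRing.Theory Num.Theory.
Import numFieldNormedType.Exports.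
Local Open Scope classical_set_scope.
Local Open Scope ring_scope.

(** At [g], [S = sum_(p, r) (C2 R(e_p, e_r) P1)_(r, p)], where [C2] is the
    cometric of [D2] and [P1] the projector onto [D1]. The hypotheses say that
    the Levi-Civita connection preserves [D1] and [D2] up to components along
    [xi], while [nabla_u xi] is a multiple of [u f], which stays in the [D_i]
    containing [u]. Hence [R(u, y) y], for [u] in [D1] and [y] in [D2], has no
    component in [D1] or along [xi], so [S = 0], and the derivatives of [C2],
    [P1] and of the volume density do not contribute to the derivative of [S].
    There remains the contraction of [C2] and [P1] with the linearized
    curvature [nabla_p Pi_r - nabla_r Pi_p], [Pi] being the derivative of the
    Christoffel symbols; the same parallelism makes it the divergence of a
    compactly supported vector field. Its integral vanishes by the divergence
    theorem, obtained from translation invariance of the Lebesgue measure in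
    charts and a C^1 substitute for a partition of unity. *)

(** * Directional derivatives and functions of class C^k *)

(** [D1] and [D2] stay fixed while the metric moves, which constrains the time derivatives. That of
    [C2] keeps its rows in [D2]. That of [P1] kills [D1], and kills [D2] because orthogonality is
    kept; it can only send [xi] into [D1]. Hence the [xi]-component of [R(u, y) y] has to vanish as
    well, and pair symmetry turns it into the [D1]-component of [R(xi, y) y]. The covariant
    derivatives of [C2] and [P1] are not zero: they contain terms mixing [u f] with [xi]. The
    contractions of them met in the integration by parts still vanish, because [f] commutes with
    [P1] and [P2], kills [xi], and is skew, so that its composites with the projectors are
    traceless. Frames and charts are arbitrary choices at each point. The frames are removed through
    [cofr], the charts through transition laws; [Pi] is a tensor although the Christoffel symbols
    are not. The passage from charts to the manifold uses a weak form: for a cutoff [phi], the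
    derivative of the integral of [phi S] is minus the integral of [V(phi)], [V] being the vector
    field. This is additive in [phi], and at the end [phi] is 1 near the support of the variation,
    off which [V] is 0. *)

Section Directional.
Variables (R : realType) (V W : normedModType R).
Implicit Types (f g : V -> W) (x u v : V) (U : set V).

Lemma is_derive_line f x v (s : R) :
  derivable f (x + s *: v) v ->
  is_derive s 1 (fun t : R => f (x + t *: v)) ('D_v f (x + s *: v)).
Proof.
have E : (fun h => h^-1 *: (((fun t : R => f (x + t *: v)) \o shift s) (h *: 1)
               - f (x + s *: v))) =
       (fun h => h^-1 *: ((f \o shift (x + s *: v)) (h *: v) - f (x + s *: v))).
  apply/funext => h /=; rewrite [h *: 1]mulr1 scalerDl; congr (_ *: (f _ - _)).
  by rewrite addrCA.
move=> df; split; first by rewrite /derivable E.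
by rewrite /derive E.
Qed.

Lemma is_derive_dirZ f x v (a : R) :
  derivable f x v -> is_derive x (a *: v) f (a *: 'D_v f x).
Proof.
move=> df; have [->|a0] := eqVneq a 0.
  by rewrite !scale0r; exact: is_derive0.
have E : (fun h => h^-1 *: ((f \o shift x) (h *: (a *: v)) - f x)) =
    (fun h => a *: ((fun k => k^-1 *: ((f \o shift x) (k *: v)
      - f x)) (h * a))).
  apply/funext => h /=; rewrite !scalerA invfM.
  by rewrite mulrCA divff// mulr1.
have lim1 : (h * a) @[h --> (0 : R)^'] --> (0 : R)^'.
  move=> A /nbhs_ballP[e /= e0 eA]; apply/nbhs_ballP.
  exists (e / `|a|); first by rewrite /= divr_gt0// normr_gt0.
  move=> y yb y0; apply: eA => /=; last by rewrite mulf_neq0.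
  move: yb; rewrite /ball /= !sub0r !normrN normrM.
  by rewrite ltr_pdivlMr// normr_gt0.
have C : h^-1 *: ((f \o shift x) (h *: (a *: v)) - f x) @[h --> 0^'] -->
    a *: 'D_v f x.
  by rewrite E; have := cvg_comp _ _ lim1 df; exact: cvgZr.
by split; [apply/cvg_ex; eexists; exact: C|exact: cvg_lim].
Qed.

End Directional.

Section DirectionalReal.
Variables (R : realType) (V : normedModType R).
Implicit Types (f g : V -> R) (x u v : V) (U : set V).

Lemma MVT_line f x v :
  (forall s : R, 0 <= s <= 1 -> derivable f (x + s *: v) v) ->
  exists2 s : R, 0 <= s <= 1 & f (x + v) - f x = 'D_v f (x + s *: v).
Proof.
move=> df; pose g (t : R) := f (x + t *: v).
have dg (s : R) : 0 <= s <= 1 -> is_derive s 1 g ('D_v f (x + s *: v)).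
  by move=> s01; apply: is_derive_line; exact: df.
have [||s sI E] := @MVT _ g (fun s => 'D_v f (x + s *: v)) 0 1 ltr01.
- move=> s; rewrite in_itv /= => /andP[s0 s1]; apply: dg.
  by rewrite !ltW.
- apply: derivable_within_continuous => s; rewrite in_itv /= => s01.
  by have [] := dg _ s01.
exists s.
  by move: sI; rewrite in_itv /= => /andP[s0 s1]; rewrite !ltW.
by move: E; rewrite /g scale1r scale0r addr0 subr0 mulr1.
Qed.

End DirectionalReal.

Section Ck.
Variables (R : realType) (V W : normedModType R).
Implicit Types (f g : V -> W) (x u v : V) (U : set V).

(** Finite differentiability is tracked because the cutoffs used later are only of class C^1. As in
    [smooth_on], only directional derivatives are required; their linearity in the direction and
    Fréchet differentiability are recovered from continuity. *)
Fixpoint Ck (n : nat) U f : Prop :=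
  (forall x, U x -> {for x, continuous f}) /\
  match n with
  | 0%N => True
  | k.+1 => (forall x v, U x -> derivable f x v) /\
            (forall v, Ck k U ('D_v f))
  end.

Lemma Ck_continuous n U f x : Ck n U f -> U x -> {for x, continuous f}.
Proof. by case: n => [|n] [h _]; exact: h. Qed.

Lemma Ck_derivable n U f x v : Ck n.+1 U f -> U x -> derivable f x v.
Proof. by case=> _ [h _]; exact: h. Qed.

Lemma Ck_derive n U f v : Ck n.+1 U f -> Ck n U ('D_v f).
Proof. by case=> _ [_]; exact. Qed.

Lemma Ck_pred n U f : Ck n.+1 U f -> Ck n U f.
Proof.
elim: n f => [|n IH] f; first by case.
by case=> c [d h]; split=> //; split=> // v; exact/IH/h.
Qed.

Lemma Ck_le n k U f : (k <= n)%N -> Ck n U f -> Ck k U f.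
Proof.
elim: n => [|n IH]; first by rewrite leqn0 => /eqP ->.
by rewrite leq_eqVlt => /predU1P[->//|kn /Ck_pred]; exact: IH.
Qed.

Lemma Ck_sub n U U' f : U' `<=` U -> Ck n U f -> Ck n U' f.
Proof.
move=> sU; elim: n f => [|n IH] f; first by case=> c _; split=> // x /sU/c.
by case=> c [d h]; split; [move=> x /sU/c|split=> [x v /sU/d|v]//; exact/IH/h].
Qed.

Lemma near_open U x : open U -> U x -> \forall y \near x, U y.
Proof. by move=> oU Ux; exact: open_nbhs_nbhs. Qed.

Lemma eq_on_near U f g x : open U -> (forall y, U y -> f y = g y) -> U x ->
  \forall y \near x, f y = g y.
Proof. by move=> oU fg Ux; near do apply: fg; exact: near_open. Unshelve. all: end_near. Qed.

Lemma eq_on_derive U f g v x : open U -> (forall y, U y -> f y = g y) -> U x ->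
  'D_v f x = 'D_v g x.
Proof. by move=> oU fg Ux; apply: near_eq_derive; exact: eq_on_near fg Ux. Qed.

Lemma Ck_ext n U f g : open U -> (forall x, U x -> f x = g x) ->
  Ck n U f -> Ck n U g.
Proof.
move=> oU; elim: n f g => [|n IH] f g fg.
  case=> c _; split=> // x Ux; have n1 := eq_on_near oU fg Ux.
  rewrite /prop_for /continuous_at -(fg _ Ux); apply: cvg_trans (c _ Ux).
  exact: near_eq_cvg.
case=> c [d h]; split; [|split].
- move=> x Ux; have n1 := eq_on_near oU fg Ux.
  rewrite /prop_for /continuous_at -(fg _ Ux); apply: cvg_trans (c _ Ux).
  exact: near_eq_cvg.
- move=> x v Ux; apply: near_eq_derivable (d _ v Ux).
  exact: eq_on_near fg Ux.
- move=> v; apply: IH (h v) => x Ux; exact: eq_on_derive oU fg Ux.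
Qed.

Lemma Ck_local n U f :
  (forall x, U x -> exists U', [/\ open U', U' x & Ck n U' f]) -> Ck n U f.
Proof.
elim: n f => [|n IH] f h.
  by split=> // x /h[U' [_ U'x [c _]]]; exact: c.
split; [|split].
- by move=> x /h[U' [_ U'x [c _]]]; exact: c.
- by move=> x v /h[U' [_ U'x [_ [d _]]]]; exact: d.
- by move=> v; apply: IH => x /h[U' [oU U'x [_ [_ k]]]]; exists U'; split=> //; exact: k.
Qed.

Lemma Ck_cst n U (c : W) : Ck n U (cst c).
Proof.
elim: n c => [|n IH] c; first by split=> // x _; exact: cst_continuous.
split; first by move=> x _; exact: cst_continuous.
split=> [x v _|v]; first exact: derivable_cst.
by rewrite (_ : 'D_v _ = cst 0) //; apply/funext => x; rewrite derive_cst.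
Qed.

Lemma CkD n U f g : open U -> Ck n U f -> Ck n U g ->
  Ck n U (fun x => f x + g x).
Proof.
move=> oU; elim: n f g => [|n IH] f g.
  by move=> [cf _] [cg _]; split=> // x Ux; apply: cvgD; [exact: cf|exact: cg].
move=> [cf [df hf]] [cg [dg hg]]; split; [|split].
- by move=> x Ux; apply: cvgD; [exact: cf|exact: cg].
- by move=> x v Ux; apply: derivableD; [exact: df|exact: dg].
- move=> v; apply: Ck_ext (IH _ _ (hf v) (hg v)) => // x Ux.
  by rewrite deriveD//; [exact: df|exact: dg].
Qed.

Lemma CkN n U f : open U -> Ck n U f -> Ck n U (fun x => - f x).
Proof.
move=> oU; elim: n f => [|n IH] f.
  by move=> [cf _]; split=> // x Ux; apply: cvgN; exact: cf.
move=> [cf [df hf]]; split; [|split].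
- by move=> x Ux; apply: cvgN; exact: cf.
- by move=> x v Ux; apply: derivableN; exact: df.
- move=> v; apply: Ck_ext (IH _ (hf v)) => // x Ux.
  by rewrite deriveN//; exact: df.
Qed.

Lemma CkB n U f g : open U -> Ck n U f -> Ck n U g ->
  Ck n U (fun x => f x - g x).
Proof. by move=> oU Cf Cg; apply: CkD => //; exact: CkN. Qed.

Lemma Ck_sum n U (I : Type) (r : seq I) (P : pred I) (F : I -> V -> W) :
  open U -> (forall i, P i -> Ck n U (F i)) ->
  Ck n U (fun x => \sum_(i <- r | P i) F i x).
Proof.
move=> oU h; elim: r => [|i r IH].
  by apply: Ck_ext (Ck_cst _ _ 0) => // x _; rewrite big_nil.
have [Pi|nPi] := boolP (P i).
  by apply: Ck_ext (CkD oU (h _ Pi) IH) => // x _; rewrite big_cons Pi.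
by apply: Ck_ext IH => // x _; rewrite big_cons (negbTE nPi).
Qed.

Lemma smooth_Ck n U f : smooth_on U f -> Ck n U f.
Proof.
elim: n f => [|n IH] f sf.
  by split=> // x Ux; have [] := sf [::] x Ux.
split; [|split].
- by move=> x Ux; have [] := sf [::] x Ux.
- by move=> x v Ux; have [_] := sf [::] x Ux; exact.
- by move=> v; apply: IH => vs x Ux; have := sf (rcons vs v) x Ux; rewrite foldr_rcons.
Qed.

Lemma Ck_smooth U f : (forall n, Ck n U f) -> smooth_on U f.
Proof.
move=> h vs x Ux; elim/last_ind: vs f h => [|vs v IH] f h.
  split; first by have [] := h 0%N => c _; exact: c.
  by move=> v; have [_ [d _]] := h 1%N; exact: d.
rewrite foldr_rcons; apply: IH => n.
have [_ [_ k]] := h n.+1; exact: k.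
Qed.

End Ck.

Section Translate.
Variables (R : realType) (V W : normedModType R).

Lemma is_derive_translate (f : V -> W) (c x v : V) : derivable f (x + c) v ->
  is_derive x v (fun y => f (y + c)) ('D_v f (x + c)).
Proof.
have E : (fun h => h^-1 *: (((fun y => f (y + c)) \o shift x) (h *: v)
               - f (x + c))) =
       (fun h => h^-1 *: ((f \o shift (x + c)) (h *: v) - f (x + c))).
  by apply/funext => h /=; rewrite addrA.
move=> df; split; first by rewrite /derivable E.
by rewrite /derive E.
Qed.

End Translate.

Section CkReal.
Variables (R : realType) (V : normedModType R).
Implicit Types (f g : V -> R) (x u v : V) (U : set V).

Lemma CkM n U f g : open U -> Ck n U f -> Ck n U g ->
  Ck n U (fun x => f x * g x).
Proof.
move=> oU; elim: n f g => [|n IH] f g.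
  by move=> [cf _] [cg _]; split=> // x Ux; apply: cvgM; [exact: cf|exact: cg].
move=> Cf Cg; have [[cf [df hf]] [cg [dg hg]]] := (Cf, Cg); split; [|split].
- by move=> x Ux; apply: cvgM; [exact: cf|exact: cg].
- by move=> x v Ux; apply: derivableM; [exact: df|exact: dg].
- move=> v; apply: Ck_ext (CkD oU (IH _ _ (Ck_pred Cf) (hg v))
    (IH _ _ (Ck_pred Cg) (hf v))) => // x Ux.
  by rewrite deriveM//; [exact: df|exact: dg].
Qed.

Lemma Ck_prod n U (I : Type) (r : seq I) (P : pred I) (F : I -> V -> R) :
  open U -> (forall i, P i -> Ck n U (F i)) ->
  Ck n U (fun x => \prod_(i <- r | P i) F i x).
Proof.
move=> oU h; elim: r => [|i r IH].
  by apply: Ck_ext (Ck_cst _ _ (1 : R)) => // x _; rewrite big_nil.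
have [Pi|nPi] := boolP (P i).
  by apply: Ck_ext (CkM oU (h _ Pi) IH) => // x _; rewrite big_cons Pi.
by apply: Ck_ext IH => // x _; rewrite big_cons (negbTE nPi).
Qed.

Lemma CkV n U f : open U -> (forall x, U x -> f x != 0) -> Ck n U f ->
  Ck n U (fun x => (f x)^-1).
Proof.
move=> oU f0; elim: n => [|n IH].
  by move=> [cf _]; split=> // x Ux; apply: cvgV; [exact: f0|exact: cf].
move=> Cf; have [cf [df hf]] := Cf; split; [|split].
- by move=> x Ux; apply: cvgV; [exact: f0|exact: cf].
- by move=> x v Ux; apply: derivableV; [exact: f0|exact: df].
- move=> v; have IH' := IH (Ck_pred Cf).
  apply: Ck_ext (CkN oU (CkM oU (CkM oU IH' IH') (hf v))) => // x Ux.
  rewrite [RHS]deriveV; [|exact: f0|exact: df].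
  by rewrite -exprVn expr2 -mulNr.
Qed.

(* MVT along [v], started at [x + h *: u], reduces the increment in direction
   [u + v] to the one in direction [u]; continuity of ['D_v f] does the rest. *)
Lemma is_derive_dirD U f x u v : open U -> Ck 1 U f -> U x ->
  is_derive x (u + v) f ('D_u f x + 'D_v f x).
Proof.
move=> oU [_ [df cdf]] Ux.
have C : h^-1 *: ((f \o shift x) (h *: (u + v)) - f x) @[h --> 0^'] -->
    'D_u f x + 'D_v f x.
  apply/cvgrPdist_le => e e0.
  have du := df x u Ux.
  have /cvgrPdist_le /(_ (e / 2)) : h^-1 *: ((f \o shift x) (h *: u) - f x)
      @[h --> 0^'] --> 'D_u f x by exact: du.
  rewrite divr_gt0// => /(_ isT) nu.
  have [cv _] := cdf v.
  have /cvgrPdist_le /(_ (e / 2)) := cv x Ux.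
  rewrite divr_gt0// => /(_ isT) nv.
  have /nbhs_normP[d /= d0 dP] : \forall y \near x,
      U y /\ `|'D_v f x - 'D_v f y| <= e / 2.
    by apply: filterI => //; exact: near_open.
  have B0 : 0 < `|u| + `|v| + 1 by rewrite ltr_wpDl// addr_ge0.
  have sm : \forall h \near (0 : R)^', `|h| < d / (`|u| + `|v| + 1).
    by apply: dnbhs0_lt; rewrite divr_gt0.
  near=> h.
  have h0 : h != 0 by near: h; exact: nbhs_dnbhs_neq.
  have hs : `|h| < d / (`|u| + `|v| + 1) by near: h.
  have inb s : 0 <= s <= 1 ->
      U (x + h *: u + s *: (h *: v)) /\
      `|'D_v f x - 'D_v f (x + h *: u + s *: (h *: v))| <= e / 2.
    move=> /andP[s0 s1]; apply: dP => /=.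
    rewrite -addrA opprD addNKr normrN scalerA mulrC -scalerA -scalerDr normrZ.
    rewrite ltr_pdivlMr// in hs; apply: le_lt_trans hs.
    rewrite ler_wpM2l// (le_trans (ler_normD _ _))// -addrA lerD2l.
    by rewrite normrZ ger0_norm// (le_trans (ler_piMl _ s1))// lerDl.
  have dhv y : U y -> is_derive y (h *: v) f (h *: 'D_v f y).
    by move=> Uy; apply: is_derive_dirZ; exact: df.
  have [s s01] := @MVT_line _ _ f (x + h *: u) (h *: v)
    (fun s sI => @ex_derive _ _ _ _ _ _ _ (dhv _ (proj1 (inb s sI)))).
  have [Uy Dy] := inb _ s01.
  have [_ ->] := dhv _ Uy => E.
  rewrite (_ : _ - _ = ('D_u f x - h^-1 *: ((f \o shift x) (h *: u) - f x)) +
     ('D_v f x - 'D_v f (x + h *: u + s *: (h *: v)))); last first.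
    have E1 : f (h *: (u + v) + x) =
        f (h *: u + x) + h *: 'D_v f (x + h *: u + s *: (h *: v)).
      by rewrite -E scalerDr [_ + x]addrC [_ + x]addrC addrA addrCA subrr addr0.
    rewrite /= E1 /GRing.scale /=; field.
    exact: h0.
  rewrite (le_trans (ler_normD _ _))// (splitr e) lerD//.
  by near: h.
by split; [apply/cvg_ex; eexists; exact: C|exact: cvg_lim].
Unshelve. all: end_near. Qed.

(** The mean value theorem is applied along [u] to the increment [f (y + v) - f y], then along [v]
    to ['D_u f]. The left side is symmetric in [u] and [v], which is what makes mixed derivatives
    commute. *)
Lemma second_difference U f x u v : open U -> Ck 2 U f ->
  (forall s t : R, 0 <= s <= 1 -> 0 <= t <= 1 -> U (x + s *: u + t *: v)) ->
  exists s t : R, [/\ 0 <= s <= 1, 0 <= t <= 1 &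
    f (x + u + v) - f (x + u) - f (x + v) + f x
    = 'D_v ('D_u f) (x + s *: u + t *: v)].
Proof.
move=> oU Cf Uxuv; pose g y := f (y + v) - f y.
have [_ [df _]] := Cf.
have shft y : U (y + v) -> is_derive y u (fun z => f (z + v)) ('D_u f (y + v)).
  by move=> Uy; apply: is_derive_translate; exact: df.
have I1 : 0 <= (1 : R) <= 1 by rewrite ler01 lexx.
have I0 : 0 <= (0 : R) <= 1 by rewrite ler01 lexx.
have dg s : 0 <= s <= 1 -> is_derive (x + s *: u) u g
    ('D_u f (x + s *: u + v) - 'D_u f (x + s *: u)).
  move=> sI; apply: is_deriveB.
    by apply: shft; have := Uxuv s 1 sI I1; rewrite scale1r.
  by apply: derivableP; apply: df; have := Uxuv s 0 sI I0; rewrite scale0r addr0.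
have [s sI] := @MVT_line _ _ g x u (fun s sI => @ex_derive _ _ _ _ _ _ _ (dg s sI)).
have [_ ->] := dg s sI => E1.
have [t tI E2] := @MVT_line _ _ ('D_u f) (x + s *: u) v
  (fun t tI => Ck_derivable (Ck_derive u Cf) (Uxuv s t sI tI)).
exists s, t; split => //; rewrite -E2 -E1 /g.
by ring.
Qed.

(** The second difference over the parallelogram of sides [h u] and [h v] is [h ^+ 2] times either
    mixed derivative at some nearby point. If the two differed at [x] by [e > 0], continuity within
    [e / 3] would contradict the equality. *)
Lemma schwarz_derive U f x u v : open U -> Ck 2 U f -> U x ->
  'D_v ('D_u f) x = 'D_u ('D_v f) x.
Proof.
move=> oU Cf Ux; apply/eqP; rewrite -subr_eq0 -normr_eq0.
apply/negPn/negP => n0.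
set e := `|_| in n0; have e0 : 0 < e by rewrite lt_def n0 normr_ge0.
have cc w z := Ck_continuous (Ck_derive w (Ck_derive z Cf)) Ux.
have near2 (F1 F2 : V -> R) (r : R) : 0 < r -> {for x, continuous F1} ->
    {for x, continuous F2} -> \forall y \near x,
    U y /\ (`|F1 x - F1 y| < r /\ `|F2 x - F2 y| < r).
  move=> r0 /cvgrPdist_lt/(_ _ r0) n1 /cvgrPdist_lt/(_ _ r0) n2.
  by have n3 := near_open oU Ux; apply: filterI => //; exact: filterI.
have e20 : 0 < e / 3 by rewrite divr_gt0.
have /nbhs_normP[d /= d0 dP] := near2 _ _ _ e20 (cc v u) (cc u v).
have B0 : 0 < `|u| + `|v| + 1 by rewrite ltr_wpDl// addr_ge0.
(* With this [h] the whole parallelogram lies in the ball of radius [d]; the [+ 1] keeps the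
   denominator positive when [u = v = 0]. *)
pose h := d / 2 / (`|u| + `|v| + 1).
have h0 : 0 < h by rewrite /h !divr_gt0.
have hE : d = h * (`|u| + `|v| + 1) * 2 by rewrite /h; field; rewrite gt_eqF.
clearbody h.
have inb s t : 0 <= s <= 1 -> 0 <= t <= 1 ->
    `|x - (x + s *: (h *: u) + t *: (h *: v))| < d.
  move=> /andP[s0 s1] /andP[t0 t1]; rewrite -addrA opprD addNKr normrN.
  rewrite (le_lt_trans (ler_normD _ _))// !normrZ !ger0_norm// ?ltW//.
  have hu : 0 <= h * `|u| by rewrite mulr_ge0// ltW.
  have hv : 0 <= h * `|v| by rewrite mulr_ge0// ltW.
  have := ler_piMl hu s1; have := ler_piMl hv t1.
  rewrite hE; nra.
have key u' v' : (forall s t : R, 0 <= s <= 1 -> 0 <= t <= 1 ->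
       U (x + s *: (h *: u') + t *: (h *: v'))) ->
   exists s t : R, [/\ 0 <= s <= 1, 0 <= t <= 1 &
    f (x + h *: u' + h *: v') - f (x + h *: u') - f (x + h *: v') + f x
    = h ^+ 2 * 'D_v' ('D_u' f) (x + s *: (h *: u') + t *: (h *: v'))].
  move=> hU; have [s [t [sI tI ->]]] := second_difference oU Cf hU.
  exists s, t; split => //; have Uy := hU _ _ sI tI.
  have D1 y : U y -> 'D_(h *: u') f y = h *: 'D_u' f y.
    move=> Uy'; have [_ ->//] : is_derive y (h *: u') f (h *: 'D_u' f y).
    by apply: is_derive_dirZ; exact: Ck_derivable Cf _.
  rewrite (eq_on_derive _ oU D1 Uy).
  have dd := Ck_derivable (v := v') (Ck_derive u' Cf) Uy.
  have dd' : derivable (fun y => h *: 'D_u' f y)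
    (x + s *: (h *: u') + t *: (h *: v')) v' by exact: derivableZ.
  have [_ ->] := is_derive_dirZ h dd'.
  by rewrite deriveZ// expr2 -mulrA.
have U1 s t : 0 <= s <= 1 -> 0 <= t <= 1 -> U (x + s *: (h *: u) + t *: (h *: v)).
  by move=> sI tI; have [] := dP _ (inb _ _ sI tI).
have U2 s t : 0 <= s <= 1 -> 0 <= t <= 1 -> U (x + s *: (h *: v) + t *: (h *: u)).
  by move=> sI tI; rewrite addrAC; exact: U1.
have [s [t [sI tI E1]]] := key u v U1.
have [s' [t' [sI' tI' E2]]] := key v u U2.
have [_ [b1 _]] := dP _ (inb _ _ sI tI).
have [_ [_ b2]] := dP _ (inb _ _ tI' sI').
have pE : x + s' *: (h *: v) + t' *: (h *: u) = x + t' *: (h *: u) + s' *: (h *: v).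
  by rewrite addrAC.
rewrite {}pE (addrAC x (h *: v)) in E2.
move: E1 E2 b1 b2 {U1 U2 inb dP near2 cc}; rewrite {}/e in e0 n0 e20 *.
move: ('D_v ('D_u f) (x + _ + _)) => A; move: ('D_u ('D_v f) (x + _ + _)) => B.
move: ('D_v ('D_u f) x) ('D_u ('D_v f) x) e0 n0 e20 => A0 B0' e0 n0 e20.
move=> E1 E2 b1 b2.
have E : A = B.
  have h2 : h ^+ 2 != 0 by rewrite expf_neq0// gt_eqF.
  apply: (mulfI h2); rewrite -E1 -E2; ring.
have : `|A0 - B0'| < `|A0 - B0'|.
  rewrite {1}(_ : A0 - B0' = (A0 - A) - (B0' - B)); last by rewrite E; ring.
  apply: (le_lt_trans (ler_normB _ _)); lra.
by rewrite ltxx.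
Qed.

End CkReal.

Lemma Ck_id (R : realType) (V : normedModType R) k (U : set V) : Ck k U id.
Proof.
case: k => [|k]; first by split=> // x _; exact: cvg_id.
split; first by move=> x _; exact: cvg_id.
split=> [x v _|v]; first exact: derivable_id.
by rewrite (_ : 'D_v id = cst v); [exact: Ck_cst|apply/funext => x; exact: derive_id].
Qed.

Lemma differentiable_linear_approx (R : realType) (V W : normedModType R)
    (f : V -> W) (L : {linear V -> W}) (x : V) : continuous L ->
  (forall e, 0 < e -> exists2 d, 0 < d &
     forall h, `|h| < d -> `|f (x + h) - f x - L h| <= e * `|h|) ->
  differentiable f x.
Proof.
move=> cL h.
have D : f \o shift x = cst (f x) + L +o_ 0 id.
  apply/eqaddoP => e e0; have [d d0 dP] := h _ e0.
  apply/nbhs_normP; exists d => //= y /=; rewrite sub0r normrN => /dP.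
  suff -> : (f \o shift x - (cst (f x) + L)) y = f (x + y) - f x - L y by [].
  by rewrite -addrA -opprD (addrC x).
by apply/diff_locallyP; rewrite (diff_unique cL D).
Qed.

Section MatrixCk.
Variables (R : realType) (V : normedModType R).
Implicit Types (x v : V) (U : set V).

Lemma continuous_mxP m n (A : V -> 'M[R]_(m, n)) x :
  {for x, continuous A} <-> forall i j, {for x, continuous (fun y => A y i j)}.
Proof.
split=> [cA i j|cA].
  by apply: (@continuous_comp _ _ _ A (fun N : 'M[R]_(m, n) => N i j)) => //;
    exact: coord_continuous.
apply/cvgrPdist_le => e e0; near=> y.
rewrite /Num.Def.normr/= mx_normrE (bigmax_le _ (ltW e0))//= => i _.
rewrite !mxE/=.
move: i; near: y; apply: filter_forall => /= i.
exact: ((cvgrPdist_le _ _).1 (cA i.1 i.2)).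
Unshelve. all: by end_near. Qed.

Lemma Ck_mxP k U m n (A : V -> 'M[R]_(m, n)) : open U ->
  Ck k U A <-> forall i j, Ck k U (fun y => A y i j).
Proof.
move=> oU; elim: k A => [|k IH] A.
  split=> [[cA _] i j|cA]; split=> // x Ux.
    by have /continuous_mxP := cA x Ux; exact.
  by apply/continuous_mxP => i j; have [c _] := cA i j; exact: c.
split=> [[cA [dA hA]] i j|h]; split.
- by move=> x Ux; have /continuous_mxP := cA x Ux; exact.
- split=> [x v Ux|v]; first by have /derivable_mxP := dA x v Ux; exact.
  have /IH/(_ i j) h := hA v.
  by apply: Ck_ext h => // x Ux; rewrite derive_mx ?mxE//; exact: dA.
- by move=> x Ux; apply/continuous_mxP => i j; exact: Ck_continuous (h i j) Ux.
- have dA x v : U x -> derivable A x v.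
    by move=> Ux; apply/derivable_mxP => i j; have [_ [d _]] := h i j; exact: d.
  split=> // v; apply/IH => i j.
  have [_ [_ hv]] := h i j; apply: Ck_ext (hv v) => // x Ux.
  by rewrite derive_mx ?mxE//; exact: dA.
Qed.

Lemma Ck_entry k U m n (A : V -> 'M[R]_(m, n)) i j : open U ->
  Ck k U A -> Ck k U (fun y => A y i j).
Proof. by move=> oU CA; exact: ((Ck_mxP k A oU).1 CA). Qed.

Lemma derive_entry m n (A : V -> 'M[R]_(m, n)) x v i j : derivable A x v ->
  'D_v (fun y => A y i j) x = 'D_v A x i j.
Proof. by move=> dA; rewrite derive_mx// mxE. Qed.

Lemma is_derive_mxP m n (A : V -> 'M[R]_(m, n)) x v (D : 'M[R]_(m, n)) :
  (forall i j, is_derive x v (fun y => A y i j) (D i j)) -> is_derive x v A D.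
Proof.
move=> h; have dA : derivable A x v.
  by apply/derivable_mxP => i j; have [] := h i j.
by split=> //; apply/matrixP => i j; rewrite derive_mx// mxE; have [] := h i j.
Qed.

Lemma is_derive_mul (a b : V -> R) x v : derivable a x v -> derivable b x v ->
  is_derive x v (fun y => a y * b y) ('D_v a x * b x + a x * 'D_v b x).
Proof.
move=> da db.
have [dab E] := is_deriveM (derivableP da) (derivableP db).
split; first by [].
rewrite (_ : (fun y => a y * b y) = a * b)// E.
by rewrite /GRing.scale /= addrC (mulrC (b x)).
Qed.

Lemma is_derive_mulmx m n p (A : V -> 'M[R]_(m, n)) (B : V -> 'M[R]_(n, p))
    x v : derivable A x v -> derivable B x v ->
  is_derive x v (fun y => A y *m B y) ('D_v A x *m B x + A x *m 'D_v B x).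
Proof.
move=> dA dB; apply: is_derive_mxP => i j.
rewrite (_ : (fun y => _) = \sum_k (fun y => A y i k * B y k j)); last first.
  by apply/funext => y; rewrite mxE fct_sumE.
rewrite !mxE -big_split /=.
apply: is_derive_sum => k.
have dAk : derivable (fun y => A y i k) x v := (derivable_mxP A x v).1 dA _ _.
have dBk : derivable (fun y => B y k j) x v := (derivable_mxP B x v).1 dB _ _.
rewrite -(derive_entry k j dB) -(derive_entry i k dA).
exact: (is_derive_mul dAk dBk).
Qed.

Lemma derive_mulmx m n p (A : V -> 'M[R]_(m, n)) (B : V -> 'M[R]_(n, p)) x v :
  derivable A x v -> derivable B x v ->
  'D_v (fun y => A y *m B y) x = 'D_v A x *m B x + A x *m 'D_v B x.
Proof. by move=> dA dB; have [] := is_derive_mulmx dA dB. Qed.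

Lemma is_derive_tr m n (A : V -> 'M[R]_(m, n)) x v :
  derivable A x v -> is_derive x v (fun y => (A y)^T) ('D_v A x)^T.
Proof.
move=> dA; apply: is_derive_mxP => i j; rewrite mxE -derive_entry//.
rewrite (_ : (fun y => _) = (fun y => A y j i)); last first.
  by apply/funext => y; rewrite mxE.
by apply: derivableP; exact: ((derivable_mxP A x v).1 dA).
Qed.

Lemma derive_tr m n (A : V -> 'M[R]_(m, n)) x v :
  derivable A x v -> 'D_v (fun y => (A y)^T) x = ('D_v A x)^T.
Proof. by move=> dA; have [] := is_derive_tr dA. Qed.

Lemma Ck_mulmx k U m n p (A : V -> 'M[R]_(m, n)) (B : V -> 'M[R]_(n, p)) :
  open U -> Ck k U A -> Ck k U B -> Ck k U (fun y => A y *m B y).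
Proof.
move=> oU /Ck_mxP-/(_ oU) CA /Ck_mxP-/(_ oU) CB; apply/Ck_mxP => // i j.
apply: Ck_ext (@Ck_sum _ _ _ k U _ (index_enum 'I_n) xpredT
  (fun l y => A y i l * B y l j) oU _) => //.
  by move=> x _; rewrite mxE.
by move=> l _; exact: CkM.
Qed.

Lemma Ck_tr k U m n (A : V -> 'M[R]_(m, n)) : open U ->
  Ck k U A -> Ck k U (fun y => (A y)^T).
Proof.
move=> oU /Ck_mxP-/(_ oU) CA; apply/Ck_mxP => // i j.
by apply: Ck_ext (CA j i) => // x _; rewrite mxE.
Qed.

Lemma Ck_det k U n (A : V -> 'M[R]_n) : open U ->
  Ck k U A -> Ck k U (fun y => \det (A y)).
Proof.
move=> oU /Ck_mxP-/(_ oU) CA.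
apply: Ck_sum => // s _; apply: CkM => //; first exact: Ck_cst.
by apply: Ck_prod => // i _; exact: CA.
Qed.

Lemma Ck_invmx k U n (A : V -> 'M[R]_n) : open U ->
  (forall x, U x -> A x \in unitmx) -> Ck k U A -> Ck k U (fun y => invmx (A y)).
Proof.
move=> oU uA CA; apply/Ck_mxP => // i j.
have dA : forall x, U x -> \det (A x) != 0.
  by move=> x /uA; rewrite unitmxE unitfE.
have Cd := CkV oU dA (Ck_det oU CA).
apply: (@Ck_ext _ _ _ _ _ (fun y => (\det (A y))^-1 *
    ((-1) ^+ (j + i) * \det (row' j (col' i (A y)))))) => //.
  by move=> x Ux; rewrite /invmx uA// !mxE.
apply: CkM => //; apply: CkM => //; first exact: Ck_cst.
apply: Ck_det => //; apply/Ck_mxP => // r s.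
move/Ck_mxP : CA => /(_ oU (lift j r) (lift i s)).
by apply: Ck_ext => // x _; rewrite !mxE.
Qed.

Lemma schwarz_mx U m n (A : V -> 'M[R]_(m, n)) x u v :
  open U -> Ck 2 U A -> U x -> 'D_v ('D_u A) x = 'D_u ('D_v A) x.
Proof.
move=> oU CA Ux; apply/matrixP => i j.
have E w z : 'D_w ('D_z A) x i j = 'D_w ('D_z (fun y => A y i j)) x.
  rewrite -derive_entry; last exact: Ck_derivable (Ck_derive z CA) Ux.
  apply: (@eq_on_derive _ _ _ U) => // y Uy; rewrite derive_entry//.
  exact: Ck_derivable CA Uy.
have S := schwarz_derive u v oU (Ck_entry i j oU CA) Ux.
by rewrite -(E v u) -(E u v) in S; exact: S.
Qed.

Lemma derive_mx_dirD U m n (A : V -> 'M[R]_(m, n)) x u v :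
  open U -> Ck 1 U A -> U x -> 'D_(u + v) A x = 'D_u A x + 'D_v A x.
Proof.
move=> oU CA Ux; have dA w := Ck_derivable (v := w) CA Ux.
apply/matrixP => i j; rewrite mxE -!derive_entry//.
by have [] := is_derive_dirD u v oU (Ck_entry i j oU CA) Ux.
Qed.

Lemma derive_mx_dirZ U m n (A : V -> 'M[R]_(m, n)) x a v :
  Ck 1 U A -> U x -> 'D_(a *: v) A x = a *: 'D_v A x.
Proof.
by move=> CA Ux; have [] := is_derive_dirZ a (Ck_derivable (v := v) CA Ux).
Qed.

Lemma derive_mx_sum U m n (A : V -> 'M[R]_(m, n)) x (I : Type) (r : seq I)
    (P : pred I) (a : I -> R) (w : I -> V) : open U -> Ck 1 U A -> U x ->
  'D_(\sum_(i <- r | P i) a i *: w i) A x = \sum_(i <- r | P i) a i *: 'D_(w i) A x.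
Proof.
move=> oU CA Ux; elim/big_rec2: _ => [|i y1 y2 _ IH]; first exact: derive0.
by rewrite (derive_mx_dirD _ _ oU CA Ux) IH (derive_mx_dirZ _ _ CA Ux).
Qed.

End MatrixCk.

(** * Row spaces, contractions and frames *)

Section RowSpace.
Variables (R : realType) (m : nat).
Implicit Types (x v : 'rV[R]_m) (U : set 'rV[R]_m).

Lemma derive_mx_row U p q (A : 'rV[R]_m -> 'M[R]_(p, q)) x v :
  open U -> Ck 1 U A -> U x ->
  'D_v A x = \sum_i v 0 i *: 'D_(delta_mx 0 i) A x.
Proof. by move=> oU CA Ux; rewrite {1}[v]row_sum_delta (derive_mx_sum _ _ _ _ oU CA Ux). Qed.

Lemma derive_row U (f : 'rV[R]_m -> R) x v : open U -> Ck 1 U f -> U x ->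
  'D_v f x = \sum_i v 0 i * 'D_(delta_mx 0 i) f x.
Proof.
move=> oU Cf Ux; rewrite {1}[v]row_sum_delta.
elim/big_rec2: _ => [|i y1 y2 _ IH]; first exact: derive0.
have df := Ck_derivable (v := delta_mx 0 i) Cf Ux.
have [_ ->] := is_derive_dirD (v 0 i *: delta_mx 0 i) y2 oU Cf Ux.
by have [_ ->] := is_derive_dirZ (v 0 i) df; rewrite IH.
Qed.

(** Along the segment from [x] to [x + h] the mean value theorem expresses the error as a sum of
    coordinates of [h] times increments of the partial derivatives, and each increment is small by
    continuity. *)
Lemma Ck_differentiable_real U (f : 'rV[R]_m -> R) x :
  open U -> Ck 1 U f -> U x -> differentiable f x.
Proof.
move=> oU Cf Ux; pose c : 'cV[R]_m := \col_i 'D_(delta_mx 0 i) f x.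
pose L0 v := (v *m c) 0 0.
have L0_lin : linear (L0 : 'rV[R]_m -> R).
  by move=> a u v; rewrite /L0 mulmxDl -scalemxAl mxE [X in X + _]mxE.
pose LM := GRing.isLinear.Build _ _ _ _ _ L0_lin.
pose L : {linear 'rV[R]_m -> R} := HB.pack L0 LM.
have LE v : L v = 'D_v f x.
  rewrite (derive_row _ oU Cf Ux) /L /= /L0 mxE.
  by apply: eq_bigr => i _; rewrite !mxE.
have cL : continuous L.
  move=> y; rewrite (_ : (L : 'rV[R]_m -> R) = fun v => \sum_i v 0 i * c i 0).
    apply: (@Ck_continuous _ _ _ 0%N setT) => //.
    apply: Ck_sum => [|i _]; first exact: openT.
    apply: CkM; [exact: openT| |exact: Ck_cst].
    by apply: (@Ck_entry _ _ _ _ _ _ id); [exact: openT|exact: Ck_id].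
  by apply/funext => v; rewrite /L /= /L0 mxE.
move: L LE cL => {LM L0 L0_lin c} L LE cL.
apply: (differentiable_linear_approx cL) => e e0.
(* The tolerance is shared among the [m] coordinates; dividing by [m + 1] also covers [m = 0]. *)
have m0 : 0 < (m%:R + 1 : R) by rewrite ltr_wpDl.
  have e1 : 0 < e / (m%:R + 1) by rewrite divr_gt0.
  have [d /= d0 dP] : exists2 d, 0 < d & forall y, `|x - y| < d -> U y /\
      forall i, `|'D_(delta_mx 0 i) f x - 'D_(delta_mx 0 i) f y| <= e / (m%:R + 1).
    have /nbhs_normP[d d0 dP] : \forall y \near x, U y /\
      forall i, `|'D_(delta_mx 0 i) f x - 'D_(delta_mx 0 i) f y| <= e / (m%:R + 1).
      have n1 := near_open oU Ux.
      have n2 : \forall y \near x, forall i,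
        `|'D_(delta_mx 0 i) f x - 'D_(delta_mx 0 i) f y| <= e / (m%:R + 1).
        suff h (i : 'I_m) : \forall y \near x,
          `|'D_(delta_mx 0 i) f x - 'D_(delta_mx 0 i) f y| <= e / (m%:R + 1).
          exact: (@filter_forall _ _ (fun (i : 'I_m) y =>
            `|'D_(delta_mx 0 i) f x - 'D_(delta_mx 0 i) f y| <= e / (m%:R + 1)) _ _ h).
        have cDi := Ck_continuous (Ck_derive (delta_mx 0 i) Cf) Ux.
        by have /cvgrPdist_le := cDi; exact.
      exact: filterI n1 n2.
    by exists d => // y yd; apply: dP.
  exists d => // h hd.
  have Us s : 0 <= s <= 1 -> `|x - (x + s *: h)| < d.
    move=> /andP[s0 s1]; rewrite opprD addNKr normrN normrZ ger0_norm//.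
    by rewrite (le_lt_trans _ hd)// ler_piMl.
  have [s sI E] := @MVT_line _ _ f x h
    (fun s sI => Ck_derivable Cf (proj1 (dP _ (Us s sI)))).
  have [Uy Dy] := dP _ (Us _ sI).
  rewrite [X in `|X|](_ : _ =
      - \sum_i h 0 i * ('D_(delta_mx 0 i) f x - 'D_(delta_mx 0 i) f (x + s *: h))).
    rewrite normrN (le_trans (ler_norm_sum _ _ _))//.
    have : \sum_(i < m) `|h| * (e / (m%:R + 1)) <= e * `|h|.
      rewrite sumr_const card_ord -[X in X <= _]mulr_natr.
      have -> : `|h| * (e / (m%:R + 1)) * m%:R = e * `|h| * (m%:R / (m%:R + 1)).
        by ring.
      by rewrite ler_piMr// ?mulr_ge0// ?(ltW e0)// ler_pdivrMr// mul1r lerDl.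
    apply: le_trans; apply: ler_sum => i _; rewrite normrM ler_pM//.
    rewrite [leRHS]/Num.Def.normr/= mx_normrE.
    exact: (le_bigmax _ (fun k : 'I_1 * 'I_m => `|h k.1 k.2|) (0, i)).
  rewrite LE.
  under eq_bigr do rewrite mulrBr.
  by rewrite sumrB -(derive_row _ oU Cf Ux) -(derive_row _ oU Cf Uy) -E; ring.
Qed.

Lemma Ck_differentiable U n (f : 'rV[R]_m -> 'rV[R]_n) x :
  open U -> Ck 1 U f -> U x -> differentiable f x.
Proof.
move=> oU Cf Ux.
rewrite (_ : f = \sum_(j < n) (fun y => f y 0 j *: delta_mx 0 j)); last first.
  by apply/funext => y; rewrite fct_sumE -row_sum_delta.
apply: differentiable_sum => j; apply: differentiableZl.
exact: (Ck_differentiable_real oU (Ck_entry 0 j oU Cf) Ux).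
Qed.

End RowSpace.

Section ChainRule.
Variables (R : realType) (m n : nat).

Lemma is_derive_comp_row (U : set 'rV[R]_n) (f : 'rV[R]_m -> 'rV[R]_n)
    (g : 'rV[R]_n -> R) x v :
  open U -> Ck 1 U g -> U (f x) -> differentiable f x ->
  is_derive x v (g \o f) ('D_('D_v f x) g (f x)).
Proof.
move=> oU Cg Ufx df; have dg := Ck_differentiable_real oU Cg Ufx.
have dgf : differentiable (g \o f) x by exact: differentiable_comp.
split; first exact: diff_derivable.
by rewrite (deriveE v dgf) (diff_comp df dg) /= (deriveE v df) (deriveE _ dg).
Qed.

Lemma is_derive_comp_mx (U : set 'rV[R]_n) p q (f : 'rV[R]_m -> 'rV[R]_n)
    (g : 'rV[R]_n -> 'M[R]_(p, q)) x v :
  open U -> Ck 1 U g -> U (f x) -> differentiable f x ->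
  is_derive x v (g \o f) ('D_('D_v f x) g (f x)).
Proof.
move=> oU Cg Ufx df; apply: is_derive_mxP => i j.
have Cg' := Ck_entry i j oU Cg.
rewrite -derive_entry; last exact: Ck_derivable Cg Ufx.
exact: (is_derive_comp_row _ oU Cg' Ufx df).
Qed.

End ChainRule.

Section Contraction.
Variables (R : comUnitRingType) (m : nat) (W : lmodType R).
Local Notation e_ i := (delta_mx 0 i : 'rV[R]_m).

Definition bilin (B : 'rV[R]_m -> 'rV[R]_m -> W) :=
  (forall v, linear (B ^~ v)) /\ (forall u, linear (B u)).

Lemma bilin_suml B (I : Type) (r : seq I) (P : pred I) (a : I -> R) w v :
  bilin B ->
  B (\sum_(i <- r | P i) a i *: w i) v = \sum_(i <- r | P i) a i *: B (w i) v.
Proof.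
move=> [Bl _]; elim/big_rec2: _ => [|i y1 y2 _ <-]; last exact: Bl.
by have := Bl v (-1) 0 0; rewrite scaleN1r oppr0 add0r scaleN1r addNr.
Qed.

Lemma bilin_sumr B (I : Type) (r : seq I) (P : pred I) (a : I -> R) w v :
  bilin B ->
  B v (\sum_(i <- r | P i) a i *: w i) = \sum_(i <- r | P i) a i *: B v (w i).
Proof.
move=> [_ Br]; elim/big_rec2: _ => [|i y1 y2 _ <-]; last exact: Br.
by have := Br v (-1) 0 0; rewrite scaleN1r oppr0 add0r scaleN1r addNr.
Qed.

Lemma bilinDr B u v w : bilin B -> B u (v + w) = B u v + B u w.
Proof. by move=> [_ h]; have := h u 1 v w; rewrite !scale1r. Qed.

Lemma bilinDl B u v w : bilin B -> B (u + v) w = B u w + B v w.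
Proof. by move=> [h _]; have := h w 1 u v; rewrite !scale1r. Qed.

(** Under a contraction over the basis, a matrix moves from one argument of a bilinear form to the
    other at the price of a transpose. *)
Lemma bilin_contract B (A A' : 'M[R]_m) : bilin B ->
  \sum_r B (e_ r *m A^T) (e_ r *m A') = \sum_k B (e_ k) (e_ k *m (A *m A')).
Proof.
move=> bB; transitivity (\sum_r \sum_k A k r *: B (e_ k) (e_ r *m A')).
  apply: eq_bigr => r _; rewrite -bilin_suml//; congr (B _ _).
  rewrite [LHS]row_sum_delta; apply: eq_bigr => k _.
  by rewrite -rowE !mxE.
rewrite exchange_big /=; apply: eq_bigr => k _.
rewrite -bilin_sumr//; congr (B _ _).
rewrite mulmxA [e_ k *m A]row_sum_delta mulmx_suml; apply: eq_bigr => r _.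
by rewrite -scalemxAl -(rowE k A) mxE.
Qed.

Lemma bilin_contract1 B (A : 'M[R]_m) : bilin B ->
  \sum_r B (e_ r *m A^T) (e_ r) = \sum_k B (e_ k) (e_ k *m A).
Proof.
move=> bB; rewrite -[A in RHS]mulmx1 -bilin_contract//.
by apply: eq_bigr => r _; rewrite mulmx1.
Qed.

(** [B] is skew on the image of [P], and the symmetric matrix [C] lives there on both sides, so the
    contraction equals its own opposite. The sum is doubled because 2 may fail to be invertible in
    the ring. *)
Lemma bilin_alt_contract B (P C : 'M[R]_m) : bilin B ->
  (forall y, B (y *m P) (y *m P) = 0) -> C^T = C -> C *m P = C ->
  \sum_r B (e_ r *m C) (e_ r) + \sum_r B (e_ r *m C) (e_ r) = 0.
Proof.
move=> bB alt CT CP.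
have anti u v : B (u *m P) (v *m P) = - B (v *m P) (u *m P).
  apply/eqP; rewrite -addr_eq0; apply/eqP.
  have := alt (u + v); rewrite mulmxDl bilinDl// !bilinDr// !alt add0r addr0.
  by [].
have PC : P^T *m C = C by rewrite -[in LHS]CT -trmx_mul CP CT.
have E : \sum_r B (e_ r *m C) (e_ r) = \sum_r B (e_ r *m C *m P) (e_ r *m P).
  have -> : \sum_r B (e_ r *m C *m P) (e_ r *m P) =
            \sum_k B (e_ k) (e_ k *m (C *m P)).
    rewrite -bilin_contract//.
    by apply: eq_bigr => r _; rewrite CT -(mulmxA _ C P) CP.
  by rewrite CP -bilin_contract1// CT.
have E2 : \sum_r B (e_ r *m C *m P) (e_ r *m P)
    = \sum_r B (e_ r *m P) (e_ r *m C *m P).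
  transitivity (\sum_r B (e_ r *m P^T^T) (e_ r *m C)); last first.
    by apply: eq_bigr => r _; rewrite trmxK -mulmxA CP.
  rewrite bilin_contract// PC -bilin_contract1//.
  by rewrite CT E.
rewrite E; apply/eqP; rewrite addr_eq0; apply/eqP.
rewrite {1}E2 -sumrN; apply: eq_bigr => r _.
by rewrite anti.
Qed.

End Contraction.

Section OrthonormalFrames.
Variables (R : realType).

Definition posdef m (A : 'M[R]_m) :=
  A^T = A /\ forall v : 'rV[R]_m, v != 0 -> 0 < dot A v v.

Lemma posdef_unit m (A : 'M[R]_m) : posdef A -> A \in unitmx.
Proof.
case=> _ pA; rewrite -row_free_unit -kermx_eq0; apply/eqP/row_matrixP => i.
rewrite row0; apply/eqP/negPn/negP => /pA; rewrite /dot.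
by rewrite -row_mul mulmx_ker row0 mul0mx mxE ltxx.
Qed.

Lemma posdef_sub m k (A : 'M[R]_m) (B : 'M[R]_(k, m)) :
  posdef A -> row_free B -> posdef (B *m A *m B^T).
Proof.
case=> sA pA fB; split; first by rewrite !trmx_mul trmxK sA mulmxA.
move=> v v0; have : v *m B != 0 by rewrite mulmx_free_eq0.
by move=> /pA; rewrite /dot trmx_mul !mulmxA.
Qed.

(** Gram-Schmidt by induction on the size: split off the first pivot and pass to the Schur
    complement. *)
Lemma posdef_orthonormalize k (N : 'M[R]_k) :
  posdef N -> exists T : 'M[R]_k, T *m N *m T^T = 1%:M.
Proof.
elim: k N => [|k IH] N pN.
  by exists 1%:M; apply/matrixP => -[].
pose N' : 'M[R]_(1 + k) := N.
have [sN posN] : posdef N' := pN.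
pose a := N' 0 0.
have a0 : 0 < a.
  have := posN (delta_mx 0 0); rewrite /dot -rowE trmx_delta -colE !mxE.
  by apply; apply/eqP => /matrixP/(_ 0 0)/eqP; rewrite !mxE !eqxx oner_eq0.
pose b : 'rV[R]_k := ursubmx N'.
pose D := drsubmx N'.
have NE : N' = block_mx a%:M b b^T D.
  rewrite -[N' in LHS]submxK; congr block_mx.
    by apply/matrixP => i j; rewrite !ord1 !mxE eqxx mulr1n; congr (N' _ _);
      apply/val_inj.
  by rewrite -[in LHS]sN /b; apply/matrixP => i j; rewrite !mxE.
(* [L] clears the first column below the pivot [a]; congruence by [L] leaves [a] and the Schur
   complement [S], which inherits positivity. *)
pose L : 'M[R]_(1 + k) := block_mx 1%:M 0 (- a^-1 *: b^T) 1%:M.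
pose S := D - a^-1 *: (b^T *m b).
have LNL : L *m N' *m L^T = block_mx a%:M 0 0 S.
  rewrite NE tr_block_mx !mulmx_block !mul1mx !mul0mx !addr0 !trmx1 !trmx0.
  rewrite !mulmx0 !mulmx1 !addr0 -!scalemxAl mul_mx_scalar scalerA.
  rewrite mulNr mulVf ?gt_eqF// scaleN1r addNr.
  rewrite linearZ /= trmxK mul_scalar_mx scalerA mulrN divff ?gt_eqF//.
  by rewrite scaleN1r addNr mul0mx add0r /S addrC scaleNr.
have Lfree : row_free L.
  by rewrite row_free_unit unitmxE det_lblock !det1 mulr1 unitr1.
have [T TS] : exists T : 'M[R]_k, T *m S *m T^T = 1%:M.
  apply: IH; have [sL pL] := posdef_sub (conj sN posN) Lfree.
  move: sL pL; rewrite LNL => sL pL; split.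
    by move: sL; rewrite tr_block_mx => /eq_block_mx[_ _ _].
  move=> v v0; have := pL (row_mx 0 v).
  rewrite /dot mul_row_block !mul0mx !mulmx0 !add0r tr_row_mx mul_row_col.
  rewrite trmx0 mulmx0 add0r; apply.
  by rewrite row_mx_eq0 eqxx.
pose c := (Num.sqrt a)^-1.
pose Q : 'M[R]_(1 + k) := block_mx c%:M 0 0 T.
exists (Q *m L).
have -> : Q *m L *m N *m (Q *m L)^T = Q *m (L *m N' *m L^T) *m Q^T.
  by rewrite (trmx_mul Q L) !mulmxA.
rewrite LNL /Q tr_block_mx !mulmx_block !mul0mx !mulmx0 !trmx0 !mulmx0.
rewrite ?(addr0, add0r, mul0mx) TS tr_scalar_mx -!scalar_mxM.
have -> : c * a * c = 1.
  rewrite mulrAC -invfM -expr2 sqr_sqrtr ?ltW// mulVf// gt_eqF//.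
by rewrite -scalar_mx_block.
Qed.

Variables (m : nat).
Implicit Types A D : 'M[R]_m.

(** [onframe] is an [xget] with default 0, so it is a frame only once one is exhibited: the row
    basis of [D], orthonormalized through its Gram matrix. *)
Lemma onframeP A D : posdef A -> is_onframe A (onframe A D).
Proof.
move=> pA; have [T TN] := posdef_orthonormalize (posdef_sub pA (row_base_free D)).
rewrite /onframe; case: xgetP => [E _ //|].
move=> /(_ (T *m row_base D)); case; split; last first.
  by rewrite trmx_mul !mulmxA -(mulmxA _ A) -!(mulmxA T) !mulmxA -TN !mulmxA.
have uT : T \in unitmx.
  by have /mulmx1_unit[] : T *m (row_base D *m A *m (row_base D)^T *m T^T) = 1%:M
    by rewrite -TN !mulmxA.
apply/eqmxP; apply: eqmx_trans (eq_row_base D).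
by apply: eqmxMfull; rewrite row_full_unit.
Qed.

(* The orthoprojector onto [D] is [A *m cofr A D], and [cofr A D] is the
   metric on covectors restricted to [D]; unlike the projector, it is symmetric. *)
Definition cofr A D : 'M[R]_m := (onframe A D)^T *m onframe A D.

Lemma cofr_sym A D : (cofr A D)^T = cofr A D.
Proof. by rewrite /cofr trmx_mul trmxK. Qed.

Lemma cofr_sub A D : posdef A -> (cofr A D <= D)%MS.
Proof.
move=> pA; have [/eqmxP eD _] := onframeP D pA.
by rewrite /cofr (submx_trans (submxMl _ _))// eD.
Qed.

Lemma cofr_id A D k (B : 'M[R]_(k, m)) : posdef A -> (B <= D)%MS ->
  B *m A *m cofr A D = B.
Proof.
move=> pA BD; have [/eqmxP eD oE] := onframeP D pA.
move: BD; rewrite -eD => /submxP[X ->]; rewrite /cofr.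
move: (onframe A D) oE X => F oE X.
have -> : X *m F *m A *m (F^T *m F) = X *m (F *m A *m F^T) *m F.
  by rewrite !mulmxA.
by rewrite oE mulmx1.
Qed.

(** [C *m A *m cofr A D] equals [C] on one reading and, after transposition, [cofr A D] on the
    other. Later formulas for [cofr] (in a local basis, for the Reeb direction, in another chart)
    all rest on this characterization, which mentions no frame. *)
Lemma cofr_uniq A D C : posdef A -> C^T = C -> (C <= D)%MS ->
  D *m A *m C = D -> C = cofr A D.
Proof.
move=> pA sC CD DC; have [sA _] := pA.
have E1 : C *m A *m cofr A D = C by apply: cofr_id.
have E2 : cofr A D *m A *m C = cofr A D.
  by have /submxP[Y ->] := cofr_sub D pA; rewrite -!mulmxA (mulmxA D) DC.
by rewrite -{1}E1 -{1}sC -{1}sA -{1}(cofr_sym A D) -!trmx_mul mulmxA E2 cofr_sym.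
Qed.

(** The inverse Gram matrix formula shows [cofr] as a rational function of the metric and of any
    basis, hence regular in the point, which the chosen frames need not be. *)
Lemma cofr_basis A D k (B : 'M[R]_(k, m)) : posdef A -> (B == D)%MS ->
  \rank D = k ->
  B *m A *m B^T \in unitmx /\
  cofr A D = B^T *m invmx (B *m A *m B^T) *m B.
Proof.
move=> pA /eqmxP eB rD.
have fB : row_free B by rewrite /row_free eB rD.
have uN := posdef_unit (posdef_sub pA fB).
have [sA _] := pA.
split=> //; symmetry; apply: cofr_uniq => //.
- by rewrite !trmx_mul trmxK trmx_inv !trmx_mul trmxK sA !mulmxA.
- by rewrite (submx_trans (submxMl _ _))// eB.
- have /submxP[X ->] : (D <= B)%MS by rewrite eB.
  rewrite -!mulmxA; congr (_ *m _); rewrite !mulmxA.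
  by rewrite mulmxV// mul1mx.
Qed.

(** The kernel is the orthogonal complement of [D] and meets it in 0 by positivity. The candidate
    [P] has its rows in [D], and [1 - P] has its rows in the kernel; splitting the identity
    accordingly computes [proj_mx]. *)
Lemma proj_cofr A D : posdef A ->
  proj_mx D (kermx (A *m D^T)) = A *m cofr A D.
Proof.
move=> pA; have [sA posA] := pA.
set K := kermx _; set P := A *m cofr A D.
have PD : (P <= D)%MS by rewrite (submx_trans (submxMl _ _))// cofr_sub.
have DP : D *m P = D by rewrite /P mulmxA; apply: cofr_id.
have capDK : (D :&: K)%MS = 0.
  apply/eqP; rewrite -submx0; apply/rV_subP => v; rewrite sub_capmx => /andP[vD vK].
  apply/negPn/negP; rewrite submx0 => /posA; rewrite /dot.
  have /submxP[X vX] := vD.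
  rewrite {2}vX trmx_mul mulmxA -(mulmxA v).
  by move/sub_kermxP : vK => ->; rewrite mul0mx mxE ltxx.
have QK : (1%:M - P <= K)%MS.
  apply/sub_kermxP; rewrite mulmxBl mul1mx -[X in _ - X]mulmxA.
  rewrite (mulmxA (cofr A D)).
  have -> : cofr A D *m A *m D^T = D^T.
    apply: trmx_inj; rewrite trmx_mul trmxK (trmx_mul (cofr A D) A) sA.
    rewrite cofr_sym mulmxA.
    exact: cofr_id.
  by rewrite subrr.
have : 1%:M *m proj_mx D K = P.
  rewrite -{1}[1%:M](subrK P) mulmxDl proj_mx_0// add0r.
  by rewrite proj_mx_id.
by rewrite mul1mx.
Qed.

End OrthonormalFrames.

(** Proves additive identities between matrices entrywise. Products and derivatives are generalized
    first, so that [mxE] does not expand them and [ring] sees atoms. *)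
Ltac mxring :=
  first [
    solve [repeat match goal with
      | |- context [@mulmx ?R ?m ?n ?p ?A ?B] =>
        generalize (@mulmx R m n p A B); intro
      end;
      repeat match goal with
      | |- context [@derive ?K ?V ?W ?f ?a ?v] =>
        generalize (@derive K V W f a v); intro
      end;
      apply/matrixP => ? ?; rewrite !mxE; ring]
  | apply/matrixP => ? ?; rewrite !mxE; ring ].

Lemma skew_form (R : comNzRingType) m (M A : 'M[R]_m) (v w : 'rV[R]_m) :
  M *m A + A *m M^T = 0 -> A^T = A ->
  (v *m M *m A *m w^T) 0 0 = - (w *m M *m A *m v^T) 0 0.
Proof.
move=> /eqP; rewrite addr_eq0 => /eqP E sA.
rewrite -(mulmxA v) E mulmxN mulNmx mxE; congr (- _).
have -> : v *m (A *m M^T) *m w^T = (w *m M *m A *m v^T)^T.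
  by rewrite !trmx_mul trmxK sA !mulmxA.
by rewrite mxE.
Qed.

(** Used with [A], [B] the derivatives along [u], [v] of [Gam v], [Gam u], and [C = Gam u],
    [D = Gam v]. The hypothesis is then the equality of the mixed second derivatives of the metric,
    and the conclusion is the skewness of the curvature. *)
Lemma curvature_metric_alg (R : comNzRingType) m (A B C D G : 'M[R]_m) :
  A *m G + D *m (C *m G + G *m C^T) + ((C *m G + G *m C^T) *m D^T + G *m A^T)
  = B *m G + C *m (D *m G + G *m D^T) + ((D *m G + G *m D^T) *m C^T + G *m B^T) ->
  (A - B + D *m C - C *m D) *m G + G *m (A - B + D *m C - C *m D)^T = 0.
Proof.
move=> S; apply/eqP; rewrite -subr_eq0 subr0; apply/eqP.
rewrite (_ : _ + _ =
  (A *m G + D *m (C *m G + G *m C^T) + ((C *m G + G *m C^T) *m D^T + G *m A^T))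
  - (B *m G + C *m (D *m G + G *m D^T) + ((D *m G + G *m D^T) *m C^T + G *m B^T))).
  by rewrite S subrr.
rewrite !linearD !linearN /= !trmx_mul.
rewrite !(mulmxDl, mulmxDr, mulmxN, mulNmx) !mulmxA.
mxring.
Qed.

Lemma curvature_row_alg (R : comNzRingType) m (A B C D : 'M[R]_m) (w : 'rV_m) :
  w *m A + w *m D *m C - (w *m B + w *m C *m D)
  = w *m (A - B + D *m C - C *m D).
Proof. by rewrite !mulmxDr !mulmxN !mulmxA; mxring. Qed.

Lemma bianchi_alg (R : comNzRingType) m (u v w : 'rV[R]_m)
    (Auv Avu Avw Awv Awu Auw Gu Gv Gw : 'M[R]_m) :
  w *m Gv = v *m Gw -> u *m Gw = w *m Gu -> v *m Gu = u *m Gv ->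
  w *m Auv = v *m Auw -> u *m Avw = w *m Avu -> v *m Awu = u *m Awv ->
  w *m (Auv - Avu + Gv *m Gu - Gu *m Gv) + u *m (Avw - Awv + Gw *m Gv - Gv *m Gw)
  + v *m (Awu - Auw + Gu *m Gw - Gw *m Gu) = 0.
Proof.
move=> h1 h2 h3 h4 h5 h6.
rewrite !(mulmxDr, mulmxN) !mulmxA h1 h2 h3 h4 h5 h6.
mxring.
Qed.

(** * Connection and curvature in a chart *)

Section LeviCivita.
Variables (R : realType) (m : nat).
Local Notation e_ i := (delta_mx 0 i : 'rV[R]_m).
Implicit Types (G : 'rV[R]_m -> 'M[R]_m) (x u v w z : 'rV[R]_m).

Lemma lin_row_sum (W : lmodType R) (F : 'rV[R]_m -> W) u :
  linear F -> F u = \sum_i u 0 i *: F (e_ i).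
Proof.
move=> lF; rewrite {1}[u]row_sum_delta.
elim/big_rec2: _ => [|i y1 y2 _ <-]; last exact: lF.
by have := lF (-1) 0 0; rewrite scaleN1r oppr0 add0r scaleN1r addNr.
Qed.

(* Row convention: [nabla_u Y = 'D_u Y + Y *m Gam G x u]. *)
Definition Gam G x u : 'M[R]_m :=
  \matrix_(j, k) \sum_i u 0 i * christoffel G x k i j.

Lemma Gam_lin G x : linear (Gam G x).
Proof.
move=> a u v; apply/matrixP => j k; rewrite !mxE mulr_sumr -big_split /=.
by apply: eq_bigr => i _; rewrite !mxE mulrDl mulrA.
Qed.

Lemma Gam_sum G x u : Gam G x u = \sum_i u 0 i *: Gam G x (e_ i).
Proof. exact/lin_row_sum/Gam_lin. Qed.

Lemma Gam0 G x : Gam G x 0 = 0.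
Proof. by rewrite Gam_sum big1// => i _; rewrite mxE scale0r. Qed.

Lemma GamD G x u v : Gam G x (u + v) = Gam G x u + Gam G x v.
Proof. by have := Gam_lin G x 1 u v; rewrite !scale1r. Qed.

Lemma GamZ G x a u : Gam G x (a *: u) = a *: Gam G x u.
Proof. by have := Gam_lin G x a u 0; rewrite !addr0 Gam0 addr0. Qed.

Lemma Gam_delta G x i j k : Gam G x (e_ i) j k = christoffel G x k i j.
Proof.
rewrite mxE (bigD1 i)//= big1 ?addr0; first by rewrite mxE !eqxx mul1r.
by move=> l li; rewrite mxE (negbTE li) andbF mul0r.
Qed.

Lemma nablaE G X Y x :
  nabla G X Y x = 'D_(X x) Y x + Y x *m Gam G x (X x).
Proof.
congr (_ + _); apply/rowP => k; rewrite !mxE exchange_big /=.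
apply: eq_bigr => j _; rewrite mxE mulr_sumr; apply: eq_bigr => i _.
by rewrite mulrA [X in X * _]mulrC.
Qed.

(* Curvature: [R(u, v) w = w *m Rm G x u v]. *)
Definition Rm G x u v : 'M[R]_m :=
  'D_u (fun y => Gam G y v) x - 'D_v (fun y => Gam G y u) x
  + Gam G x v *m Gam G x u - Gam G x u *m Gam G x v.

Variables (U : set 'rV[R]_m) (G : 'rV[R]_m -> 'M[R]_m).
Hypothesis oU : open U.
Hypothesis GC : Ck 3 U G.
Hypothesis Gpos : forall x, U x -> posdef (G x).

Let Gsym x : U x -> (G x)^T = G x. Proof. by case/Gpos. Qed.
Let Gunit x : U x -> G x \in unitmx. Proof. by move/Gpos/posdef_unit. Qed.

Let pd_sym x a b c : U x ->
  'D_(e_ a) (fun y => G y b c) x = 'D_(e_ a) (fun y => G y c b) x.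
Proof.
move=> Ux; apply: (@eq_on_derive _ _ _ U) => // y Uy.
by rewrite -[in RHS]Gsym// mxE.
Qed.

Lemma christoffel_sym x i j k : U x ->
  christoffel G x k i j = christoffel G x k j i.
Proof.
move=> Ux; congr (_ * _); apply: eq_bigr => l _; congr (_ * _).
by rewrite (pd_sym l i j Ux) [X in X - _]addrC.
Qed.

Lemma Gam_sym x u v : U x -> v *m Gam G x u = u *m Gam G x v.
Proof.
move=> Ux; apply/rowP => k; rewrite !mxE.
under eq_bigr do rewrite mxE mulr_sumr.
under [RHS]eq_bigr do rewrite mxE mulr_sumr.
rewrite exchange_big /=; apply: eq_bigr => i _; apply: eq_bigr => j _.
by rewrite (christoffel_sym _ _ _ Ux) mulrCA.
Qed.

Lemma Ck_christoffel i j k : Ck 2 U (fun y => christoffel G y k i j).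
Proof.
apply: CkM => //; first exact: Ck_cst.
apply: Ck_sum => // l _; apply: CkM => //.
  by apply: (Ck_entry k l oU); apply: Ck_invmx => //; exact: Ck_le GC.
have h a b c : Ck 2 U ('D_(e_ a) (fun y => G y b c)).
  by apply: Ck_derive; exact: Ck_entry.
by apply: CkB => //; apply: CkD.
Qed.

Lemma Ck_Gam u : Ck 2 U (fun y => Gam G y u).
Proof.
apply/Ck_mxP => // j k.
apply: (@Ck_ext _ _ _ _ _ (fun y => \sum_i u 0 i * christoffel G y k i j)) => //.
  by move=> x _; rewrite mxE.
apply: Ck_sum => // i _; apply: CkM => //; first exact: Ck_cst.
exact: Ck_christoffel.
Qed.

Let dGam x u v : U x -> derivable (fun y => Gam G y u) x v.
Proof. by move=> Ux; exact: Ck_derivable (Ck_Gam u) Ux. Qed.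

Let dG x v : U x -> derivable G x v.
Proof. by move=> Ux; exact: Ck_derivable GC Ux. Qed.

(** Multiplying the Christoffel formula by [G] removes the inverse metric and leaves half the Koszul
    expression [A i]; adding the transpose cancels everything but the derivative along [e_i]. *)
Lemma Gam_metric x u : U x ->
  'D_u G x = Gam G x u *m G x + G x *m (Gam G x u)^T.
Proof.
move=> Ux; pose A (i : 'I_m) : 'M[R]_m := \matrix_(j, l)
  ('D_(e_ i) (fun y => G y j l) x + 'D_(e_ j) (fun y => G y i l) x
   - 'D_(e_ l) (fun y => G y i j) x).
have GA i : Gam G x (e_ i) = 2^-1 *: (A i *m invmx (G x)).
  apply/matrixP => j k; rewrite Gam_delta !mxE; congr (_ * _).
  apply: eq_bigr => l _; rewrite mulrC mxE; congr (_ * _).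
  by rewrite -[in LHS]Gsym// -trmx_inv mxE.
have GAG i : Gam G x (e_ i) *m G x = 2^-1 *: A i.
  by rewrite GA -scalemxAl mulmxKV// Gunit.
have E i : 'D_(e_ i) G x = Gam G x (e_ i) *m G x + G x *m (Gam G x (e_ i))^T.
  have -> : G x *m (Gam G x (e_ i))^T = (Gam G x (e_ i) *m G x)^T.
    by rewrite trmx_mul Gsym.
  rewrite GAG; apply/matrixP => j l.
  rewrite !mxE -derive_entry; last exact: dG.
  rewrite (pd_sym i l j Ux) (pd_sym l i j Ux) (pd_sym j i l Ux).
  rewrite (pd_sym j l i Ux) (pd_sym l j i Ux).
  by field.
have GC1 : Ck 1 U G by exact: Ck_le GC.
rewrite (derive_mx_row u oU GC1 Ux) Gam_sum mulmx_suml linear_sum mulmx_sumr.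
rewrite -big_split /=; apply: eq_bigr => i _; rewrite E scalerDr.
by rewrite -scalemxAl linearZ /= -scalemxAr.
Qed.

(** Uniqueness of the Levi-Civita connection, [D] being a difference of two candidates. The
    trilinear form [a] is symmetric in its first two arguments and skew in its last two; alternating
    the two symmetries three times gives [a = - a]. *)
Lemma LC_uniq x (D : 'rV[R]_m -> 'M[R]_m) : U x ->
  (forall u v, v *m D u = u *m D v) ->
  (forall u, D u *m G x + G x *m (D u)^T = 0) -> forall u, D u = 0.
Proof.
move=> Ux sD mD.
pose a (u v w : 'rV[R]_m) : R := (v *m D u *m G x *m w^T) 0 0.
have a1 u v w : a u v w = a v u w by rewrite /a sD.
have a2 u v w : a u v w = - a u w v by exact: skew_form (mD u) (Gsym Ux).
have a0 u v w : a u v w = 0.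
  have : a u v w = - a u v w.
    by rewrite {1}a2 a1 a2 opprK a1 a2 a1.
  by lra.
move=> u; have Gu := Gunit Ux.
suff DG : D u *m G x = 0 by rewrite -[D u](mulmxK Gu) DG mul0mx.
apply/matrixP => i j; have := a0 u (e_ i) (e_ j).
by rewrite /a -!mulmxA -rowE trmx_delta mulmxA -colE !mxE.
Qed.

Lemma riemE x u v w : U x -> riem G x u v w = w *m Rm G x u v.
Proof.
move=> Ux; rewrite /riem /curvature !nablaE.
have nE (v' : 'rV[R]_m) : nabla G (fun=> v') (fun=> w) =
    (fun y => w *m Gam G y v').
  by apply/funext => y; rewrite nablaE derive_cst add0r.
have b0 : bracket (fun=> u) (fun=> v) x = 0.
  by rewrite /bracket !derive_cst subrr.
rewrite !nE b0 Gam0 derive0 mulmx0 addr0 subr0.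
have dM v' u' : 'D_u' (fun y => w *m Gam G y v') x =
    w *m 'D_u' (fun y => Gam G y v') x.
  have dw : derivable (fun _ : 'rV[R]_m => w) x u' by exact: derivable_cst.
  by rewrite (derive_mulmx dw (@dGam _ _ _ Ux)) derive_cst mul0mx add0r.
rewrite !dM !derive_cst !add0r.
exact: curvature_row_alg.
Qed.

Lemma Rm_antisym x u v : Rm G x v u = - Rm G x u v.
Proof. by rewrite /Rm; mxring. Qed.

Lemma Rm_metric x u v : U x ->
  Rm G x u v *m G x + G x *m (Rm G x u v)^T = 0.
Proof.
move=> Ux.
have E a b : 'D_a ('D_b G) x =
    'D_a (fun y => Gam G y b) x *m G x + Gam G x b *m 'D_a G x
    + ('D_a G x *m (Gam G x b)^T + G x *m ('D_a (fun y => Gam G y b) x)^T).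
  rewrite (eq_on_derive a oU (fun y Uy => Gam_metric b Uy) Ux).
  have d1 := is_derive_mulmx (@dGam _ b a Ux) (@dG _ a Ux).
  have d2 := is_derive_tr (@dGam _ b a Ux).
  have d3 := is_derive_mulmx (@dG _ a Ux) (@ex_derive _ _ _ _ _ _ _ d2).
  have [_ ->] := is_deriveD d1 d3.
  by have [_ ->] := d2.
have S : 'D_u ('D_v G) x = 'D_v ('D_u G) x.
  exact: (schwarz_mx v u oU (Ck_pred GC) Ux).
rewrite !E !(Gam_metric _ Ux) in S.
exact: curvature_metric_alg S.
Qed.

Lemma Rm_bianchi x u v w : U x ->
  w *m Rm G x u v + u *m Rm G x v w + v *m Rm G x w u = 0.
Proof.
move=> Ux.
have S a b c : b *m 'D_c (fun y => Gam G y a) x = a *m 'D_c (fun y => Gam G y b) x.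
  have E a' b' : b' *m 'D_c (fun y => Gam G y a') x =
      'D_c (fun y => b' *m Gam G y a') x.
    have dw : derivable (fun _ : 'rV[R]_m => b') x c by exact: derivable_cst.
    by rewrite (derive_mulmx dw (@dGam _ _ _ Ux)) derive_cst mul0mx add0r.
  rewrite !E; apply: (@eq_on_derive _ _ _ U) => // y Uy; exact: Gam_sym.
by apply: bianchi_alg; [exact: Gam_sym|exact: Gam_sym|exact: Gam_sym| | |].
Qed.

(** The classical consequence of the two antisymmetries [q1], [q2] and of the Bianchi identity [q3]:
    four cyclic instances, brought to common terms, combine linearly. *)
Lemma Rm_pair x u v w z : U x ->
  (w *m Rm G x u v *m G x *m z^T) 0 0 = (u *m Rm G x w z *m G x *m v^T) 0 0.
Proof.
move=> Ux; pose Q (a b c d : 'rV[R]_m) : R := (c *m Rm G x a b *m G x *m d^T) 0 0.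
have q1 a b c d : Q b a c d = - Q a b c d.
  by rewrite /Q Rm_antisym mulmxN !mulNmx mxE.
have q2 a b c d : Q a b d c = - Q a b c d.
  exact: skew_form (Rm_metric a b Ux) (Gsym Ux).
have q3 a b c d : Q a b c d + Q b c a d + Q c a b d = 0.
  have /(congr1 (fun M => (M *m G x *m d^T) 0 0)) := Rm_bianchi a b c Ux.
  rewrite !mulmxDl !mul0mx /Q.
  move: (c *m _ *m _ *m _) (a *m _ *m _ *m _) (b *m _ *m _ *m _) => A B C.
  by rewrite !mxE.
rewrite -/(Q u v w z) -/(Q w z u v).
have b1 := q3 u v w z.
have b2 := q3 v w z u; rewrite (q2 v w u z) (q2 w z u v) in b2.
have b3 := q3 w z u v; rewrite (q1 w u z v) (q2 w u v z) in b3.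
have b4 := q3 z u v w.
rewrite (q2 z u w v) (q2 u v w z) (q1 z v u w) (q2 z v w u) in b4.
lra.
Qed.

End LeviCivita.

Opaque derive jacobian Gam christoffel.

Section MoreMatrixDerivatives.
Variables (R : realType) (V : normedModType R) (m n : nat).

Lemma is_derive_entry (A : V -> 'M[R]_(m, n)) (D : 'M[R]_(m, n)) x v i j :
  is_derive x v A D -> is_derive x v (fun y => A y i j) (D i j).
Proof.
move=> [dA <-]; split; first exact: ((derivable_mxP _ x v).1 dA).
exact: derive_entry.
Qed.

Lemma is_derive_mulmxE p (A : V -> 'M[R]_(m, n)) (B : V -> 'M[R]_(n, p)) dA dB x v :
  is_derive x v A dA -> is_derive x v B dB ->
  is_derive x v (fun y => A y *m B y) (dA *m B x + A x *m dB).
Proof. by move=> [d1 <-] [d2 <-]; exact: is_derive_mulmx. Qed.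

Lemma is_derive_scale_mx (a : V -> R) (A : V -> 'M[R]_(m, n)) da dA x v :
  is_derive x v a da -> is_derive x v A dA ->
  is_derive x v (fun y => a y *: A y) (da *: A x + a x *: dA).
Proof.
move=> [d1 e1] hA; apply: is_derive_mxP => i j.
have [d2 e2] := is_derive_entry i j hA.
have [d e] := is_derive_mul d1 d2.
rewrite (_ : (fun y => _) = (fun y => a y * A y i j)).
  by split=> //; rewrite e e1 e2 !mxE.
by apply/funext => y; rewrite mxE.
Qed.

End MoreMatrixDerivatives.

Lemma metric_transition_alg (R : comNzRingType) m (K A J G B : 'M[R]_m) :
  K *m J = A + J *m B ->
  (A *m G + J *m (B *m G + G *m B^T)) *m J^T + J *m G *m A^T
  = K *m (J *m G *m J^T) + (J *m G *m J^T) *m K^T.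
Proof.
move=> KJ; have -> : J *m G *m J^T *m K^T = J *m G *m (K *m J)^T.
  by rewrite trmx_mul mulmxA.
have T : (A + J *m B)^T = A^T + B^T *m J^T by rewrite linearD /= trmx_mul.
rewrite !(mulmxA K) KJ T !(mulmxDl, mulmxDr) !mulmxA.
mxring.
Qed.

Lemma Rm_transition_alg (R : comNzRingType) m
    (A1 A2 Au Av B1 B2 Bu Bv Bs Bs' Ju Jv JJ JJ' J : 'M[R]_m) :
  JJ = JJ' -> Bs = Bs' ->
  A1 *m J + Av *m Ju = JJ' + (Ju *m Bv + J *m (B1 + Bs')) ->
  A2 *m J + Au *m Jv = JJ + (Jv *m Bu + J *m (B2 + Bs)) ->
  Au *m J = Ju + J *m Bu -> Av *m J = Jv + J *m Bv ->
  A1 *m J - A2 *m J + Av *m (Ju + J *m Bu) - Au *m (Jv + J *m Bv)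
  = J *m (B1 - B2 + Bv *m Bu - Bu *m Bv).
Proof.
move=> <- <- h1 h2 h3 h4.
have e1 : A1 *m J = JJ + (Ju *m Bv + J *m (B1 + Bs)) - Av *m Ju by rewrite -h1 addrK.
have e2 : A2 *m J = JJ + (Jv *m Bu + J *m (B2 + Bs)) - Au *m Jv by rewrite -h2 addrK.
rewrite e1 e2 !mulmxDr !(mulmxA _ J) h3 h4 !(mulmxDl, mulmxDr, mulmxN) !mulmxA.
mxring.
Qed.

(** * Transformation laws *)

Section ChangeOfCoordinates.
Variables (R : realType) (m : nat).
Local Notation e_ i := (delta_mx 0 i : 'rV[R]_m).
Variables (U U' : set 'rV[R]_m) (phi : 'rV[R]_m -> 'rV[R]_m).
Variables (G G' : 'rV[R]_m -> 'M[R]_m).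
Hypotheses (oU : open U) (oU' : open U').
Hypothesis phiC : Ck 4 U phi.
Hypothesis phiU : forall x, U x -> U' (phi x).
Hypothesis GC : Ck 3 U G.
Hypothesis GC' : Ck 3 U' G'.
Hypothesis Gpos : forall x, U x -> posdef (G x).
Hypothesis Gpos' : forall x, U' x -> posdef (G' x).
Let J := jacobian phi.
Hypothesis GJ : forall x, U x -> G x = J x *m G' (phi x) *m (J x)^T.

Lemma phi_diff x : U x -> differentiable phi x.
Proof.
by move=> Ux; apply: (Ck_differentiable oU _ Ux); exact: Ck_le phiC.
Qed.

Lemma derive_jacobian x u : U x -> 'D_u phi x = u *m J x.
Proof. by move=> Ux; rewrite deriveEjacobian//; exact: phi_diff. Qed.

Lemma Ck_jacobian : Ck 3 U J.
Proof.
apply/Ck_mxP => // i j.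
apply: (@Ck_ext _ _ _ _ _ (fun y => 'D_(e_ i) phi y 0 j)) => //.
  by move=> x Ux; rewrite derive_jacobian// -rowE mxE.
by apply: Ck_entry => //; exact: Ck_derive.
Qed.

Let dJ x u : U x -> derivable J x u.
Proof. by move=> Ux; exact: Ck_derivable Ck_jacobian Ux. Qed.

Lemma jacobian_unit x : U x -> J x \in unitmx.
Proof.
move=> Ux; have := posdef_unit (Gpos Ux); rewrite GJ// unitmx_mul => /andP[].
by rewrite unitmx_mul => /andP[].
Qed.

Lemma derive_jacobian_sym x u v : U x -> v *m 'D_u J x = u *m 'D_v J x.
Proof.
move=> Ux.
have E a b : a *m 'D_b J x = 'D_b ('D_a phi) x.
  have da : derivable (fun _ : 'rV[R]_m => a) x b by exact: derivable_cst.
  rewrite -[RHS](eq_on_derive b oU (f := fun y => a *m J y) _ Ux).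
    by rewrite (derive_mulmx da (@dJ _ b Ux)) derive_cst mul0mx add0r.
  by move=> y Uy; rewrite derive_jacobian.
rewrite !E; apply: (schwarz_mx v u oU _ Ux); exact: Ck_le phiC.
Qed.

(** Instead of transforming the Christoffel formula, the connection [K] pulled back from the other
    chart is seen to be torsion-free (the Jacobian has symmetric derivatives) and compatible with
    [G]; uniqueness identifies it with [Gam]. *)
Lemma Gam_transition x u : U x ->
  Gam G x u *m J x = 'D_u J x + J x *m Gam G' (phi x) (u *m J x).
Proof.
move=> Ux; have uJ := jacobian_unit Ux; have U'x := phiU Ux.
pose K u := ('D_u J x + J x *m Gam G' (phi x) (u *m J x)) *m invmx (J x).
have KJ v : K v *m J x = 'D_v J x + J x *m Gam G' (phi x) (v *m J x).
  by rewrite /K mulmxKV.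
suff : Gam G x u - K u = 0 by move=> /eqP; rewrite subr_eq0 => /eqP ->.
move: u; apply: (LC_uniq Gpos Ux) => [u v|u].
  rewrite !mulmxBr (Gam_sym oU Gpos u v Ux); congr (_ - _).
  rewrite /K !mulmxA !mulmxDr !mulmxA derive_jacobian_sym//.
  by rewrite (Gam_sym oU' Gpos' _ _ U'x).
rewrite linearB /= mulmxBl mulmxBr addrACA -opprD -(Gam_metric oU GC Gpos _ Ux).
apply/eqP; rewrite subr_eq0; apply/eqP.
rewrite (eq_on_derive u oU GJ Ux).
have C1 : Ck 1 U' G' by exact: Ck_le GC'.
have dG := is_derive_comp_mx u oU' C1 U'x (phi_diff Ux).
have d1 := is_derive_mulmx (@dJ _ u Ux) (@ex_derive _ _ _ _ _ _ _ dG).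
have d2 := is_derive_tr (@dJ _ u Ux).
have d3 := is_derive_mulmx (@ex_derive _ _ _ _ _ _ _ d1) (@ex_derive _ _ _ _ _ _ _ d2).
have [_ ->] := d3; have [_ ->] := d1; have [_ ->] := d2; have [_ ->] := dG.
rewrite derive_jacobian// (Gam_metric oU' GC' Gpos' _ U'x) /= GJ//.
exact: metric_transition_alg (KJ u).
Qed.

(** [Gam_transition] is differentiated once more and antisymmetrized. The inhomogeneous terms cancel
    because second derivatives of the Jacobian commute. *)
Lemma Rm_transition x u v : U x ->
  Rm G x u v *m J x = J x *m Rm G' (phi x) (u *m J x) (v *m J x).
Proof.
move=> Ux; have U'x := phiU Ux.
have dGam a b : derivable (fun y => Gam G y a) x b.
  exact: Ck_derivable (Ck_Gam oU GC Gpos a) Ux.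
have dJJ a b : derivable ('D_a J) x b.
  exact: Ck_derivable (Ck_derive a Ck_jacobian) Ux.
(* Both the base point [phi y] and the direction [a *m J y] move with [y]; expanding the direction
   in the basis separates the two dependences. *)
have H a b : is_derive x b (fun y => Gam G' (phi y) (a *m J y))
    ('D_(b *m J x) (fun z => Gam G' z (a *m J x)) (phi x)
     + Gam G' (phi x) (a *m 'D_b J x)).
  have da : derivable (fun _ : 'rV[R]_m => a) x b by exact: derivable_cst.
  have daJ := is_derive_mulmx da (@dJ _ b Ux).
  have dphi k : is_derive x b (fun y => Gam G' (phi y) (e_ k))
      ('D_(b *m J x) (fun z => Gam G' z (e_ k)) (phi x)).
    rewrite -(derive_jacobian b Ux).
    exact: (is_derive_comp_mx b oU'
      (Ck_pred (Ck_Gam oU' GC' Gpos' (e_ k))) U'x (phi_diff Ux)).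
  have dk k : is_derive x b (fun y => (a *m J y) 0 k *: Gam G' (phi y) (e_ k))
      ((a *m 'D_b J x) 0 k *: Gam G' (phi x) (e_ k)
       + (a *m J x) 0 k *: 'D_(b *m J x) (fun z => Gam G' z (e_ k)) (phi x)).
    apply: is_derive_scale_mx (dphi k).
    have := is_derive_entry 0 k daJ.
    by rewrite derive_cst mul0mx add0r.
  have D : is_derive x b (fun y => Gam G' (phi y) (a *m J y))
      (\sum_k ((a *m 'D_b J x) 0 k *: Gam G' (phi x) (e_ k)
       + (a *m J x) 0 k *: 'D_(b *m J x) (fun z => Gam G' z (e_ k)) (phi x))).
    rewrite (_ : (fun y => _) =
        \sum_k (fun y => (a *m J y) 0 k *: Gam G' (phi y) (e_ k))).
      exact: is_derive_sum.
    by apply/funext => y; rewrite fct_sumE -Gam_sum.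
  apply: is_derive_eq D _.
  rewrite big_split /= -Gam_sum addrC; congr (_ + _).
  have dGk k : is_derive (phi x) (b *m J x) (fun z => (a *m J x) 0 k *: Gam G' z (e_ k))
      ((a *m J x) 0 k *: 'D_(b *m J x) (fun z => Gam G' z (e_ k)) (phi x)).
    apply: is_deriveZ; apply: derivableP.
    exact: Ck_derivable (Ck_Gam oU' GC' Gpos' (e_ k)) U'x.
  have E : \sum_k (fun z => (a *m J x) 0 k *: Gam G' z (e_ k)) =
      (fun z => Gam G' z (a *m J x)).
    by apply/funext => z; rewrite fct_sumE; exact: esym (Gam_sum _ _ _).
  have := is_derive_sum dGk; rewrite E => -[_ e].
  exact: esym e.
have K a b : 'D_b (fun y => Gam G y a) x *m J x + Gam G x a *m 'D_b J x =
    'D_b ('D_a J) x + ('D_b J x *m Gam G' (phi x) (a *m J x) +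
    J x *m ('D_(b *m J x) (fun z => Gam G' z (a *m J x)) (phi x)
    + Gam G' (phi x) (a *m 'D_b J x))).
  have [_ e1] := is_derive_mulmx (dGam a b) (@dJ _ b Ux).
  have [_ e2] := is_deriveD (derivableP (dJJ a b))
    (is_derive_mulmxE (derivableP (@dJ _ b Ux)) (H a b)).
  apply: etrans (esym e1) (etrans _ e2).
  exact: (eq_on_derive b oU (fun y Uy => Gam_transition a Uy) Ux).
have S := schwarz_mx u v oU (Ck_pred Ck_jacobian) Ux.
have Kuv := K v u; have Kvu := K u v.
have Jsym := derive_jacobian_sym u v Ux.
have gu := Gam_transition u Ux; have gv := Gam_transition v Ux.
rewrite /Rm !mulmxDl !mulNmx -[X in _ + X - _]mulmxA -[X in _ - X]mulmxA gu gv.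
exact: (Rm_transition_alg S (congr1 (Gam G' (phi x)) (esym Jsym)) Kuv Kvu gu gv).
Qed.

End ChangeOfCoordinates.

(** * Algebra of the integration by parts *)

Section DivergenceFormula.
Variables (R : comNzRingType) (m : nat).
Variables (C P : 'M[R]_m) (dC dP Ga Pi : 'I_m -> 'M[R]_m).
Variable dPi : 'I_m -> 'I_m -> 'M[R]_m.
Hypothesis Ga_sym : forall i j k, Ga i j k = Ga j i k.

(** The covariant derivatives along [e_p] of the bivector [C], here and of the endomorphism [P],
    below. *)
Let nC p := dC p + (Ga p)^T *m C + C *m Ga p.
Let nP p := dP p + P *m Ga p - Ga p *m P.

(** These are the four contractions in which the Leibniz rule leaves a derivative on [C] or [P]:
    [nC] in the directions of [P], the divergences of [P] and of [C], and [nP] in the directions of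
    [C]. *)
Hypothesis h1 : forall q, \sum_p P q p *: nC p = 0.
Hypothesis h2 : forall k, \sum_p nP p k p = 0.
Hypothesis h3 : forall k, \sum_r nC r r k = 0.
Hypothesis h4 : forall k, \sum_r C r k *: nP r = 0.

(* Integration by parts: the contraction of the linearized curvature with
   [C] and [P] is a divergence, since every term in which a derivative falls
   on [C] or [P] vanishes. *)
Lemma linearized_curvature_div :
  \sum_r \sum_p (C *m (dPi p r - dPi r p + Pi r *m Ga p + Ga r *m Pi p
     - Pi p *m Ga r - Ga p *m Pi r) *m P) r p
  = \sum_r \sum_p (dC p *m Pi r *m P + C *m dPi p r *m P + C *m Pi r *m dP p
       + C *m Pi r *m P *m Ga p) r p
  - \sum_r \sum_p (dC r *m Pi p *m P + C *m dPi r p *m P + C *m Pi p *m dP r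
       + (Ga r)^T *m (C *m Pi p *m P)) r p.
Proof.
have E r p : C *m (dPi p r - dPi r p + Pi r *m Ga p + Ga r *m Pi p
     - Pi p *m Ga r - Ga p *m Pi r) *m P =
   (dC p *m Pi r *m P + C *m dPi p r *m P + C *m Pi r *m dP p
       + C *m Pi r *m P *m Ga p)
   - (dC r *m Pi p *m P + C *m dPi r p *m P + C *m Pi p *m dP r
       + (Ga r)^T *m (C *m Pi p *m P))
   - nC p *m Pi r *m P - C *m Pi r *m nP p + nC r *m Pi p *m P
   + C *m Pi p *m nP r + (Ga p)^T *m C *m Pi r *m P - C *m Pi p *m P *m Ga r.
  rewrite /nC /nP !(mulmxDl, mulmxDr, mulmxN, mulNmx) !mulmxA.
  mxring.
have z1 : \sum_r \sum_p (nC p *m Pi r *m P) r p = 0.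
  rewrite big1// => r _; transitivity (\sum_q ((\sum_p P q p *: nC p) *m Pi r) r q).
    rewrite (eq_bigr (fun p => \sum_q (nC p *m Pi r) r q * P q p)); last first.
      by move=> p _; rewrite mxE.
    rewrite exchange_big /=; apply: eq_bigr => q _.
    rewrite mulmx_suml summxE; apply: eq_bigr => p _.
    by rewrite -scalemxAl [RHS]mxE mulrC.
  by rewrite big1// => q _; rewrite h1 mul0mx mxE.
have z2 : \sum_r \sum_p (C *m Pi r *m nP p) r p = 0.
  rewrite big1// => r _.
  rewrite (eq_bigr (fun p => \sum_k (C *m Pi r) r k * nP p k p)); last first.
    by move=> p _; rewrite mxE.
  by rewrite exchange_big big1// => k _; rewrite -mulr_sumr h2 mulr0.
have z3 : \sum_r \sum_p (nC r *m Pi p *m P) r p = 0.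
  rewrite exchange_big big1// => p _.
  rewrite (eq_bigr (fun r => \sum_k nC r r k * (Pi p *m P) k p)); last first.
    by move=> r _; rewrite -mulmxA mxE.
  by rewrite exchange_big big1// => k _; rewrite -mulr_suml h3 mul0r.
have z4 : \sum_r \sum_p (C *m Pi p *m nP r) r p = 0.
  rewrite exchange_big big1// => p _.
  transitivity (\sum_k (Pi p *m (\sum_r C r k *: nP r)) k p).
    rewrite (eq_bigr (fun r => \sum_k C r k * (Pi p *m nP r) k p)); last first.
      by move=> r _; rewrite -mulmxA mxE.
    rewrite exchange_big /=; apply: eq_bigr => k _.
    rewrite mulmx_sumr summxE; apply: eq_bigr => r _.
    by rewrite -scalemxAr [RHS]mxE.
  by rewrite big1// => k _; rewrite h4 mulmx0 mxE.
(* The two leftover Christoffel terms agree after renaming indices, because the connection is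
   torsion-free. *)
have z5 : \sum_r \sum_p ((Ga p)^T *m C *m Pi r *m P) r p =
          \sum_r \sum_p (C *m Pi p *m P *m Ga r) r p.
  rewrite (eq_bigr (fun r => \sum_k \sum_p Ga p k r * (C *m Pi r *m P) k p)).
    rewrite [RHS](eq_bigr (fun k => \sum_r \sum_p (C *m Pi r *m P) k p * Ga k p r)).
      rewrite exchange_big /=; apply: eq_bigr => k _; apply: eq_bigr => r _.
      by apply: eq_bigr => p _; rewrite mulrC Ga_sym.
    by move=> r _; apply: eq_bigr => p _; rewrite mxE.
  move=> r _; rewrite exchange_big /=; apply: eq_bigr => p _.
  by rewrite -!mulmxA mxE; apply: eq_bigr => k _; rewrite mxE mulmxA.
have ent (A B c d e f g h : 'M[R]_m) r p : (A - B - c - d + e + f + g - h) r p =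
    A r p - B r p - c r p - d r p + e r p + f r p + g r p - h r p.
  by rewrite !mxE.
transitivity (\sum_r \sum_p (dC p *m Pi r *m P + C *m dPi p r *m P
     + C *m Pi r *m dP p + C *m Pi r *m P *m Ga p) r p
  - \sum_r \sum_p (dC r *m Pi p *m P + C *m dPi r p *m P + C *m Pi p *m dP r
     + (Ga r)^T *m (C *m Pi p *m P)) r p
  - \sum_r \sum_p (nC p *m Pi r *m P) r p
  - \sum_r \sum_p (C *m Pi r *m nP p) r p
  + \sum_r \sum_p (nC r *m Pi p *m P) r p
  + \sum_r \sum_p (C *m Pi p *m nP r) r p
  + \sum_r \sum_p ((Ga p)^T *m C *m Pi r *m P) r p
  - \sum_r \sum_p (C *m Pi p *m P *m Ga r) r p); last first.
  by rewrite z1 z2 z3 z4 z5 !subr0 !addr0 addrK.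
rewrite -!(sumrB, big_split) /=; apply: eq_bigr => r _.
rewrite -!(sumrB, big_split) /=; apply: eq_bigr => p _.
by rewrite E; exact: ent.
Qed.

End DivergenceFormula.

(** * K-contact structures in a chart and the first variation *)

Section KContactChart.
Variables (R : realType) (m : nat).
Local Notation e_ i := (delta_mx 0 i : 'rV[R]_m).

(* [kx_A]: the covariant derivative of a section of the image of [P1] has no
   [P2]-component; the conditions on [T1] and [h1], on [T2] and [h2], and on
   [T^mix_13] give this in the directions of [D1], of [D2] and of [xi]. *)
Record kc_chart (U : set 'rV[R]_m) (G f : 'rV[R]_m -> 'M[R]_m)
    (xi : 'rV[R]_m -> 'rV[R]_m) (eta : 'rV[R]_m -> 'cV[R]_m)
    (P1 P2 : 'rV[R]_m -> 'M[R]_m) : Prop := KcChart {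
  kx_open : open U;
  kx_G : Ck 3 U G;
  kx_pos : forall x, U x -> posdef (G x);
  kx_xiC : Ck 1 U xi;
  kx_P1C : Ck 2 U P1;
  kx_P2C : Ck 2 U P2;
  kx_sum : forall x, U x -> P1 x + P2 x + eta x *m xi x = 1%:M;
  kx_12 : forall x, U x -> P1 x *m P2 x = 0;
  kx_21 : forall x, U x -> P2 x *m P1 x = 0;
  kx_11 : forall x, U x -> P1 x *m P1 x = P1 x;
  kx_22 : forall x, U x -> P2 x *m P2 x = P2 x;
  kx_1e : forall x, U x -> P1 x *m eta x = 0;
  kx_2e : forall x, U x -> P2 x *m eta x = 0;
  kx_xe : forall x, U x -> xi x *m eta x = 1%:M;
  kx_x1 : forall x, U x -> xi x *m P1 x = 0;
  kx_x2 : forall x, U x -> xi x *m P2 x = 0;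
  kx_sym1 : forall x, U x -> P1 x *m G x = G x *m (P1 x)^T;
  kx_sym2 : forall x, U x -> P2 x *m G x = G x *m (P2 x)^T;
  kx_eta : forall x, U x -> eta x = G x *m (xi x)^T;
  kx_skew : forall x, U x -> f x *m G x = - (G x *m (f x)^T);
  kx_f1 : forall x, U x -> f x *m P1 x = P1 x *m f x;
  kx_f2 : forall x, U x -> f x *m P2 x = P2 x *m f x;
  kx_xf : forall x, U x -> xi x *m f x = 0;
  kx_nxi : forall x u, U x -> 'D_u xi x + xi x *m Gam G x u = - (u *m f x);
  kx_A : forall x u, U x -> ('D_u P1 x + P1 x *m Gam G x u) *m P2 x = 0 }.

(** The equation [E] is the derivative of [P *m G *m Q^T = 0]. For orthogonal sections [X], [Y] of
    the two images it reads [g(nabla X, Y) = - g(X, nabla Y)], so one mixed component vanishes with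
    the other. *)
Lemma projector_duality_alg (P Q dP dQ G Ga : 'M[R]_m) :
  G \in unitmx -> P *m G = G *m P^T -> Q *m G = G *m Q^T ->
  (dP *m G + P *m (Ga *m G + G *m Ga^T)) *m Q^T + P *m G *m dQ^T = 0 ->
  (dP + P *m Ga) *m Q = 0 -> (dQ + Q *m Ga) *m P = 0.
Proof.
move=> uG sP sQ E A.
apply: trmx_inj; rewrite trmx0 -[LHS](mulKmx uG).
suff -> : G *m ((dQ + Q *m Ga) *m P)^T = 0 by rewrite mulmx0.
have e0 : (dP + P *m Ga) *m (G *m Q^T) = 0 by rewrite -sQ mulmxA A mul0mx.
transitivity ((dP *m G + P *m (Ga *m G + G *m Ga^T)) *m Q^T + P *m G *m dQ^T
  - (dP + P *m Ga) *m (G *m Q^T)); last by rewrite E e0 subr0.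
have T : ((dQ + Q *m Ga) *m P)^T = P^T *m (dQ^T + Ga^T *m Q^T).
  by rewrite trmx_mul linearD /= trmx_mul.
rewrite T mulmxA -sP !(mulmxDl, mulmxDr) !mulmxA.
mxring.
Qed.

(** [kx_A] is the only field of the record that is not symmetric in the two distributions up to
    commutation, and duality exchanges its two versions. Facts proved for [P1] thus hold for
    [P2]. *)
Lemma kc_chart_swap U G f xi eta P1 P2 :
  kc_chart U G f xi eta P1 P2 -> kc_chart U G f xi eta P2 P1.
Proof.
move=> h; have [oU ? ? ? ? ? ? ? ? ? ? ? ? ? ? ? ? ? ? ? ? ? ? ? ?] := h.
split=> //.
  by move=> x Ux; rewrite [X in X + _]addrC; exact: kx_sum h _ Ux.
move=> x u Ux.
have dP1 := Ck_derivable (v := u) (kx_P1C h) Ux.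
have dP2 := Ck_derivable (v := u) (kx_P2C h) Ux.
have dG := Ck_derivable (v := u) (kx_G h) Ux.
apply: (projector_duality_alg (posdef_unit (kx_pos h Ux)) (kx_sym1 h Ux)
  (kx_sym2 h Ux) _ (kx_A h u Ux)).
have [d e] := is_derive_mulmxE
  (is_derive_mulmxE (derivableP dP1) (derivableP dG)) (is_derive_tr dP2).
rewrite (Gam_metric oU (kx_G h) (kx_pos h) u Ux) in e.
apply: etrans (esym e) _; rewrite -(derive_cst (0 : 'M[R]_m) x u).
apply: (eq_on_derive u oU _ Ux) => y Uy.
by rewrite (kx_sym1 h Uy) -mulmxA -trmx_mul (kx_21 h Uy) trmx0 mulmx0.
Qed.

(** The resolution of the identity cuts [N], the covariant derivative of [P1], into blocks. The
    [P1]-[P1] block vanishes since [P1] is idempotent, the [P1]-[P2] blocks by the last two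
    hypotheses, and the blocks involving [xi] are computed from [nabla_u xi = - u f]. *)
Lemma nabla_projector_alg (P1 P2 dP1 dP2 G Ga f : 'M[R]_m) (xi dxi u : 'rV[R]_m)
    (eta deta : 'cV[R]_m) :
  P1 + P2 + eta *m xi = 1%:M -> P1 *m P2 = 0 -> P2 *m P1 = 0 ->
  P1 *m P1 = P1 -> P1 *m eta = 0 -> xi *m P1 = 0 ->
  P1 *m G = G *m P1^T -> f *m P1 = P1 *m f -> 
  dP1 *m P1 + P1 *m dP1 = dP1 -> dP2 *m P1 + P2 *m dP1 = 0 ->
  dP1 *m eta + P1 *m deta = 0 -> dxi *m P1 + xi *m dP1 = 0 ->
  dxi + xi *m Ga = - (u *m f) -> deta = Ga *m eta - G *m (u *m f)^T ->
  (dP1 + P1 *m Ga) *m P2 = 0 -> (dP2 + P2 *m Ga) *m P1 = 0 ->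
  dP1 + P1 *m Ga - Ga *m P1 = G *m (u *m f *m P1)^T *m xi + eta *m (u *m f *m P1).
Proof.
move=> S h12 h21 h11 h1e hx1 s1 f1 r11 r21 r1e rx1 nx ne A B.
set N := LHS.
have N1e : N *m eta = G *m (u *m f *m P1)^T.
  rewrite /N mulmxBl -[Ga *m P1 *m _]mulmxA h1e mulmx0 subr0 mulmxDl.
  have -> : dP1 *m eta = - (P1 *m deta) by apply/eqP; rewrite -addr_eq0 r1e.
  rewrite ne mulmxBr opprB [P1 *m (G *m _)]mulmxA s1 -mulmxA -trmx_mul.
  by rewrite mulmxA subrK.
have N2 : N *m P2 = 0.
  by rewrite /N mulmxBl A -mulmxA h12 mulmx0 subr0.
have p1 : P1 *m N *m P1 = 0.
  rewrite /N !(mulmxDr, mulmxN) !mulmxA h11 !(mulmxDl, mulNmx).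
  rewrite -[P1 *m Ga *m P1 *m P1]mulmxA h11 addrK.
  have /(congr1 (mulmx P1)) := r11; rewrite mulmxDr !mulmxA h11 => E.
  by apply: (addIr (P1 *m dP1)); rewrite E add0r.
have p2 : P2 *m N *m P1 = 0.
  rewrite /N !(mulmxDr, mulmxN) !mulmxA h21 mul0mx addr0 !(mulmxDl, mulNmx).
  have -> : P2 *m dP1 = - (dP2 *m P1).
    by apply/eqP; rewrite -addr_eq0 addrC r21.
  rewrite mulNmx -!mulmxA h11 -opprD mulmxA.
  by move: B; rewrite mulmxDl => ->; rewrite oppr0.
have px : xi *m N *m P1 = u *m f *m P1.
  rewrite /N !(mulmxDr, mulmxN) !mulmxA hx1 mul0mx addr0 !(mulmxDl, mulNmx).
  have -> : xi *m dP1 = - (dxi *m P1).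
    by apply/eqP; rewrite -addr_eq0 addrC rx1.
  rewrite mulNmx -!mulmxA h11 -opprD mulmxA.
  by rewrite -mulmxDl nx mulNmx opprK mulmxA.
move: N N1e N2 p1 p2 px => N N1e N2 p1 p2 px.
rewrite -[LHS]mulmx1 -S !mulmxDr N2 addr0 mulmxA N1e addrC; congr (_ + _).
rewrite -[LHS]mul1mx -S !mulmxDl !mulmxA p1 p2 !add0r.
by rewrite -!mulmxA (mulmxA xi) px !mulmxA.
Qed.

Lemma nabla_P1 U G f xi eta P1 P2 x u : kc_chart U G f xi eta P1 P2 -> U x ->
  'D_u P1 x + P1 x *m Gam G x u - Gam G x u *m P1 x =
  G x *m (u *m f x *m P1 x)^T *m xi x + eta x *m (u *m f x *m P1 x).
Proof.
move=> h Ux; have oU := kx_open h.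
have dP1 := Ck_derivable (v := u) (kx_P1C h) Ux.
have dP2 := Ck_derivable (v := u) (kx_P2C h) Ux.
have dG := Ck_derivable (v := u) (kx_G h) Ux.
have dxi := Ck_derivable (v := u) (kx_xiC h) Ux.
have deta : is_derive x u eta
    (Gam G x u *m eta x - G x *m (u *m f x)^T).
  have h1 := is_derive_mulmxE (derivableP dG) (is_derive_tr dxi).
  have h2 : is_derive x u eta ('D_u G x *m (xi x)^T + G x *m ('D_u xi x)^T).
    apply: near_eq_is_derive h1.
    by apply: (eq_on_near oU _ Ux) => y Uy; rewrite (kx_eta h).
  apply: is_derive_eq h2 _.
  rewrite (Gam_metric oU (kx_G h) (kx_pos h) u Ux) mulmxDl.
  rewrite (kx_eta h Ux) -!mulmxA -addrA; congr (_ + _).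
  by rewrite -mulmxDr -trmx_mul -linearD /= addrC (kx_nxi h u Ux) linearN /= mulmxN.
have [deta' deE] := deta.
have dd p q r (A : 'rV[R]_m -> 'M[R]_(p, q)) (B : 'rV[R]_m -> 'M[R]_(q, r)) C :
    derivable A x u -> derivable B x u -> (forall y, U y -> A y *m B y = C y) ->
    'D_u A x *m B x + A x *m 'D_u B x = 'D_u C x.
  move=> dA dB AB; have [_ e] := is_derive_mulmx dA dB.
  exact: etrans (esym e) (eq_on_derive u oU AB Ux).
have hs := kc_chart_swap h.
apply: (nabla_projector_alg (kx_sum h Ux) (kx_12 h Ux) (kx_21 h Ux) (kx_11 h Ux)
  (kx_1e h Ux) (kx_x1 h Ux) (kx_sym1 h Ux) (kx_f1 h Ux)
  (dd _ _ _ _ _ _ dP1 dP1 (kx_11 h)) _ _ _ (kx_nxi h u Ux) deE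
  (kx_A h u Ux) (kx_A hs u Ux)).
- rewrite -(derive_cst (0 : 'M[R]_m) x u).
  exact: (dd _ _ _ _ _ _ dP2 dP1 (kx_21 h)).
- rewrite -(derive_cst (0 : 'cV[R]_m) x u).
  exact: (dd _ _ _ _ _ _ dP1 deta' (kx_1e h)).
- rewrite -(derive_cst (0 : 'rV[R]_m) x u).
  exact: (dd _ _ _ _ _ _ dxi dP1 (kx_x1 h)).
Qed.

Lemma curvature_block_alg (P1 P2 dM Mu Mv dP1 dP2 Gu : 'M[R]_m)
    (xi dxi w : 'rV[R]_m) (b : 'cV[R]_m) :
  P2 *m P1 = 0 -> xi *m P1 = 0 ->
  Mv = Mv *m P2 + b *m xi ->
  dM *m P1 + Mv *m dP1 = 0 -> dP2 *m P1 + P2 *m dP1 = 0 ->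
  dxi *m P1 + xi *m dP1 = 0 -> Mu *m P1 = 0 -> Mu = dP2 + P2 *m Gu ->
  dxi + xi *m Gu = w ->
  (dM + Mv *m Gu) *m P1 = b *m w *m P1.
Proof.
move=> h21 hx1 MvE r1 r2 r3 MuP MuE wE.
have e2 : P2 *m dP1 = - (dP2 *m P1) by apply/eqP; rewrite -addr_eq0 addrC r2.
have e3 : xi *m dP1 = - (dxi *m P1) by apply/eqP; rewrite -addr_eq0 addrC r3.
have e1 : dM *m P1 = Mv *m dP2 *m P1 + b *m dxi *m P1.
  apply/eqP; rewrite -subr_eq0 -[X in _ - X]opprK opprK; apply/eqP.
  rewrite -[RHS]r1; congr (_ + _).
  rewrite [in RHS]MvE mulmxDl -!mulmxA e2 e3 !mulmxN opprD.
  by rewrite !mulmxA.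
rewrite mulmxDl e1 -wE.
have -> : Mv *m Gu *m P1 = Mv *m (P2 *m Gu) *m P1 + b *m xi *m Gu *m P1.
  by rewrite {1}MvE !mulmxDl !mulmxA.
have E : Mv *m dP2 *m P1 + Mv *m (P2 *m Gu) *m P1 = 0.
  by rewrite -mulmxDl -mulmxDr -MuE -mulmxA MuP mulmx0.
rewrite addrACA E add0r -mulmxDl -mulmxA mulmxDr !mulmxA.
by [].
Qed.

Lemma block_split_alg (P1 P2 dd du dv Gu Gv A B X Y : 'M[R]_m) :
  (dd + (du *m Gv + P2 *m A) + (dv + P2 *m Gv) *m Gu) *m P1 = - X ->
  (dd + (dv *m Gu + P2 *m B) + (du + P2 *m Gu) *m Gv) *m P1 = - Y ->
  P2 *m (A - B + Gv *m Gu - Gu *m Gv) *m P1 = Y - X.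
Proof.
move=> h1 h2; rewrite -[Y]opprK -h2 -h1.
rewrite !(mulmxDl, mulmxDr, mulmxN, mulNmx) !mulmxA; mxring.
Qed.

(** An equation of Gauss type. Covariant derivatives of sections of [D2] leave [D2] only along [xi],
    and [nabla_w xi = - w f]; so the [D1]-part of a second derivative is a product of two such
    terms, antisymmetrized here in [u] and [v]. *)
Lemma curvature_block U G f xi eta P1 P2 x u v :
  kc_chart U G f xi eta P1 P2 -> U x ->
  P2 x *m Rm G x u v *m P1 x =
    G x *m (u *m f x *m P2 x)^T *m (v *m f x) *m P1 x
    - G x *m (v *m f x *m P2 x)^T *m (u *m f x) *m P1 x.
Proof.
move=> h Ux; have oU := kx_open h; have hs := kc_chart_swap h.
(* The row [v *m M w] is the covariant derivative along [w] of the section [v *m P2], for constant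
   [v]. *)
pose M (w y : 'rV[R]_m) : 'M[R]_m := 'D_w P2 y + P2 y *m Gam G y w.
have ME w y : U y -> M w y = M w y *m P2 y + G y *m (w *m f y *m P2 y)^T *m xi y.
  move=> Uy; have h0 := kx_A hs w Uy.
  have M1 : M w y *m P1 y = 0 by rewrite /M; exact h0.
  have Me : M w y *m eta y = G y *m (w *m f y *m P2 y)^T.
    have := nabla_P1 w hs Uy => /(congr1 (fun Q => Q *m eta y)).
    rewrite mulmxBl -[Gam G y w *m P2 y *m _]mulmxA (kx_2e h Uy) mulmx0 subr0.
    move=> E; apply: etrans E _.
    rewrite mulmxDl -[_ *m xi y *m eta y]mulmxA (kx_xe h Uy) mulmx1.
    by rewrite -[eta y *m _ *m _]mulmxA -[_ *m P2 y *m eta y]mulmxA (kx_2e h Uy)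
      !mulmx0 addr0.
  move: (M w y) M1 Me => A M1 Me.
  by rewrite -{1}[A]mulmx1 -(kx_sum h Uy) !mulmxDr M1 add0r mulmxA Me.
have dP1 w := Ck_derivable (v := w) (kx_P1C h) Ux.
have dP2 w := Ck_derivable (v := w) (kx_P2C h) Ux.
have dxi w := Ck_derivable (v := w) (kx_xiC h) Ux.
have dGam a b : derivable (fun y => Gam G y a) x b.
  exact: Ck_derivable (Ck_Gam oU (kx_G h) (kx_pos h) a) Ux.
have ddP a b : derivable ('D_a P2) x b.
  exact: Ck_derivable (Ck_derive a (kx_P2C h)) Ux.
have dM a b : is_derive x b (M a) ('D_b ('D_a P2) x +
    ('D_b P2 x *m Gam G x a + P2 x *m 'D_b (fun y => Gam G y a) x)).
  exact: is_deriveD (derivableP (ddP a b)) (is_derive_mulmx (dP2 b) (dGam a b)).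
have dd w p q r (A : 'rV[R]_m -> 'M[R]_(p, q)) (B : 'rV[R]_m -> 'M[R]_(q, r)) :
    derivable A x w -> derivable B x w -> (forall y, U y -> A y *m B y = 0) ->
    'D_w A x *m B x + A x *m 'D_w B x = 0.
  move=> dA dB AB; have [_ e] := is_derive_mulmx dA dB.
  apply: etrans (esym e) _; rewrite -(derive_cst (0 : 'M[R]_(p, r)) x w).
  exact: (eq_on_derive w oU AB Ux).
(* Differentiating [M z *m P1 = 0] and splitting [M z] by [ME], the part in [P2] is cancelled by
   [M w *m P1 = 0]; the part along [xi] survives through [nabla_w xi]. *)
have key w z : ('D_w (M z) x + M z x *m Gam G x w) *m P1 x =
    G x *m (z *m f x *m P2 x)^T *m (- (w *m f x)) *m P1 x.
  have dMz : derivable (M z) x w by have [] := dM z w.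
  have MP a y : U y -> M a y *m P1 y = 0.
    by move=> Uy; have h0 := kx_A hs a Uy; rewrite /M; exact h0.
  have k1 := dd _ _ _ _ _ _ dMz (dP1 w) (fun y Uy => MP z y Uy).
  have k2 := dd _ _ _ _ _ _ (dP2 w) (dP1 w) (fun y Uy => kx_21 h Uy).
  have k3 := dd _ _ _ _ _ _ (dxi w) (dP1 w) (fun y Uy => kx_x1 h Uy).
  have MuE : M w x = 'D_w P2 x + P2 x *m Gam G x w by [].
  have k4 := ME z x Ux; have k5 := MP w x Ux.
  have k := curvature_block_alg (kx_21 h Ux) (kx_x1 h Ux) k4 k1 k2 k3 k5 MuE
    (kx_nxi h w Ux).
  exact k.
have S := schwarz_mx u v oU (kx_P2C h) Ux.
have k1 := key u v; have k2 := key v u.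
have [_ e1] := dM v u; have [_ e2] := dM u v.
apply: (block_split_alg (dd := 'D_v ('D_u P2) x) (du := 'D_u P2 x)
  (dv := 'D_v P2 x)).
- apply: etrans _ (etrans k1 _).
    by apply: etrans (congr1 (fun Z => (Z + M v x *m Gam G x u) *m P1 x) (esym e1));
      rewrite S.
  by rewrite mulmxN mulNmx.
- apply: etrans _ (etrans k2 _).
    by rewrite e2 /M.
  by rewrite mulmxN mulNmx.
Qed.

(** For the [D1]-component, the first term of [curvature_block] contains [u f P2 = 0] and the second
    contains [g(y, y f) = 0]. For the [xi]-component, pair symmetry and skewness exchange
    [g(R(u, y) y, xi)] for the [u]-component of [R(xi, y) y], where [xi f = 0] gives the same
    conclusion. *)
Lemma curvature_alt U G f xi eta P1 P2 x u y :
  kc_chart U G f xi eta P1 P2 -> U x -> u *m P1 x = u -> y *m P2 x = y ->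
  y *m Rm G x u y *m (P1 x + eta x *m xi x) = 0.
Proof.
move=> h Ux uP yP.
have skew (w : 'rV[R]_m) : w *m G x *m (w *m f x)^T = 0.
  have [sG _] := kx_pos h Ux.
  have : (w *m G x *m (w *m f x)^T)^T = - (w *m G x *m (w *m f x)^T).
    rewrite trmx_mul trmxK trmx_mul sG mulmxA -(mulmxA w (f x)) (kx_skew h Ux).
    by rewrite mulmxN mulNmx (trmx_mul w (f x)) !mulmxA.
  move: (w *m G x *m _) => X XT; apply/matrixP => i j; rewrite !ord1 [RHS]mxE.
  by have /matrixP/(_ 0 0) := XT; rewrite !mxE; lra.
have B w z : w *m P2 x = w -> (z *m f x *m P2 x = 0) ->
    w *m Rm G x z w *m P1 x = 0.
  move=> wP zP; rewrite -{1}wP -!mulmxA (mulmxA (P2 x)) (curvature_block z w h Ux).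
  rewrite zP trmx0 mulmx0 !mul0mx sub0r mulmxN.
  rewrite -(mulmxA w) (kx_f2 h Ux) (mulmxA w) wP !mulmxA.
  by rewrite skew !mul0mx oppr0.
have y1 : y *m Rm G x u y *m P1 x = 0.
  apply: B => //.
  by rewrite -(mulmxA u) (kx_f2 h Ux) mulmxA -uP -(mulmxA u) (kx_12 h Ux) mulmx0 mul0mx.
rewrite mulmxDr y1 add0r mulmxA.
suff -> : y *m Rm G x u y *m eta x = 0 by rewrite mul0mx.
apply/matrixP => i j; rewrite !ord1 [RHS]mxE (kx_eta h Ux) mulmxA.
rewrite (Rm_pair (kx_open h) (kx_G h) (kx_pos h) u y y (xi x) Ux).
rewrite (skew_form u y (Rm_metric (kx_open h) (kx_G h) (kx_pos h) y (xi x) Ux)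
  (proj1 (kx_pos h Ux))).
have -> : y *m Rm G x y (xi x) *m G x *m u^T = 0.
  rewrite -uP trmx_mul -!mulmxA (mulmxA (G x)) -(kx_sym1 h Ux) !mulmxA.
  rewrite Rm_antisym mulmxN !mulNmx B// ?mul0mx ?oppr0//.
  by rewrite (kx_xf h Ux) mul0mx.
by rewrite mxE oppr0.
Qed.

End KContactChart.

Section FirstVariation.
Variables (R : realType) (m : nat).
Local Notation e_ i := (delta_mx 0 i : 'rV[R]_m).

Lemma Rm_linr U (G : 'rV[R]_m -> 'M[R]_m) x u : open U -> Ck 3 U G ->
  (forall y, U y -> posdef (G y)) -> U x -> linear (Rm G x u).
Proof.
move=> oU GC Gp Ux a v w.
have d b c : derivable (fun y => Gam G y b) x c.
  exact: Ck_derivable (Ck_Gam oU GC Gp b) Ux.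
have e1 : 'D_u (fun y => Gam G y (a *: v + w)) x =
    a *: 'D_u (fun y => Gam G y v) x + 'D_u (fun y => Gam G y w) x.
  have [_ e] := is_deriveD (is_deriveZ a (derivableP (d v u))) (derivableP (d w u)).
  apply: etrans (eq_on_derive u oU _ Ux) e => y _.
  exact: Gam_lin.
have C1 := Ck_pred (Ck_Gam oU GC Gp u).
have e2 : 'D_(a *: v + w) (fun y => Gam G y u) x =
    a *: 'D_v (fun y => Gam G y u) x + 'D_w (fun y => Gam G y u) x.
  apply: etrans (derive_mx_dirD _ _ oU C1 Ux) _; congr (_ + _).
  exact: derive_mx_dirZ C1 Ux.
rewrite /Rm e1 e2 (Gam_lin G x a v w) !(mulmxDl, mulmxDr) -!scalemxAl -!scalemxAr.
move: ('D__ _ _) ('D__ _ _) ('D__ _ _) ('D__ _ _) (_ *m _) (_ *m _) (_ *m _) (_ *m _).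
move=> A B C D E F K L.
mxring.
Qed.

Lemma Rm_linl U (G : 'rV[R]_m -> 'M[R]_m) x v : open U -> Ck 3 U G ->
  (forall y, U y -> posdef (G y)) -> U x -> linear (Rm G x ^~ v).
Proof.
move=> oU GC Gp Ux a u w; rewrite /= Rm_antisym (Rm_linr v oU GC Gp Ux).
by rewrite (Rm_antisym _ _ v u) (Rm_antisym _ _ v w) opprD scalerN.
Qed.

Lemma tr_lin n p (a : R) (v w : 'M[R]_(n, p)) : (a *: v + w)^T = a *: v^T + w^T.
Proof. by apply/matrixP => i j; rewrite !mxE. Qed.

Lemma lin_row_comb (a : 'I_m -> R) (W : 'rV[R]_m -> 'M[R]_m) :
  linear W -> \sum_p a p *: W (e_ p) = W (\row_p a p).
Proof.
move=> lW; rewrite (lin_row_sum _ lW); apply: eq_bigr => p _.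
by rewrite mxE.
Qed.

Lemma skew_trace0 (S C : 'M[R]_m) : S^T = - S -> C^T = C -> \tr (S *m C) = 0.
Proof.
move=> sS sC; have : \tr (S *m C) = - \tr (S *m C).
  by rewrite -{1}mxtrace_tr trmx_mul sS sC mulmxN linearN /= mxtrace_mulC.
lra.
Qed.

Variables (U : set 'rV[R]_m) (G f : 'rV[R]_m -> 'M[R]_m).
Variables (xi : 'rV[R]_m -> 'rV[R]_m) (eta : 'rV[R]_m -> 'cV[R]_m).
Variables (P1 P2 : 'rV[R]_m -> 'M[R]_m).
Hypothesis h : kc_chart U G f xi eta P1 P2.
Let oU := kx_open h.

(** For fixed [p], the sum over [r] contracts the symmetric [C] with a form that is skew on [D2] by
    [curvature_alt]. The conditions on [C] and [A] are wide enough to cover both a time derivative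
    of [C2] against [P1] and [C2] against a time derivative of [P1]. *)
Lemma curvature_contraction0 x (C A : 'M[R]_m) : U x ->
  C^T = C -> C *m P2 x = C -> (P1 x + eta x *m xi x) *m A = A ->
  A *m P1 x = A ->
  \sum_r \sum_p (C *m Rm G x (e_ p) (e_ r) *m A) r p = 0.
Proof.
move=> Ux sC CP QA AP.
have Rl v := Rm_linl v oU (kx_G h) (kx_pos h) Ux.
have Rr u := Rm_linr u oU (kx_G h) (kx_pos h) Ux.
have entry (M : 'M[R]_m) r p : M r p = (e_ r *m M *m (e_ p)^T) 0 0.
  by rewrite -rowE trmx_delta -colE !mxE.
have sc (a : R) (X Y : 'M[R]_(1, 1)) : (a *: X + Y) 0 0 = a *: X 0 0 + Y 0 0.
  by rewrite !mxE.
pose B (r : 'I_m) (a b : 'rV[R]_m) : R := (e_ r *m C *m Rm G x a (e_ r) *m A *m b^T) 0 0.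
have bB r : bilin (B r).
  split=> [v a u w|u a v w]; rewrite /B.
    by rewrite Rl mulmxDr -scalemxAr !mulmxDl -!scalemxAl sc.
  by rewrite tr_lin mulmxDr -scalemxAr sc.
rewrite (eq_bigr (fun r => \sum_p B r (e_ p *m P1 x) (e_ p))); last first.
  move=> r _; rewrite -[X in _ *m X](trmxK (P1 x)) in AP *.
  rewrite -[P1 x in RHS]trmxK (bilin_contract1 _ (bB r)).
  apply: eq_bigr => p _; rewrite entry /B trmx_mul trmxK !mulmxA.
  by rewrite -[in LHS]AP trmxK !mulmxA.
rewrite exchange_big big1// => p _ /=.
set u := e_ p *m P1 x.
have uP : u *m P1 x = u by rewrite /u -mulmxA (kx_11 h Ux).
pose B' (y z : 'rV[R]_m) : R := (y *m Rm G x u z *m A *m (e_ p)^T) 0 0.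
have bB' : bilin B'.
  split=> [v a w z|w a v z]; rewrite /B'.
    by rewrite !mulmxDl -!scalemxAl sc.
  by rewrite Rr mulmxDr -scalemxAr !mulmxDl -!scalemxAl sc.
have alt y : B' (y *m P2 x) (y *m P2 x) = 0.
  have yP : y *m P2 x *m P2 x = y *m P2 x by rewrite -mulmxA (kx_22 h Ux).
  by rewrite /B' -QA !mulmxA (curvature_alt h Ux uP yP) !mul0mx mxE.
have := bilin_alt_contract bB' alt sC CP; rewrite /B /B'.
by move: (\sum_r _) => s; lra.
Qed.

Variables (C2 : 'rV[R]_m -> 'M[R]_m) (Pi : 'I_m -> 'rV[R]_m -> 'M[R]_m).
Hypothesis C2C : Ck 1 U C2.
Hypothesis C2G : forall x, U x -> G x *m C2 x = P2 x.
Hypothesis C2sym : forall x, U x -> (C2 x)^T = C2 x.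
Hypothesis PiC : forall r, Ck 1 U (Pi r).

(** Its two traces come from the two terms [nabla_p Pi_r] and [nabla_r Pi_p] of the linearized
    curvature, once the derivative has been moved outside the contraction. *)
Definition variation_field y : 'rV[R]_m :=
  \row_k \sum_r ((C2 y *m Pi r y *m P1 y) r k - (C2 y *m Pi r y *m P1 y) k r).

Let C2P x : U x -> C2 x *m P2 x = C2 x.
Proof.
move=> Ux; have uG := posdef_unit (kx_pos h Ux).
have [sG _] := kx_pos h Ux.
have E : C2 x = invmx (G x) *m P2 x by rewrite -C2G// mulKmx.
by rewrite E -mulmxA (kx_22 h Ux).
Qed.

(** The metric is parallel and [G *m C2 = P2], so this is [nabla P2] and [nabla_P1] applies after
    the swap. *)
Let nabla_C2 x u : U x ->
  G x *m ('D_u C2 x + (Gam G x u)^T *m C2 x + C2 x *m Gam G x u) =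
  G x *m (u *m f x *m P2 x)^T *m xi x + eta x *m (u *m f x *m P2 x).
Proof.
move=> Ux; rewrite -(nabla_P1 u (kc_chart_swap h) Ux).
have dG := Ck_derivable (v := u) (kx_G h) Ux.
have dC := Ck_derivable (v := u) C2C Ux.
have [_ e] := is_derive_mulmx dG dC.
have e' : 'D_u P2 x = 'D_u G x *m C2 x + G x *m 'D_u C2 x.
  apply: etrans _ e; apply: (eq_on_derive u oU _ Ux) => y Uy.
  by rewrite C2G.
rewrite e' (Gam_metric oU (kx_G h) (kx_pos h) u Ux) -(C2G Ux).
by rewrite !(mulmxDl, mulmxDr) !mulmxA; mxring.
Qed.

(** [f *m G] is skew while [invmx G *m P] is symmetric, so the trace of their product is zero. *)
Let trace_f (P : 'M[R]_m) x : U x -> P *m G x = G x *m P^T ->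
  \tr (f x *m P) = 0.
Proof.
move=> Ux sP; have uG := posdef_unit (kx_pos h Ux).
have [sG _] := kx_pos h Ux.
have -> : f x *m P = (f x *m G x) *m (invmx (G x) *m P).
  by rewrite !mulmxA mulmxK.
rewrite skew_trace0//.
  by rewrite trmx_mul sG (kx_skew h Ux) opprK.
rewrite trmx_mul trmx_inv sG.
by rewrite -[RHS](mulmxK uG) -(mulmxA _ P) sP mulmxA mulVmx// mul1mx.
Qed.

Let div_form x (F : 'I_m -> 'rV[R]_m) (X : 'M[R]_m) (Gx : 'M[R]_m) k :
  (forall p, F p = e_ p *m X) -> xi x *m X = 0 -> \tr X = 0 ->
  \sum_p (Gx *m (F p)^T *m xi x + eta x *m F p) k p = 0.
Proof.
move=> FE xX tX; rewrite (eq_bigr (fun p => (Gx *m (F p)^T) k 0 * xi x 0 p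
    + eta x k 0 * X p p)); last first.
  move=> p _; rewrite mxE; congr (_ + _); first by rewrite mxE big_ord1.
  by rewrite mxE big_ord1 FE -rowE mxE.
rewrite big_split /= -mulr_sumr.
move: tX; rewrite /mxtrace => ->.
rewrite mulr0 addr0.
have -> : \sum_i (Gx *m (F i)^T) k 0 * xi x 0 i = (Gx *m (xi x *m X)^T) k 0.
  rewrite {2}[xi x]row_sum_delta mulmx_suml linear_sum mulmx_sumr summxE.
  apply: eq_bigr => i _.
  by rewrite -scalemxAl -FE linearZ /= -scalemxAr [RHS]mxE mulrC.
by rewrite xX trmx0 mulmx0 mxE.
Qed.

(** The left side is the Leibniz rule for the trace of [C2 *m Rm *m P1], with [C2'] and [P1']
    standing for time derivatives. Their two terms vanish by [curvature_contraction0]; the middle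
    one is the divergence. *)
Lemma first_variation x (C2' P1' : 'M[R]_m) : U x ->
  C2'^T = C2' -> C2' *m P2 x = C2' ->
  eta x *m xi x *m P1' = P1' -> P1' *m P1 x = P1' ->
  \sum_r \sum_p (C2' *m Rm G x (e_ p) (e_ r) *m P1 x
    + C2 x *m ('D_(e_ p) (Pi r) x - 'D_(e_ r) (Pi p) x
        + Pi r x *m Gam G x (e_ p) + Gam G x (e_ r) *m Pi p x
        - Pi p x *m Gam G x (e_ r) - Gam G x (e_ p) *m Pi r x) *m P1 x
    + C2 x *m Rm G x (e_ p) (e_ r) *m P1') r p
  = \sum_k ('D_(e_ k) variation_field x 0 k
            + (variation_field x *m Gam G x (e_ k)) 0 k).
Proof.
move=> Ux sC' C'P xP P1P; have uG := posdef_unit (kx_pos h Ux).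
have [sG _] := kx_pos h Ux.
have QP1 : (P1 x + eta x *m xi x) *m P1 x = P1 x.
  by rewrite mulmxDl (kx_11 h Ux) -mulmxA (kx_x1 h Ux) mulmx0 addr0.
have QP1' : (P1 x + eta x *m xi x) *m P1' = P1'.
  rewrite mulmxDl xP -{1}xP !mulmxA (kx_1e h Ux) !mul0mx add0r.
  by [].
have z1 := curvature_contraction0 Ux sC' C'P QP1 (kx_11 h Ux).
have z2 := curvature_contraction0 Ux (C2sym Ux) (C2P Ux) QP1' P1P.
transitivity (\sum_r \sum_p (C2 x *m ('D_(e_ p) (Pi r) x - 'D_(e_ r) (Pi p) x
        + Pi r x *m Gam G x (e_ p) + Gam G x (e_ r) *m Pi p x
        - Pi p x *m Gam G x (e_ r) - Gam G x (e_ p) *m Pi r x) *m P1 x) r p).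
  transitivity (\sum_r \sum_p (C2' *m Rm G x (e_ p) (e_ r) *m P1 x) r p +
    \sum_r \sum_p (C2 x *m ('D_(e_ p) (Pi r) x - 'D_(e_ r) (Pi p) x
        + Pi r x *m Gam G x (e_ p) + Gam G x (e_ r) *m Pi p x
        - Pi p x *m Gam G x (e_ r) - Gam G x (e_ p) *m Pi r x) *m P1 x) r p
    + \sum_r \sum_p (C2 x *m Rm G x (e_ p) (e_ r) *m P1') r p); last first.
    by rewrite z1 z2 add0r addr0.
  rewrite -!big_split /=; apply: eq_bigr => r _.
  rewrite -!big_split /=; apply: eq_bigr => p _.
  move: (C2' *m _ *m _) (C2 x *m _ *m P1 x) (C2 x *m _ *m P1') => A B D.
  by rewrite !mxE.
pose nC (u : 'rV[R]_m) : 'M[R]_m := 'D_u C2 x + (Gam G x u)^T *m C2 x + C2 x *m Gam G x u.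
pose nP (u : 'rV[R]_m) : 'M[R]_m := 'D_u P1 x + P1 x *m Gam G x u - Gam G x u *m P1 x.
have nCE u : nC u = invmx (G x) *m
    (G x *m (u *m f x *m P2 x)^T *m xi x + eta x *m (u *m f x *m P2 x)).
  by rewrite -nabla_C2// mulKmx.
have nPE u := nabla_P1 u h Ux.
pose Q (X : 'M[R]_m) (u : 'rV[R]_m) : 'M[R]_m := G x *m (u *m X)^T *m xi x + eta x *m (u *m X).
have lQ X : linear (Q X).
  move=> a u v; rewrite /Q mulmxDl -scalemxAl tr_lin.
  rewrite !(mulmxDl, mulmxDr) -!scalemxAr -!scalemxAl.
  by rewrite scalerDr addrACA.
(* Of the four contractions, [hh1] and [hh4] vanish because [f] commutes with the projectors and
   [P1 P2 = P2 P1 = 0]; [hh2] and [hh3] vanish because [f P1] and [f P2] are traceless and killed by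
   [xi] on the left. *)
have hh1 q : \sum_p P1 x q p *: nC (e_ p) = 0.
  rewrite (eq_bigr (fun p => invmx (G x) *m (P1 x q p *: Q (f x *m P2 x) (e_ p)))).
    rewrite -mulmx_sumr (lin_row_comb _ (lQ _)) /Q.
    have -> : \row_p P1 x q p = row q (P1 x) by apply/rowP => p; rewrite !mxE.
    have z : P1 x *m (f x *m P2 x) = 0.
      by rewrite mulmxA -(kx_f1 h Ux) -mulmxA (kx_12 h Ux) mulmx0.
    by rewrite -row_mul z row0 trmx0 !mulmx0 mul0mx addr0 mulmx0.
  by move=> p _; rewrite nCE -scalemxAr /Q -(mulmxA (e_ p) (f x) (P2 x)).
have hh2 k : \sum_p nP (e_ p) k p = 0.
  rewrite (eq_bigr (fun p => (G x *m (e_ p *m (f x *m P1 x))^T *m xi x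
     + eta x *m (e_ p *m (f x *m P1 x))) k p)); last first.
    by move=> p _; rewrite /nP nPE -(mulmxA (e_ p) (f x) (P1 x)).
  apply: (div_form (X := f x *m P1 x)) => //; last exact: trace_f Ux (kx_sym1 h Ux).
  by rewrite mulmxA (kx_xf h Ux) mul0mx.
have nCsym u : (nC u)^T = nC u.
  have dC : ('D_u C2 x)^T = 'D_u C2 x.
    have dC := Ck_derivable (v := u) C2C Ux.
    apply: etrans (esym (derive_tr dC)) _.
    by apply: (eq_on_derive u oU _ Ux) => y Uy; rewrite C2sym.
  rewrite /nC !linearD /= !trmx_mul trmxK (C2sym Ux) dC.
  by rewrite -addrA [X in _ + X]addrC addrA.
have hh3 k : \sum_r nC (e_ r) r k = 0.
  rewrite (eq_bigr (fun r => \sum_l invmx (G x) k l *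
    (G x *m (e_ r *m (f x *m P2 x))^T *m xi x
     + eta x *m (e_ r *m (f x *m P2 x))) l r)); last first.
    move=> r _; rewrite -nCsym mxE nCE mxE.
    by rewrite -(mulmxA (e_ r) (f x) (P2 x)).
  rewrite exchange_big big1// => l _; rewrite -mulr_sumr.
  rewrite (div_form (X := f x *m P2 x)) ?mulr0//.
    by rewrite mulmxA (kx_xf h Ux) mul0mx.
  exact: trace_f Ux (kx_sym2 h Ux).
have hh4 k : \sum_r C2 x r k *: nP (e_ r) = 0.
  rewrite (eq_bigr (fun r => C2 x r k *: Q (f x *m P1 x) (e_ r))); last first.
    by move=> r _; rewrite /nP nPE /Q -(mulmxA (e_ r) (f x) (P1 x)).
  rewrite (lin_row_comb _ (lQ _)) /Q.
  have -> : \row_r C2 x r k = row k (C2 x).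
    by apply/rowP => p; rewrite !mxE -{1}C2sym// mxE.
  have z : C2 x *m (f x *m P1 x) = 0.
    rewrite -C2P// -mulmxA (mulmxA (P2 x)) -(kx_f2 h Ux) -mulmxA (kx_21 h Ux).
    by rewrite !mulmx0.
  by rewrite -row_mul z row0 trmx0 !mulmx0 mul0mx addr0.
have Gsym i j k : Gam G x (e_ i) j k = Gam G x (e_ j) i k.
  have := Gam_sym oU (kx_pos h) (e_ i) (e_ j) Ux => /(congr1 (fun M : 'rV[R]_m => M 0 k)).
  by rewrite -!rowE !mxE.
apply: etrans (linearized_curvature_div (dC := fun p => 'D_(e_ p) C2 x)
  (dP := fun p => 'D_(e_ p) P1 x) (Ga := fun p => Gam G x (e_ p))
  (fun r => Pi r x) (fun p r => 'D_(e_ p) (Pi r) x) Gsym hh1 hh2 hh3 hh4) _.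
have dC u := Ck_derivable (v := u) C2C Ux.
have dP u := Ck_derivable (v := u) (kx_P1C h) Ux.
have dPi r u := Ck_derivable (v := u) (PiC r) Ux.
pose X (r : 'I_m) (y : 'rV[R]_m) : 'M[R]_m := C2 y *m Pi r y *m P1 y.
pose dX (p r : 'I_m) : 'M[R]_m := 'D_(e_ p) C2 x *m Pi r x *m P1 x + C2 x *m 'D_(e_ p) (Pi r) x *m P1 x
  + C2 x *m Pi r x *m 'D_(e_ p) P1 x.
have XD p r : is_derive x (e_ p) (X r) (dX p r).
  have := is_derive_mulmxE (is_derive_mulmx (dC (e_ p)) (dPi r (e_ p)))
    (derivableP (dP (e_ p))).
  by rewrite mulmxDl.
have VD k : 'D_(e_ k) variation_field x 0 k = \sum_r (dX k r r k - dX k r k r).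
  have VDk : is_derive x (e_ k) variation_field
      (\row_j \sum_r (dX k r r j - dX k r j r)).
    apply: is_derive_mxP => i j; rewrite ord1 mxE.
    rewrite (_ : (fun y => _) = \sum_r (fun y => X r y r j - X r y j r)).
      apply: is_derive_sum => r.
      exact: is_deriveB (is_derive_entry r j (XD k r)) (is_derive_entry j r (XD k r)).
    by apply/funext => y; rewrite mxE fct_sumE.
  by have [_ ->] := VDk; rewrite mxE.
have VG k : (variation_field x *m Gam G x (e_ k)) 0 k =
    \sum_r (X r x *m Gam G x (e_ k)) r k - \sum_r ((Gam G x (e_ k))^T *m X r x) k r.
  rewrite mxE -sumrB.
  rewrite (eq_bigr (fun l => \sum_r (X r x r l * Gam G x (e_ k) l k
    - Gam G x (e_ k) l k * X r x l r))); last first.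
    move=> l _; rewrite mxE mulr_suml; apply: eq_bigr => r _.
    by rewrite /X mulrBl [X in _ - X]mulrC.
  rewrite exchange_big /=; apply: eq_bigr => r _.
  rewrite sumrB; congr (_ - _); first by rewrite mxE.
  by rewrite mxE; apply: eq_bigr => l _; rewrite [in RHS]mxE.
transitivity (\sum_k ((\sum_r (dX k r r k + (X r x *m Gam G x (e_ k)) r k))
  - \sum_r (dX k r k r + ((Gam G x (e_ k))^T *m X r x) k r))); last first.
  by apply: eq_bigr => k _; rewrite VD VG sumrB !big_split /= opprD addrACA.
rewrite sumrB [X in _ = X - _]exchange_big /=; congr (_ - _).
  by apply: eq_bigr => r _; apply: eq_bigr => p _; rewrite mxE.
by apply: eq_bigr => r _; apply: eq_bigr => p _; rewrite mxE.
Qed.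

End FirstVariation.

Transparent derive.

(** * Families of metrics: joint regularity in time and space *)

Section Slices.
Variables (R : realType) (V W : normedModType R).
Implicit Types F : (R * V)%type -> W.

Lemma is_derive_slice F t x v : derivable F (t, x) (0, v) ->
  is_derive x v (fun y => F (t, y)) ('D_(0, v) F (t, x)).
Proof.
have E : (fun h => h^-1 *: (((fun y => F (t, y)) \o shift x) (h *: v) - F (t, x))) =
    (fun h => h^-1 *: ((F \o shift (t, x)) (h *: (0, v)) - F (t, x))).
  apply/funext => h /=; congr (_ *: (F _ - _)).
  by apply: injective_projections => /=; rewrite ?scaler0 ?add0r.
move=> dF; split; first by move: dF; rewrite /derivable E.
by rewrite /derive E.
Qed.

Lemma is_derive_slice_time F t x : derivable F (t, x) (1, 0) ->
  is_derive t 1 (fun s : R => F (s, x)) ('D_(1, 0) F (t, x)).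
Proof.
have E : (fun h => h^-1 *: (((fun s : R => F (s, x)) \o shift t) (h *: 1) - F (t, x))) =
    (fun h => h^-1 *: ((F \o shift (t, x)) (h *: (1, 0)) - F (t, x))).
  apply/funext => h /=; congr (_ *: (F _ - _)).
  by apply: injective_projections => /=; rewrite ?scaler0 ?add0r.
move=> dF; split; first by move: dF; rewrite /derivable E.
by rewrite /derive E.
Qed.

End Slices.

Section Tube.
Variables (R : realType) (m : nat).
Local Notation V := (R * 'rV[R]_m)%type.
Implicit Types (eps t : R) (U : set 'rV[R]_m).

Definition tube eps U : set V := [set q | `|q.1| < eps /\ U q.2].

Lemma tube_open eps U : open U -> open (tube eps U).
Proof.
move=> oU; rewrite openE => -[t x] [/= te Ux].
exists ([set s : R | `|s| < eps], U); last by move=> [s y] [/= ? ?].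
split=> /=; last exact: (near_open oU Ux).
apply: open_nbhs_nbhs; split=> //.
have -> : [set s : R | `|s| < eps] = ball (0 : R) eps.
  by apply/seteqP; split=> s /=; rewrite /ball /= sub0r normrN.
exact: ball_open.
Qed.

Let pair_continuous t : continuous (fun y : 'rV[R]_m => (t, y)).
Proof.
move=> x; apply: (@cvg_pair _ _ _ (nbhs x) (nbhs t) (nbhs x) _ _ _ (fun=> t) id).
  exact: cvg_cst.
exact: cvg_id.
Qed.

Lemma Ck_slice (W : normedModType R) eps U n t (F : V -> W) : open U -> `|t| < eps ->
  Ck n (tube eps U) F -> Ck n U (fun x => F (t, x)).
Proof.
move=> oU te; elim: n F => [|n IH] F [cF hF].
  split=> // x Ux; apply: (@continuous_comp _ _ _ (fun y => (t, y)) F).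
    exact: pair_continuous.
  by apply: cF; split.
have [dF hF'] := hF; split; last split.
- move=> x Ux; apply: (@continuous_comp _ _ _ (fun y => (t, y)) F).
    exact: pair_continuous.
  by apply: cF; split.
- move=> x v Ux; have [] // := @is_derive_slice _ _ _ F t x v _.
  by apply: dF; split.
- move=> v; apply: Ck_ext (IH _ (hF' (0, v))) => // x Ux.
  have [_ e] := @is_derive_slice _ _ _ F t x v (dF (t, x) (0, v) (conj te Ux)).
  exact: esym e.
Qed.

Lemma Ck_proj2 (W : normedModType R) eps U n (F : 'rV[R]_m -> W) : open U ->
  Ck n U F -> Ck n (tube eps U) (fun q : V => F q.2).
Proof.
move=> oU; elim: n F => [|n IH] F [cF hF].
  split=> // -[t x] [/= te Ux].
  by apply: (@continuous_comp _ _ _ (fun q : V => q.2) F); [exact: cvg_snd|exact: cF].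
have [dF hF'] := hF.
have D q v : U q.2 -> is_derive q v (fun q : V => F q.2) ('D_v.2 F q.2).
  move=> Uq; have d := dF _ v.2 Uq.
  split; first exact: d.
  by [].
split; last split.
- move=> -[t x] [/= te Ux].
  by apply: (@continuous_comp _ _ _ (fun q : V => q.2) F); [exact: cvg_snd|exact: cF].
- by move=> q v [_ Uq]; have [] := D q v Uq.
- move=> v; apply: Ck_ext (IH _ (hF' v.2)) => [|q [_ Uq]]; first exact: tube_open.
  by have [_ e] := D q v Uq; exact: esym e.
Qed.

End Tube.

Opaque derive.

Section MutualCurvature.
Variables (R : realType) (m : nat).
Local Notation e_ i := (delta_mx 0 i : 'rV[R]_m).

(** Expanding the frame vectors in the basis leaves only [E^T *m E] and [F^T *m F]. The mutual
    curvature thereby becomes a trace in [cofr], free of the chosen frames. *)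
Lemma frame_contraction k l (E : 'M[R]_(k, m)) (F : 'M[R]_(l, m)) (G : 'M[R]_m)
    (B : 'rV[R]_m -> 'rV[R]_m -> 'M[R]_m) : bilin B ->
  \sum_a \sum_i dot G (row i F *m B (row a E) (row i F)) (row a E) =
  \sum_r \sum_p (F^T *m F *m B (e_ p) (e_ r) *m (G *m (E^T *m E))) r p.
Proof.
move=> bB; pose X p r := F *m B (e_ p) (e_ r) *m G *m E^T.
transitivity (\sum_a \sum_i \sum_r \sum_p F i r * X p r i a * E a p).
  apply: eq_bigr => a _; apply: eq_bigr => i _.
  have -> : B (row a E) (row i F) = \sum_r \sum_p (F i r * E a p) *: B (e_ p) (e_ r).
    rewrite [row a E]row_sum_delta [row i F]row_sum_delta bilin_sumr//.
    apply: eq_bigr => r _; rewrite bilin_suml// scaler_sumr; apply: eq_bigr => p _.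
    by rewrite scalerA !mxE.
  rewrite /dot !(mulmx_sumr, mulmx_suml) summxE; apply: eq_bigr => r _.
  rewrite !(mulmx_sumr, mulmx_suml) summxE; apply: eq_bigr => p _.
  rewrite -scalemxAr -!scalemxAl mxE mulrAC; congr (_ * _).
  congr (_ * _); rewrite -!row_mul [LHS]mxE [LHS]mxE /X [RHS]mxE.
  apply: eq_bigr => j _; congr (_ * _).
  by rewrite !mxE.
have RE r p : (F^T *m F *m B (e_ p) (e_ r) *m (G *m (E^T *m E))) r p =
    \sum_a \sum_i F i r * X p r i a * E a p.
  rewrite (_ : _ *m _ = F^T *m X p r *m E); last by rewrite /X !mulmxA.
  rewrite mxE; apply: eq_bigr => a _; rewrite mxE mulr_suml.
  by apply: eq_bigr => i _; rewrite mxE.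
transitivity (\sum_r \sum_p \sum_a \sum_i F i r * X p r i a * E a p); last first.
  by apply: eq_bigr => r _; apply: eq_bigr => p _; rewrite RE.
transitivity (\sum_a \sum_r \sum_p \sum_i F i r * X p r i a * E a p).
  apply: eq_bigr => a _; rewrite exchange_big; apply: eq_bigr => r _.
  exact: exchange_big.
rewrite exchange_big; apply: eq_bigr => r _; exact: exchange_big.
Qed.

Lemma chart_mutual_curvatureE U (G D1 D2 : 'rV[R]_m -> 'M[R]_m) x : open U -> Ck 3 U G ->
  (forall y, U y -> posdef (G y)) -> U x ->
  chart_mutual_curvature G D1 D2 x =
  \sum_r \sum_p (cofr (G x) (D2 x) *m Rm G x (e_ p) (e_ r) *m
                 (G x *m cofr (G x) (D1 x))) r p.
Proof.
move=> oU GC Gp Ux; rewrite /chart_mutual_curvature /cofr -frame_contraction; last first.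
  by split=> v; [exact: Rm_linl Gp Ux|exact: Rm_linr Gp Ux].
apply: eq_bigr => a _; apply: eq_bigr => i _; congr (dot _ _ _).
exact: (riemE oU GC Gp).
Qed.

End MutualCurvature.

Opaque Ck.
Section TimeFamily.
Variables (R : realType) (m : nat).
Local Notation e_ i := (delta_mx 0 i : 'rV[R]_m).
Local Notation V := (R * 'rV[R]_m)%type.
Variables (eps : R) (U : set 'rV[R]_m) (Gt : V -> 'M[R]_m).
Hypotheses (oU : open U) (GtC : Ck 3 (tube eps U) Gt).
Hypothesis Gtpos : forall q, tube eps U q -> posdef (Gt q).
Local Notation T := (tube eps U).
Let oT : open T := tube_open (eps := eps) oU.

Definition smooth_span (D : 'rV[R]_m -> 'M[R]_m) := exists k : nat, forall x, U x ->
  \rank (D x) = k /\ exists (U' : set 'rV[R]_m) (E : 'rV[R]_m -> 'M[R]_(k, m)),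
    [/\ open U', U' x, U' `<=` U, smooth_on U' E & forall y, U' y -> (E y == D y)%MS].

(** Locally a smooth basis of [D], which does not move in time, is available, and [cofr_basis] is a
    rational expression in it and the metric. *)
Lemma Ck_cofr D : smooth_span D -> Ck 3 T (fun q => cofr (Gt q) (D q.2)).
Proof.
move=> [k hD]; apply: Ck_local => -[t x] [/= te Ux].
have [_ [U' [E [oU' U'x sU' sE ED]]]] := hD x Ux.
have sT : tube eps U' `<=` T by move=> q [? /sU'].
have oT' := tube_open (eps := eps) oU'.
exists (tube eps U'); split; [exact: oT'|by split|].
have rD y : U' y -> \rank (D y) = k by move=> /sU'/hD[].
have b q : tube eps U' q -> _ := fun h =>
  cofr_basis (Gtpos (sT _ h)) (ED _ h.2) (rD _ h.2).
have CE : Ck 3 (tube eps U') (fun q => E q.2) := Ck_proj2 eps oU' (smooth_Ck 3 sE).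
have CG : Ck 3 (tube eps U') Gt by exact: Ck_sub GtC.
have e q : tube eps U' q -> (E q.2)^T *m invmx (E q.2 *m Gt q *m (E q.2)^T) *m E q.2 =
    cofr (Gt q) (D q.2) by move=> /b[_ e]; exact: esym e.
have CtE := Ck_tr oT' CE.
have CEG := Ck_mulmx oT' (Ck_mulmx oT' CE CG) CtE.
have u q : tube eps U' q -> E q.2 *m Gt q *m (E q.2)^T \in unitmx by move=> /b[].
have C := Ck_mulmx oT' (Ck_mulmx oT' CtE (Ck_invmx oT' u CEG)) CE.
exact: (Ck_ext oT' e C).
Qed.

Let slice_pd q a b c : T q ->
  'D_(e_ a) (fun y => Gt (q.1, y) b c) q.2 = 'D_(0, e_ a) Gt q b c.
Proof.
case: q => t x Tq; have d := Ck_derivable (v := (0, e_ a)) GtC Tq.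
have e1 := @is_derive_slice _ _ _ (fun q => Gt q b c) t x (e_ a)
  ((derivable_mxP _ _ _).1 d b c).
have [_ e2] := e1; exact: (etrans e2 (derive_entry b c d)).
Qed.

Definition Gam_family u (q : V) : 'M[R]_m := Gam (fun y => Gt (q.1, y)) q.2 u.

Lemma Ck_Gam_family u : Ck 2 T (Gam_family u).
Proof.
have C2 a b c : Ck 2 T (fun q => 'D_(0, e_ a) Gt q b c).
  exact: (Ck_entry b c oT (Ck_derive _ GtC)).
have Ci : Ck 2 T (fun q => invmx (Gt q)).
  exact: (Ck_invmx oT (fun q h => posdef_unit (Gtpos h)) (Ck_pred GtC)).
pose ch k i j q := 2^-1 * \sum_l invmx (Gt q) k l *
  ('D_(0, e_ i) Gt q j l + 'D_(0, e_ j) Gt q i l - 'D_(0, e_ l) Gt q i j).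
have Cch k i j : Ck 2 T (ch k i j).
  apply: (CkM oT (Ck_cst 2 _ _)); apply: (Ck_sum _ oT) => l _.
  apply: (CkM oT (Ck_entry k l oT Ci)).
  exact: (CkB oT (CkD oT (C2 i j l) (C2 j i l)) (C2 l i j)).
have E j k q : T q -> \sum_i u 0 i * ch k i j q = Gam_family u q j k.
  move=> Tq; rewrite /Gam_family mxE; apply: eq_bigr => i _; congr (_ * (_ * _)).
  apply: eq_bigr => l _; congr (_ * (_ + _ - _)); last exact/esym/slice_pd.
  - by congr (invmx (Gt _) _ _); case: (q).
  - exact/esym/slice_pd.
  - exact/esym/slice_pd.
have C j k : Ck 2 T (fun q => Gam_family u q j k).
  apply: (Ck_ext oT (E j k)); apply: (Ck_sum _ oT) => i _.
  exact: (CkM oT (Ck_cst 2 _ _) (Cch k i j)).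
exact: (Ck_mxP _ _ oT).2 C.
Qed.

Definition Rm_family u v (q : V) : 'M[R]_m := Rm (fun y => Gt (q.1, y)) q.2 u v.

Lemma Rm_familyE u v q : T q -> Rm_family u v q =
  'D_(0, u) (Gam_family v) q - 'D_(0, v) (Gam_family u) q
  + Gam_family v q *m Gam_family u q - Gam_family u q *m Gam_family v q.
Proof.
case: q => t x Tq.
have e a b : 'D_a (fun y => Gam (fun y => Gt (t, y)) y b) x = 'D_(0, a) (Gam_family b) (t, x).
  have [_ e] := @is_derive_slice _ _ _ (Gam_family b) t x a (Ck_derivable (Ck_Gam_family b) Tq).
  exact: e.
exact: (f_equal2 (fun A B => A - B + Gam_family v (t, x) *m Gam_family u (t, x)
  - Gam_family u (t, x) *m Gam_family v (t, x)) (e u v) (e v u)).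
Qed.

Lemma Ck_Rm_family u v : Ck 1 T (Rm_family u v).
Proof.
have C1 w := Ck_pred (Ck_Gam_family w).
have D w z : Ck 1 T ('D_(0, w) (Gam_family z)) by exact: Ck_derive (Ck_Gam_family z).
have C := CkB oT (CkD oT (CkB oT (D u v) (D v u)) (Ck_mulmx oT (C1 v) (C1 u)))
  (Ck_mulmx oT (C1 u) (C1 v)).
exact: (Ck_ext oT (fun q Tq => esym (Rm_familyE u v Tq)) C).
Qed.

Variables D1 D2 : 'rV[R]_m -> 'M[R]_m.
Hypotheses (sD1 : smooth_span D1) (sD2 : smooth_span D2).

Definition chart_curvature q := chart_mutual_curvature (fun y => Gt (q.1, y)) D1 D2 q.2.

Let slice_pos t : `|t| < eps -> forall y, U y -> posdef (Gt (t, y)).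
Proof. by move=> te y Uy; exact: Gtpos. Qed.

Lemma chart_curvatureE q : T q -> chart_curvature q = \sum_r \sum_p
  (cofr (Gt q) (D2 q.2) *m Rm_family (e_ p) (e_ r) q *m (Gt q *m cofr (Gt q) (D1 q.2))) r p.
Proof.
case: q => t x [/= te Ux].
exact: chart_mutual_curvatureE oU (Ck_slice oU te GtC) (slice_pos te) Ux.
Qed.

Lemma Ck_chart_curvature : Ck 1 T chart_curvature.
Proof.
have C1 := Ck_le (isT : (1 <= 3)%N) (Ck_cofr sD1).
have C2 := Ck_le (isT : (1 <= 3)%N) (Ck_cofr sD2).
have CG := Ck_le (isT : (1 <= 3)%N) GtC.
have C r p := Ck_entry r p oT (Ck_mulmx oT (Ck_mulmx oT C2 (Ck_Rm_family (e_ p) (e_ r)))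
  (Ck_mulmx oT CG C1)).
apply: (Ck_ext oT (fun q Tq => esym (chart_curvatureE Tq))).
by apply: (Ck_sum _ oT) => r _; apply: (Ck_sum _ oT) => p _; exact: C.
Qed.

(** A relation linear in [F (t, x)] with coefficients independent of [t] may be differentiated at
    [t = 0]. Such relations arise by composing with the projectors of time 0, as [D1] and [D2] are
    fixed. *)
Let time_linear (F : V -> 'M[R]_m) x (A B A' B' c : 'M[R]_m) : 0 < eps -> U x ->
  Ck 1 T F ->
  (forall t, `|t| < eps -> A *m F (t, x) *m B = A' *m F (t, x) *m B' + c) ->
  A *m 'D_(1, 0) F (0, x) *m B = A' *m 'D_(1, 0) F (0, x) *m B'.
Proof.
move=> eps0 Ux CF h; have T0 : T (0, x) by split=> //=; rewrite normr0.
have [d e] := @is_derive_slice_time _ _ _ F 0 x (Ck_derivable CF T0).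
have dl (A0 B0 : 'M[R]_m) : is_derive (0 : R) 1 (fun t => A0 *m F (t, x) *m B0)
    (A0 *m 'D_(1, 0) F (0, x) *m B0).
  have cA := derivable_cst (V := R) A0 0 1; have cB := derivable_cst (V := R) B0 0 1.
  have [d1 e1] := is_derive_mulmx cA d.
  have [d2 e2] := is_derive_mulmx d1 cB.
  apply: DeriveDef; first exact: d2.
  apply: (etrans e2); rewrite derive_cst mulmx0 addr0; congr (_ *m _).
  by apply: (etrans e1); rewrite derive_cst mul0mx add0r; congr (_ *m _).
have [d1 e1] := dl A B; have [d2 e2] := dl A' B'.
have [_ e3] := is_deriveD (DeriveDef d2 e2) (is_derive_cst c (0 : R) 1).
apply: (etrans (esym e1)); rewrite addr0 in e3; apply: (etrans _ e3).
apply: near_eq_derive; near=> t; rewrite h//; near: t.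
Unshelve. all: end_near. Qed.

Variables (f : 'rV[R]_m -> 'M[R]_m) (xi : 'rV[R]_m -> 'rV[R]_m) (eta : 'rV[R]_m -> 'cV[R]_m).
Let C1 (q : V) := cofr (Gt q) (D1 q.2).
Let C2 (q : V) := cofr (Gt q) (D2 q.2).
Let PP1 (q : V) := Gt q *m C1 q.
Let G0 (x : 'rV[R]_m) := Gt (0, x).
Definition proj0 (D : 'rV[R]_m -> 'M[R]_m) x := Gt (0, x) *m cofr (Gt (0, x)) (D x).
Hypothesis eps0 : 0 < eps.
Hypothesis orthT : forall q, T q -> D1 q.2 *m Gt q *m (D2 q.2)^T = 0.
Hypothesis kc : kc_chart U G0 f xi eta (proj0 D1) (proj0 D2).

Definition dGam_dt r x := 'D_(1, 0) (Gam_family (e_ r)) (0, x).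
Definition variation_vector := variation_field (proj0 D1) (fun x => cofr (Gt (0, x)) (D2 x)) dGam_dt.

Let T0 x : U x -> T (0, x).
Proof. by move=> Ux; split=> //=; rewrite normr0. Qed.

Let CC1 : Ck 3 T C1 := Ck_cofr sD1.
Let CC2 : Ck 3 T C2 := Ck_cofr sD2.
Let CP1 : Ck 3 T PP1 := Ck_mulmx oT GtC CC1.

Let PiC r : Ck 1 U (dGam_dt r).
Proof.
by apply: (@Ck_slice _ _ _ eps U 1 0 _ oU _ (Ck_derive _ (Ck_Gam_family (e_ r)))); rewrite normr0.
Qed.

Lemma Ck_variation_vector : Ck 1 U variation_vector.
Proof.
have C20 : Ck 1 U (fun x => cofr (Gt (0, x)) (D2 x)).
  by apply: (Ck_le (isT : (1 <= 3)%N)); apply: (Ck_slice (t := 0) oU _ CC2); rewrite normr0.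
have C10 := Ck_pred (kx_P1C kc).
have E r k l := Ck_entry k l oU (Ck_mulmx oU (Ck_mulmx oU C20 (PiC r)) C10).
apply: (Ck_mxP _ _ oU).2 => i k.
apply: (Ck_ext oU) => [x _|]; first exact/esym/mxE.
by apply: (Ck_sum _ oU) => r _; exact: (CkB oU (E r r k) (E r k r)).
Qed.

Lemma chart_curvature_static x : U x -> chart_curvature (0, x) = 0.
Proof.
move=> Ux; rewrite (chart_curvatureE (T0 Ux)).
have pG := kx_pos kc Ux; have uG := posdef_unit pG.
have e : C2 (0, x) *m proj0 D2 x = C2 (0, x).
  by rewrite /proj0 mulmxA; apply: cofr_id => //; exact: cofr_sub.
have := @curvature_contraction0 _ _ U G0 f xi eta (proj0 D1) (proj0 D2) kc x
  (C2 (0, x)) (proj0 D1 x) Ux (cofr_sym _ _) e.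
apply; last exact: (kx_11 kc Ux).
rewrite mulmxDl (kx_11 kc Ux) -mulmxA (kx_x1 kc Ux) mulmx0 addr0.
by [].
Qed.

Let dC2 x := 'D_(1, 0) C2 (0, x).
Let dP1 x := 'D_(1, 0) PP1 (0, x).
Let CC2' : Ck 1 T C2 := Ck_le (isT : (1 <= 3)%N) CC2.
Let CP1' : Ck 1 T PP1 := Ck_le (isT : (1 <= 3)%N) CP1.

Let dC2_sym x : U x -> (dC2 x)^T = dC2 x.
Proof.
move=> Ux; have e1 := derive_tr (Ck_derivable (v := ((1, 0) : V)) CC2' (T0 Ux)).
apply: (etrans (esym e1)); apply: (eq_on_derive _ oT _ (T0 Ux)) => q _.
exact: cofr_sym.
Qed.

Let dC2_P2 x : U x -> dC2 x *m proj0 D2 x = dC2 x.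
Proof.
move=> Ux; have pG := kx_pos kc Ux.
have := @time_linear C2 x 1%:M (proj0 D2 x) 1%:M 1%:M 0 eps0 Ux CC2'.
rewrite !mul1mx mulmx1; apply=> t te.
rewrite !mul1mx mulmx1 addr0 /proj0 mulmxA; apply: cofr_id => //.
by apply: cofr_sub; exact: Gtpos.
Qed.

Let dP1_P1 x : U x -> dP1 x *m proj0 D1 x = dP1 x.
Proof.
move=> Ux; have pG := kx_pos kc Ux.
have := @time_linear PP1 x 1%:M (proj0 D1 x) 1%:M 1%:M 0 eps0 Ux CP1'.
rewrite !mul1mx mulmx1; apply=> t te.
rewrite !mul1mx mulmx1 addr0 /PP1 -mulmxA; congr (_ *m _).
rewrite /proj0 mulmxA; apply: cofr_id => //.
by apply: cofr_sub; exact: Gtpos.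
Qed.

Let P1_dP1 x : U x -> proj0 D1 x *m dP1 x = 0.
Proof.
move=> Ux; have pG := kx_pos kc Ux.
have := @time_linear PP1 x (proj0 D1 x) 1%:M 0 0 (proj0 D1 x) eps0 Ux CP1'.
rewrite !mul0mx mulmx1; apply=> t te.
rewrite mul0mx mulmx1 mul0mx add0r /PP1 /proj0.
have e : cofr (Gt (0, x)) (D1 x) *m Gt (t, x) *m C1 (t, x) = cofr (Gt (0, x)) (D1 x).
  by apply: cofr_id; [exact: Gtpos|exact: cofr_sub].
by rewrite -(mulmxA (Gt (0, x))) (mulmxA (cofr _ _)) e.
Qed.

(** Here the orthogonality of [D1] and [D2] for every metric of the family enters: the moving
    projector onto [D1] kills [D2] at all times. *)
Let P2_dP1 x : U x -> proj0 D2 x *m dP1 x = 0.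
Proof.
move=> Ux; have pG := kx_pos kc Ux.
have := @time_linear PP1 x (proj0 D2 x) 1%:M 0 0 0 eps0 Ux CP1'.
rewrite !mul0mx mulmx1; apply=> t te.
rewrite mul0mx mulmx1 mul0mx add0r /PP1 /proj0.
have pGt : posdef (Gt (t, x)) by exact: Gtpos.
have /submxP[Y eY] := cofr_sub (D1 x) pGt.
have /submxP[Z eZ] := cofr_sub (D2 x) pG.
have o : D2 x *m Gt (t, x) *m (D1 x)^T = 0.
  have := orthT (conj te Ux : T (t, x)); move=> /(congr1 trmx).
  by rewrite !trmx_mul trmxK trmx0 pGt.1 mulmxA.
have eC : C1 (t, x) = (D1 x)^T *m Y^T by rewrite -trmx_mul -eY; exact/esym/cofr_sym.
have e : cofr (Gt (0, x)) (D2 x) *m Gt (t, x) *m C1 (t, x) = 0.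
  by rewrite eC eZ mulmxA -(mulmxA Z) -(mulmxA Z) o mulmx0 mul0mx.
by rewrite -(mulmxA (Gt (0, x))) (mulmxA (cofr _ _)) e mulmx0.
Qed.

(** [xi] need not stay orthogonal to [D1], so the projector may move on [xi]; by the two preceding
    facts it moves nowhere else to first order. *)
Let xi_dP1 x : U x -> eta x *m xi x *m dP1 x = dP1 x.
Proof.
move=> Ux; rewrite -[RHS]mul1mx -(kx_sum kc Ux) !mulmxDl P1_dP1// P2_dP1//.
by rewrite !add0r.
Qed.

Let Gamma x u := Gam G0 x u.
Let dR x p r := 'D_(e_ p) (dGam_dt r) x - 'D_(e_ r) (dGam_dt p) x
  + dGam_dt r x *m Gamma x (e_ p) + Gamma x (e_ r) *m dGam_dt p x
  - dGam_dt p x *m Gamma x (e_ r) - Gamma x (e_ p) *m dGam_dt r x.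

Let mixed x u r : U x ->
  'D_(1, 0) ('D_(0, u) (Gam_family (e_ r))) (0, x) = 'D_u (dGam_dt r) x.
Proof.
move=> Ux.
have e1 := @schwarz_mx _ _ T _ _ (Gam_family (e_ r)) (0, x) (0, u) (1, 0) oT (Ck_Gam_family (e_ r)) (T0 Ux).
have C := Ck_derive ((1, 0) : V) (Ck_Gam_family (e_ r)).
have [_ e2] := @is_derive_slice _ _ _ ('D_(1, 0) (Gam_family (e_ r))) 0 x u (Ck_derivable C (T0 Ux)).
exact: (etrans e1 (esym e2)).
Qed.

Let dRE x p r : U x -> 'D_(1, 0) (Rm_family (e_ p) (e_ r)) (0, x) = dR x p r.
Proof.
move=> Ux; pose dt : V := (1, 0).
have dG w := Ck_derivable (v := dt) (Ck_Gam_family w) (T0 Ux).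
have dD w z := derivableP (Ck_derivable (v := dt) (Ck_derive (0, w) (Ck_Gam_family z)) (T0 Ux)).
have [_ e] := is_deriveB (is_deriveD (is_deriveB (dD (e_ p) (e_ r)) (dD (e_ r) (e_ p)))
  (is_derive_mulmx (dG (e_ r)) (dG (e_ p)))) (is_derive_mulmx (dG (e_ p)) (dG (e_ r))).
have e1 := eq_on_derive dt oT (fun q Tq => Rm_familyE (e_ p) (e_ r) Tq) (T0 Ux).
apply: (etrans e1); apply: (etrans e).
have e2 := mixed (e_ p) r Ux; have e3 := mixed (e_ r) p Ux.
apply: (etrans (f_equal2 (fun A B => A - B
  + (dGam_dt r x *m Gamma x (e_ p) + Gamma x (e_ r) *m dGam_dt p x)
  - (dGam_dt p x *m Gamma x (e_ r) + Gamma x (e_ p) *m dGam_dt r x)) e2 e3)).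
by rewrite opprD !addrA.
Qed.

Lemma derive_chart_curvature x : U x -> 'D_(1, 0) chart_curvature (0, x) =
  \sum_k ('D_(e_ k) variation_vector x 0 k + (variation_vector x *m Gam G0 x (e_ k)) 0 k).
Proof.
move=> Ux; pose dt : V := (1, 0).
have uG := posdef_unit (kx_pos kc Ux).
have C2s : Ck 1 U (fun x => cofr (Gt (0, x)) (D2 x)).
  by apply: (Ck_le (isT : (1 <= 3)%N)); apply: (Ck_slice (t := 0) oU _ CC2); rewrite normr0.
have FV := @first_variation _ _ U G0 f xi eta (proj0 D1) (proj0 D2) kc
  (fun x => cofr (Gt (0, x)) (D2 x)) dGam_dt C2s (fun _ _ => erefl) (fun _ _ => cofr_sym _ _)
  PiC x (dC2 x) (dP1 x) Ux (dC2_sym Ux) (dC2_P2 Ux) (xi_dP1 Ux) (dP1_P1 Ux).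
apply: (etrans _ FV).
have dC := Ck_derivable (v := dt) CC2' (T0 Ux).
have dP := Ck_derivable (v := dt) CP1' (T0 Ux).
have dRm p r := Ck_derivable (v := dt) (Ck_Rm_family (e_ p) (e_ r)) (T0 Ux).
have d1 p r := is_derive_mulmx dC (dRm p r).
have d2 p r : is_derive ((0, x) : V) dt (fun q => C2 q *m Rm_family (e_ p) (e_ r) q *m PP1 q)
    (dC2 x *m Rm G0 x (e_ p) (e_ r) *m proj0 D1 x
     + C2 (0, x) *m dR x p r *m proj0 D1 x
     + C2 (0, x) *m Rm G0 x (e_ p) (e_ r) *m dP1 x).
  have [d1a d1b] := d1 p r.
  have [d2a d2b] := is_derive_mulmx d1a dP.
  split; first exact: d2a.
  apply: (etrans d2b); rewrite -mulmxDl; congr (_ *m _ + _).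
  apply: (etrans d1b); congr (_ + _ *m _); exact: dRE.
have d3 r p := is_derive_entry r p (d2 p r).
have d4 r := is_derive_sum (fun p => d3 r p).
have [_ e] := is_derive_sum d4.
have e1 := eq_on_derive dt oT (fun q Tq => chart_curvatureE Tq) (T0 Ux).
apply: (etrans e1); apply: (etrans _ e).
by apply: (eq_on_derive _ oT _ (T0 Ux)) => q _; rewrite fct_sumE; apply: eq_bigr => r _;
  rewrite fct_sumE.
Qed.
End TimeFamily.

(** * From the hypotheses of the theorem to [kc_chart] *)

Section KContactChart.
Variables (R : realType) (m : nat).
Local Notation vec := ('rV[R]_m).
Variables (U : set vec) (G f : vec -> 'M[R]_m) (xi : vec -> vec) (eta : vec -> 'cV[R]_m).
Variables (D1 D2 P1 P2 P3 : vec -> 'M[R]_m).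
Hypotheses (oU : open U) (GC : smooth_on U G) (xiC : smooth_on U xi) (etaC : smooth_on U eta).
Hypothesis Gpos : forall x, U x -> posdef (G x).
Hypothesis eta_xi : forall x, U x -> xi x *m eta x = 1%:M.
Hypothesis f2 : forall x, U x -> f x *m f x = - 1%:M + eta x *m xi x.
Hypothesis f_xi : forall x, U x -> xi x *m f x = 0.
Hypothesis eta_f : forall x, U x -> f x *m eta x = 0.
Hypothesis compat : forall x, U x -> forall u v : vec,
  dot (G x) (u *m f x) (v *m f x)
  = dot (G x) u v - (u *m eta x) 0 0 * (v *m eta x) 0 0.
Hypothesis contact : forall X Y, smooth_on U X -> smooth_on U Y ->
  forall x, U x -> dform eta X Y x = dot (G x) (X x) (Y x *m f x).
Hypothesis killing : forall X Y, smooth_on U X -> smooth_on U Y ->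
  forall x, U x -> lie_metric G xi X Y x = 0.
Hypotheses (sD1 : smooth_span U D1) (sD2 : smooth_span U D2).
Hypothesis orth : forall x, U x -> D1 x *m G x *m (D2 x)^T = 0.
Hypothesis D12f : forall x, U x -> (D1 x + D2 x == f x)%MS.
Hypothesis D1f : forall x, U x -> (D1 x *m f x <= D1 x)%MS.
Hypothesis D2f : forall x, U x -> (D2 x *m f x <= D2 x)%MS.

Hypothesis P1E : forall x, U x -> P1 x = G x *m cofr (G x) (D1 x).
Hypothesis P2E : forall x, U x -> P2 x = G x *m cofr (G x) (D2 x).
Hypothesis P3E' : forall x, U x -> P3 x = G x *m cofr (G x) (kermx (f x)).

Let sub1 x : U x -> (P1 x <= D1 x)%MS.
Proof. by move=> Ux; rewrite P1E// (submx_trans (submxMl _ _))// cofr_sub//; exact: Gpos. Qed.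
Let sub2 x : U x -> (P2 x <= D2 x)%MS.
Proof. by move=> Ux; rewrite P2E// (submx_trans (submxMl _ _))// cofr_sub//; exact: Gpos. Qed.

Let fix1 k (B : 'M[R]_(k, m)) x : U x -> (B <= D1 x)%MS -> B *m P1 x = B.
Proof. by move=> Ux BD; rewrite P1E// mulmxA; apply: cofr_id => //; exact: Gpos. Qed.
Let fix2 k (B : 'M[R]_(k, m)) x : U x -> (B <= D2 x)%MS -> B *m P2 x = B.
Proof. by move=> Ux BD; rewrite P2E// mulmxA; apply: cofr_id => //; exact: Gpos. Qed.

Let orth' x : U x -> D2 x *m G x *m (D1 x)^T = 0.
Proof.
move=> Ux; have /(congr1 trmx) := orth Ux.
by rewrite !trmx_mul trmxK trmx0 (Gpos Ux).1 mulmxA.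
Qed.

Let kill1 k (B : 'M[R]_(k, m)) x : U x -> (B <= D1 x)%MS -> B *m P2 x = 0.
Proof.
move=> Ux /submxP[Y ->]; rewrite P2E// -cofr_sym.
have /submxP[Z ->] := cofr_sub (D2 x) (Gpos Ux).
by rewrite trmx_mul -!mulmxA (mulmxA (G x)) (mulmxA (D1 x)) (mulmxA (D1 x)) orth// mul0mx mulmx0.
Qed.

Let kill2 k (B : 'M[R]_(k, m)) x : U x -> (B <= D2 x)%MS -> B *m P1 x = 0.
Proof.
move=> Ux /submxP[Y ->]; rewrite P1E// -cofr_sym.
have /submxP[Z ->] := cofr_sub (D1 x) (Gpos Ux).
by rewrite trmx_mul -!mulmxA (mulmxA (G x)) (mulmxA (D2 x)) (mulmxA (D2 x)) orth'// mul0mx mulmx0.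
Qed.

Let c11 x : U x -> P1 x *m P1 x = P1 x. Proof. by move=> Ux; exact: fix1 (sub1 Ux). Qed.
Let c22 x : U x -> P2 x *m P2 x = P2 x. Proof. by move=> Ux; exact: fix2 (sub2 Ux). Qed.
Let c12 x : U x -> P1 x *m P2 x = 0. Proof. by move=> Ux; exact: kill1 (sub1 Ux). Qed.
Let c21 x : U x -> P2 x *m P1 x = 0. Proof. by move=> Ux; exact: kill2 (sub2 Ux). Qed.

Let sym1 x : U x -> P1 x *m G x = G x *m (P1 x)^T.
Proof. by move=> Ux; rewrite P1E// trmx_mul (Gpos Ux).1 cofr_sym -(mulmxA (G x) (cofr _ _)). Qed.
Let sym2 x : U x -> P2 x *m G x = G x *m (P2 x)^T.
Proof. by move=> Ux; rewrite P2E// trmx_mul (Gpos Ux).1 cofr_sym -(mulmxA (G x) (cofr _ _)). Qed.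

Let eta1 k (B : 'M[R]_(k, m)) x : U x -> (B <= f x)%MS -> B *m eta x = 0.
Proof. by move=> Ux /submxP[Y ->]; rewrite -mulmxA eta_f// mulmx0. Qed.

Let D1sub x : U x -> (D1 x <= f x)%MS.
Proof. by move=> Ux; have /eqmxP <- := D12f Ux; exact: addsmxSl. Qed.
Let D2sub x : U x -> (D2 x <= f x)%MS.
Proof. by move=> Ux; have /eqmxP <- := D12f Ux; exact: addsmxSr. Qed.

Let c1e x : U x -> P1 x *m eta x = 0.
Proof. by move=> Ux; apply: eta1 => //; exact: submx_trans (sub1 Ux) (D1sub Ux). Qed.
Let c2e x : U x -> P2 x *m eta x = 0.
Proof. by move=> Ux; apply: eta1 => //; exact: submx_trans (sub2 Ux) (D2sub Ux). Qed.

(** Compatibility of [f] with the metric, tested against [xi], gives [g(u, xi) = eta(u)] because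
    [xi f = 0]. *)
Let etaE x : U x -> eta x = G x *m (xi x)^T.
Proof.
move=> Ux; apply/row_matrixP => i; rewrite !rowE.
have := compat Ux (delta_mx 0 i) (xi x); rewrite f_xi// /dot trmx0 mulmx0 eta_xi//.
have -> : (0 : 'M[R]_1) 0 0 = 0 by rewrite mxE.
have -> : (1%:M : 'M[R]_1) 0 0 = 1 by rewrite mxE eqxx.
rewrite mulr1 => /esym/eqP; rewrite subr_eq0 => /eqP e.
by apply/matrixP => a b; rewrite !ord1 mulmxA e.
Qed.

Let x1 x : U x -> xi x *m P1 x = 0.
Proof.
move=> Ux; apply: trmx_inj; rewrite trmx0 trmx_mul; have uG := posdef_unit (Gpos Ux).
by rewrite -[LHS](mulKmx uG) (mulmxA (G x)) -sym1// -mulmxA -etaE// c1e// mulmx0.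
Qed.
Let x2 x : U x -> xi x *m P2 x = 0.
Proof.
move=> Ux; apply: trmx_inj; rewrite trmx0 trmx_mul; have uG := posdef_unit (Gpos Ux).
by rewrite -[LHS](mulKmx uG) (mulmxA (G x)) -sym2// -mulmxA -etaE// c2e// mulmx0.
Qed.

(** The complementary matrix [Q] kills [D1 + D2], the image of [f], hence [f *m Q = 0] and
    [f *m f *m Q = 0]. The formula for the square of [f] turns this into [Q = eta *m xi]. *)
Let sum1 x : U x -> P1 x + P2 x + eta x *m xi x = 1%:M.
Proof.
move=> Ux; pose Q := 1%:M - (P1 x + P2 x).
have d1 : D1 x *m Q = 0 by rewrite mulmxBr mulmx1 mulmxDr fix1// kill1// addr0 subrr.
have d2 : D2 x *m Q = 0 by rewrite mulmxBr mulmx1 mulmxDr fix2// kill2// add0r subrr.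
have fQ : f x *m Q = 0.
  have /andP[_ /sub_addsmxP[[A B] /= ->]] := D12f Ux.
  by rewrite mulmxDl -!mulmxA d1 d2 !mulmx0 addr0.
have : f x *m f x *m Q = 0 by rewrite -mulmxA fQ mulmx0.
rewrite f2// mulmxDl mulNmx mul1mx -mulmxA.
have -> : xi x *m Q = xi x by rewrite mulmxBr mulmx1 mulmxDr x1// x2// addr0 subr0.
move=> /eqP; rewrite addrC subr_eq0 => /eqP ->; rewrite /Q addrC subrK.
by [].
Qed.

Let f1 x : U x -> f x *m P1 x = P1 x *m f x.
Proof.
move=> Ux; have F1 : P1 x *m f x *m P1 x = P1 x *m f x.
  apply: fix1 => //; have /submxP[Y ->] := sub1 Ux.
  by rewrite -mulmxA (submx_trans (submxMl _ _))// D1f.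
have F2 : P2 x *m f x *m P1 x = 0.
  apply: kill2 => //; have /submxP[Y ->] := sub2 Ux.
  by rewrite -mulmxA (submx_trans (submxMl _ _))// D2f.
rewrite -[LHS]mul1mx -(sum1 Ux) !mulmxDl !mulmxA F1 F2 addr0.
by rewrite -(mulmxA (eta x)) f_xi// mulmx0 mul0mx addr0.
Qed.
Let ff2 x : U x -> f x *m P2 x = P2 x *m f x.
Proof.
move=> Ux; have F1 : P2 x *m f x *m P2 x = P2 x *m f x.
  apply: fix2 => //; have /submxP[Y ->] := sub2 Ux.
  by rewrite -mulmxA (submx_trans (submxMl _ _))// D2f.
have F2 : P1 x *m f x *m P2 x = 0.
  apply: kill1 => //; have /submxP[Y ->] := sub1 Ux.
  by rewrite -mulmxA (submx_trans (submxMl _ _))// D1f.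
rewrite -[LHS]mul1mx -(sum1 Ux) !mulmxDl !mulmxA F1 F2 add0r.
by rewrite -(mulmxA (eta x)) f_xi// mulmx0 mul0mx addr0.
Qed.

(** On [ker f] the square of [f] vanishes, so its formula says that [eta *m xi] fixes [ker f];
    [cofr_uniq] then gives [cofr] as [xi^T *m xi]. *)
Let P3E x : U x -> P3 x = eta x *m xi x.
Proof.
move=> Ux; rewrite P3E'//.
have <- : (xi x)^T *m xi x = cofr (G x) (kermx (f x)).
  apply: cofr_uniq; first exact: Gpos.
  - by rewrite trmx_mul trmxK.
  - by apply/sub_kermxP; rewrite -mulmxA f_xi// mulmx0.
  rewrite !mulmxA -(mulmxA _ (G x)) -etaE//.
  have : kermx (f x) *m (f x *m f x) = 0 by rewrite mulmxA mulmx_ker mul0mx.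
  rewrite f2// mulmxDr mulmxN mulmx1 addrC => /eqP; rewrite subr_eq0 => /eqP.
  by rewrite mulmxA.
by rewrite mulmxA -etaE.
Qed.

Let smooth_cst (c : vec) : smooth_on U (fun=> c).
Proof. by apply: Ck_smooth => n; exact: Ck_cst. Qed.

Let G3 : Ck 3 U G := smooth_Ck 3 GC.
Let dG x v : U x -> derivable G x v.
Proof. by move=> Ux; exact: Ck_derivable G3 Ux. Qed.
Let dxi x v : U x -> derivable xi x v.
Proof. by move=> Ux; exact: Ck_derivable (smooth_Ck 1 xiC) Ux. Qed.
Let deta x v : U x -> derivable eta x v.
Proof. by move=> Ux; exact: Ck_derivable (smooth_Ck 1 etaC) Ux. Qed.

Let N x u := 'D_u xi x + xi x *m Gam G x u.

Let dotC x u v : U x -> dot (G x) u v = dot (G x) v u.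
Proof.
move=> Ux; rewrite /dot -[in RHS](trmxK (v *m _ *m _)) [in RHS]mxE.
by rewrite !trmx_mul trmxK (Gpos Ux).1 mulmxA.
Qed.

Let dotDl x u v w : dot (G x) (u + v) w = dot (G x) u w + dot (G x) v w.
Proof. by rewrite /dot !mulmxDl mxE. Qed.
Let dotDr x u v w : dot (G x) w (u + v) = dot (G x) w u + dot (G x) w v.
Proof. by rewrite /dot linearD mulmxDr mxE. Qed.
Let dotNl x u w : dot (G x) (- u) w = - dot (G x) u w.
Proof. by rewrite /dot !mulNmx mxE. Qed.
Let dotNr x u w : dot (G x) w (- u) = - dot (G x) w u.
Proof. by rewrite /dot linearN mulmxN mxE. Qed.

Let killing_skew x u v : U x -> dot (G x) (N x u) v + dot (G x) u (N x v) = 0.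
Proof.
move=> Ux; have K := killing (smooth_cst u) (smooth_cst v) Ux.
have b w : bracket xi (fun=> w) x = - 'D_w xi x.
  by rewrite /bracket derive_cst sub0r.
have e : 'D_(xi x) (fun y => dot (G y) u v) x = dot ('D_(xi x) G x) u v.
  have d := is_derive_mulmxE (is_derive_mulmxE (is_derive_cst u x (xi x))
    (derivableP (@dG x (xi x) Ux))) (is_derive_cst v^T x (xi x)).
  have [_ e'] := is_derive_entry 0 0 d.
  apply: (etrans e'); rewrite /dot.
  by rewrite mul0mx add0r mulmx0 addr0.
have g : dot ('D_(xi x) G x) u v =
    dot (G x) (xi x *m Gam G x u) v + dot (G x) u (xi x *m Gam G x v).
  rewrite (Gam_metric oU G3 Gpos (xi x) Ux) /dot mulmxDr mulmxDl mxE.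
  rewrite !mulmxA (Gam_sym oU Gpos (xi x) u Ux); congr (_ + _).
  rewrite -(Gam_sym oU Gpos (xi x) v Ux) trmx_mul !mulmxA.
  by [].
move: K; rewrite /lie_metric.
move=> K; have := etrans (esym (f_equal2 (fun a b => a - b - dot (G x) u (bracket xi (fun=> v) x))
  e (f_equal (fun z => dot (G x) z v) (b u)))) K.
rewrite (b v) dotNl dotNr !opprK g => K2.
rewrite /N dotDl dotDr -{}K2.
lra.
Qed.

(** On constant fields the Christoffel terms cancel by symmetry, leaving half the skew part of
    [g(nabla_u xi, v)] in [d eta]. The Killing equation makes this form skew already, so the factor
    1/2 is absorbed exactly. *)
Let contact_form x u v : U x -> dot (G x) (N x u) v = dot (G x) u (v *m f x).
Proof.
move=> Ux; have K := contact (smooth_cst u) (smooth_cst v) Ux.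
have ev w (z : vec) : 'D_w (fun y => (z *m eta y) 0 0) x = (z *m 'D_w eta x) 0 0.
  have d := is_derive_mulmxE (is_derive_cst z x w) (derivableP (@deta x w Ux)).
  have [_ e'] := is_derive_entry 0 0 d.
  by apply: (etrans e'); rewrite mul0mx add0r.
have br : bracket (fun=> u) (fun=> v) x = 0.
  by rewrite /bracket !derive_cst subrr.
have de w z : (z *m 'D_w eta x) 0 0 = (z *m Gam G x w *m eta x) 0 0 + dot (G x) z (N x w).
  have d := is_derive_mulmxE (derivableP (@dG x w Ux)) (is_derive_tr (@dxi x w Ux)).
  have [_ e1] := d.
  have e2 := eq_on_derive w oU etaE Ux.
  rewrite (etrans e2 e1) (Gam_metric oU G3 Gpos w Ux).
  rewrite mulmxDl -addrA -(mulmxA (G x) _^T) -trmx_mul -mulmxDr -linearD /=.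
  rewrite -(mulmxA _ (G x)) -etaE// mulmxDr mxE /dot !mulmxA; congr (_ + _).
  by rewrite /N addrC.
have S := Gam_sym oU Gpos u v Ux.
have K2 := killing_skew u v Ux.
rewrite -K /dform br mul0mx mxE subr0.
suff L : dot (G x) (N x u) v =
    2^-1 * ((v *m 'D_u eta x) 0 0 - (u *m 'D_v eta x) 0 0).
  by rewrite L; congr (_ * (_ - _)); [exact: esym (ev u v)|exact: esym (ev v u)].
rewrite !de S (dotC v) //.
by move: K2; move: (dot _ _ _) (dot _ _ _) => a b K2; lra.
Qed.

Let skewf x : U x -> f x *m G x = - (G x *m (f x)^T).
Proof.
move=> Ux; apply/matrixP => i j.
have e1 := contact_form (delta_mx 0 i) (delta_mx 0 j) Ux.
have e2 := contact_form (delta_mx 0 j) (delta_mx 0 i) Ux.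
have K : dot (G x) (delta_mx 0 i) ((delta_mx 0 j : vec) *m f x)
    + dot (G x) (delta_mx 0 j) ((delta_mx 0 i : vec) *m f x) = 0.
  by rewrite -e1 -e2 (dotC (N x (delta_mx 0 j)))//; exact: killing_skew.
move: K; rewrite (dotC (delta_mx 0 j))// /dot trmx_mul.
rewrite (mulmxA _ (f x)^T) -(mulmxA (delta_mx 0 i) (G x)) -(mulmxA (delta_mx 0 i) (f x)).
have E (A : 'M[R]_m) : ((delta_mx 0 i : vec) *m A *m (delta_mx 0 j : vec)^T) 0 0 = A i j.
  by rewrite trmx_delta -rowE -colE !mxE.
by rewrite !E => /eqP; rewrite addrC addr_eq0 => /eqP ->; rewrite [RHS]mxE.
Qed.

(** The K-contact identity: [g(nabla_u xi, v) = g(u, v f)] by [contact_form], and [f] is skew. *)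
Let nxi x u : U x -> 'D_u xi x + xi x *m Gam G x u = - (u *m f x).
Proof.
move=> Ux; have uG := posdef_unit (Gpos Ux).
apply: (can_inj (mulmxK uG)); rewrite mulNmx -mulmxA skewf// mulmxN opprK.
apply/rowP => j; have := contact_form u (delta_mx 0 j) Ux.
rewrite /dot trmx_mul mulmxA -!mulmxA !mulmxA trmx_delta -!colE !mxE.
by [].
Qed.

Hypothesis hT13 : forall X Y, smooth_on U X -> smooth_on U Y ->
  forall x, U x -> Tmix G P1 P3 P2 X Y x = 0.
Hypothesis hT1 : forall X Y, smooth_on U X -> smooth_on U Y ->
  forall x, U x -> papply P2 (Tten G P1 X Y) x = 0.
Hypothesis hT2 : forall X Y, smooth_on U X -> smooth_on U Y ->
  forall x, U x -> papply P1 (Tten G P2 X Y) x = 0.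
Hypothesis hh2 : forall X Y, smooth_on U X -> smooth_on U Y ->
  forall x, U x -> papply P1 (hten G P2 X Y) x = 0.
Hypothesis hh1 : forall X Y, smooth_on U X -> smooth_on U Y ->
  forall x, U x -> papply P2 (hten G P1 X Y) x = 0.

Let CP D (P : vec -> 'M[R]_m) : smooth_span U D ->
  (forall x, U x -> P x = G x *m cofr (G x) (D x)) -> Ck 2 U P.
Proof.
move=> sD PE.
(* The single metric is viewed as a family constant in time, so that [Ck_cofr] applies. *)
have CG : Ck 3 (tube 1 U) (fun q : R * vec => G q.2) := Ck_proj2 1 oU G3.
have Cc := Ck_cofr CG (fun q h => Gpos h.2) sD.
have z1 : `|0 : R| < 1 by rewrite normr0.
have C := Ck_slice oU z1 (Ck_mulmx (tube_open oU) CG Cc).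
exact: Ck_pred (Ck_ext oU (fun x Ux => esym (PE x Ux)) C).
Qed.

Let C21 : Ck 2 U P1 := CP sD1 P1E.
Let C22 : Ck 2 U P2 := CP sD2 P2E.

Let nabla_const (P : vec -> 'M[R]_m) (X : vec -> vec) (v : vec) x : Ck 2 U P -> U x ->
  nabla G X (papply P (fun=> v)) x = v *m ('D_(X x) P x + P x *m Gam G x (X x)).
Proof.
move=> CPP Ux; have d := Ck_derivable (v := X x) CPP Ux.
have [_ e] := is_derive_mulmxE (is_derive_cst v x (X x)) (derivableP d).
rewrite nablaE mulmxDr mulmxA; congr (_ + _).
by apply: (etrans e); rewrite mul0mx add0r.
Qed.

(** [h_m] and [T_m] are the symmetric and skew halves of one bilinear expression; when the relevant
    components of both vanish, so does that of the whole. *)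
Let half_sum (a b : vec) (Q P : 'M[R]_m) : Q *m P = P ->
  (2^-1 *: ((a + b) *m Q)) *m P = 0 -> (2^-1 *: ((a - b) *m Q)) *m P = 0 -> a *m P = 0.
Proof.
move=> QP; rewrite -!scalemxAl -!mulmxA QP => e1 e2.
have : a *m P = 2^-1 *: ((a + b) *m P) + 2^-1 *: ((a - b) *m P).
  rewrite -scalerDr mulmxDl mulmxBl addrACA subrr addr0 -mulr2n -(scaler_nat 2 (a *m P)) scalerA.
  by rewrite mulVf ?scale1r// pnatr_eq0.
by rewrite e1 e2 addr0.
Qed.

Let fields_eq0 (A B : 'M[R]_m) : (forall v : vec, v *m A = 0) -> A = 0.
Proof. by move=> h; apply/row_matrixP => i; rewrite rowE h row0. Qed.

Let B1 x u : U x -> ('D_(u *m P1 x) P1 x + P1 x *m Gam G x (u *m P1 x)) *m P2 x = 0.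
Proof.
move=> Ux; apply: (fields_eq0 0) => v; rewrite mulmxA.
have e1 := hh1 (smooth_cst u) (smooth_cst v) Ux.
have e2 := hT1 (smooth_cst u) (smooth_cst v) Ux.
have e0 := nabla_const (papply P1 (fun=> u)) v C21 Ux.
have := half_sum _ e1 e2; rewrite {}e0; apply.
by rewrite /perp mulmxBl mul1mx c12// subr0.
Qed.

Let B2 x u : U x -> ('D_(u *m P2 x) P2 x + P2 x *m Gam G x (u *m P2 x)) *m P1 x = 0.
Proof.
move=> Ux; apply: (fields_eq0 0) => v; rewrite mulmxA.
have e1 := hh2 (smooth_cst u) (smooth_cst v) Ux.
have e2 := hT2 (smooth_cst u) (smooth_cst v) Ux.
have e0 := nabla_const (papply P2 (fun=> u)) v C22 Ux.
have := half_sum _ e1 e2; rewrite {}e0; apply.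
by rewrite /perp mulmxBl mul1mx c21// subr0.
Qed.

(** The conditions on [D2] give [B2], about sections of [D2]; duality converts it into a statement
    about sections of [D1], in the same directions. *)
Let A2 x u : U x -> ('D_(u *m P2 x) P1 x + P1 x *m Gam G x (u *m P2 x)) *m P2 x = 0.
Proof.
move=> Ux; set w := u *m P2 x.
have dP1 := Ck_derivable (v := w) C21 Ux.
have dP2 := Ck_derivable (v := w) C22 Ux.
apply: (projector_duality_alg (posdef_unit (Gpos Ux)) (sym2 Ux) (sym1 Ux) _ (B2 u Ux)).
have [d e] := is_derive_mulmxE
  (is_derive_mulmxE (derivableP dP2) (derivableP (@dG x w Ux))) (is_derive_tr dP1).
have g := Gam_metric oU G3 Gpos w Ux.
have z : 'D_w (fun y => P2 y *m G y *m (P1 y)^T) x = 0.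
  apply: etrans _ (derive_cst (0 : 'M[R]_m) x w).
  apply: (eq_on_derive w oU _ Ux) => y Uy.
  by rewrite (sym2 Uy) -mulmxA -trmx_mul (c12 Uy) trmx0 mulmx0.
have e' := etrans (esym e) z; rewrite g in e'; exact: e'.
Qed.

(** With one argument in [D1] and the other along [xi], the mixed tensor is half the [D2]-component
    of [nabla_X xi - nabla_xi X]. The first term is [- X f], which lies in [D1]; so the second has
    no [D2]-component. *)
Let A3 x : U x -> ('D_(xi x) P1 x + P1 x *m Gam G x (xi x)) *m P2 x = 0.
Proof.
move=> Ux; set A := _ *m P2 x.
have P1A : P1 x *m A = A.
  have d := Ck_derivable (v := xi x) C21 Ux.
  have [_ e] := is_derive_mulmxE (derivableP d) (derivableP d).
  have e2 := eq_on_derive (xi x) oU c11 Ux.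
  have e3 := etrans (esym e2) e.
  rewrite /A mulmxA mulmxDr mulmxA c11// !mulmxDl; congr (_ + _).
  by rewrite [in RHS]e3 mulmxDl -(mulmxA _ (P1 x) (P2 x)) c12// mulmx0 add0r.
rewrite -P1A; apply: (fields_eq0 0) => a; rewrite mulmxA.
have := hT13 (smooth_cst (a *m P1 x)) (smooth_cst (xi x)) Ux.
rewrite /Tmix /Ttilde.
set Z1 := papply (perp P2) (papply P1 (fun=> _)).
set Z2 := papply (perp P2) (papply P3 (fun=> _)).
set Z3 := papply (perp P2) (papply P3 (fun=> _)).
set Z4 := papply (perp P2) (papply P1 (fun=> _)).
(* The second half of [Tmix] pairs fields that vanish at [x], and [nabla] depends on its direction
   only through the value at the point. *)
have z3 : Z3 x = 0 by rewrite /Z3 /papply P3E// mulmxA -(mulmxA a) c1e// mulmx0 !mul0mx.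
have z4 : Z4 x = 0 by rewrite /Z4 /papply x1// mul0mx.
have n0 Y Z : Y x = 0 -> nabla G Y Z x = 0.
  by move=> Yx; rewrite nablaE Yx derive0 Gam0 mulmx0 addr0.
rewrite (n0 Z3)// (n0 Z4)// subr0 mul0mx scaler0 addr0.
have perp1 y : U y -> P1 y *m perp P2 y = P1 y.
  by move=> Uy; rewrite /perp mulmxBr mulmx1 c12// subr0.
have perp3 y : U y -> P3 y *m perp P2 y = P3 y.
  by move=> Uy; rewrite /perp mulmxBr mulmx1 P3E// -mulmxA x2// mulmx0 subr0.
have e1 y : U y -> Z1 y = a *m P1 x *m P1 y.
  by move=> Uy; rewrite /Z1 /papply -mulmxA perp1.
(* [Z2] is a multiple of [xi] with coefficient 1 at [x]; differentiating the coefficient only adds a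
   multiple of [xi], which [P2] kills. *)
have e2 y : U y -> Z2 y = xi x *m eta y *m xi y.
  by move=> Uy; rewrite /Z2 /papply -mulmxA perp3// P3E// mulmxA.
have x2' : Z2 x = xi x by rewrite e2// eta_xi// mul1mx.
have x1' : Z1 x = a *m P1 x by rewrite e1// -mulmxA c11.
have n2 : nabla G Z2 Z1 x *m P2 x = a *m P1 x *m A.
  rewrite /A mulmxA; congr (_ *m _); rewrite -(nabla_const (fun=> xi x))// !nablaE x2'.
  rewrite (e1 x Ux).
  exact: (f_equal (fun z => z + a *m P1 x *m P1 x *m Gam G x (xi x))
    (eq_on_derive (xi x) oU e1 Ux)).
have n1 : nabla G Z1 Z2 x *m P2 x = 0.
  rewrite nablaE x1' x2'; set w := a *m P1 x.
  have [_ e] := is_derive_mulmxE (is_derive_mulmxE (is_derive_cst (xi x) x w)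
    (derivableP (@deta x w Ux))) (derivableP (@dxi x w Ux)).
  have e' := etrans (eq_on_derive w oU e2 Ux) e.
  rewrite e' (eta_xi Ux) mul1mx -addrA (nxi w Ux) mul0mx add0r mulmxBl.
  rewrite -(mulmxA _ (xi x)) x2// mulmx0 sub0r -mulmxA ff2// mulmxA /w -(mulmxA a) c12//.
  by rewrite mulmx0 mul0mx oppr0.
rewrite mulmxBl n1 n2 sub0r => /eqP.
by rewrite scaler_eq0 invr_eq0 pnatr_eq0 /= oppr_eq0 => /eqP.
Qed.

Lemma kc_chartP : kc_chart U G f xi eta P1 P2.
Proof.
apply: KcChart => //.
- exact: (smooth_Ck 1 xiC).
- move=> x u Ux.
  (* The direction is split along [D1], [D2] and [xi], where [B1], [A2] and [A3] apply
     respectively. *)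
  have -> : u = u *m P1 x + u *m P2 x + (u *m eta x) 0 0 *: xi x.
    rewrite -mul_scalar_mx -mx11_scalar -mulmxA -!mulmxDr sum1// mulmx1.
    by [].
  have C1' := Ck_pred C21.
  have e1 := derive_mx_dirD (u *m P1 x + u *m P2 x) ((u *m eta x) 0 0 *: xi x) oU C1' Ux.
  have e2 := derive_mx_dirD (u *m P1 x) (u *m P2 x) oU C1' Ux.
  have e3 := derive_mx_dirZ ((u *m eta x) 0 0) (xi x) C1' Ux.
  rewrite e1 e2 e3 !GamD GamZ !mulmxDr -scalemxAr.
  have a1 := B1 u Ux; have a2 := A2 u Ux; have a3 := A3 Ux.
  move: a1 a2 a3; set d1 := 'D_(_ *m P1 x) P1 x; set d2 := 'D_(_ *m P2 x) P1 x.
  set d3 := 'D_(xi x) P1 x; move: d1 d2 d3 => d1 d2 d3 a1 a2 a3.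
  rewrite addrACA -scalerDr mulmxDl -scalemxAl a3 scaler0 addr0.
  by rewrite addrACA mulmxDl a1 a2 addr0.
Qed.
End KContactChart.

Transparent christoffel.
Section LocalExtension.
Variables (R : realType) (m : nat) (U : set 'rV[R]_m) (G G' : 'rV[R]_m -> 'M[R]_m).
Hypotheses (oU : open U) (GG : forall x, U x -> G x = G' x).

Lemma Gam_ext x u : U x -> Gam G x u = Gam G' x u.
Proof.
move=> Ux; apply/matrixP => j k; rewrite !mxE; apply: eq_bigr => i _.
have e a b c : 'D_(delta_mx 0 a) (fun y => G y b c) x =
    'D_(delta_mx 0 a) (fun y => G' y b c) x.
  by apply: (eq_on_derive _ oU _ Ux) => y /GG ->.
rewrite /christoffel; congr (_ * (_ * _)); apply: eq_bigr => l _.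
by rewrite (GG Ux); congr (_ * _); rewrite !e.
Qed.

(** Needed because the metric of time 0 agrees with the given one only on the image of the chart,
    and likewise [proj0] with [orthoproj]. *)
Lemma kc_chart_ext f xi eta P1 P2 P1' P2' : kc_chart U G f xi eta P1 P2 ->
  (forall x, U x -> P1 x = P1' x) -> (forall x, U x -> P2 x = P2' x) ->
  kc_chart U G' f xi eta P1' P2'.
Proof.
move=> [_ GC Gp xC C1 C2 s h12 h21 h11 h22 h1e h2e hxe hx1 hx2 s1 s2 he hs hf1 hf2 hxf hn hA] e1 e2.
apply: KcChart.
- exact: oU.
- exact: (Ck_ext oU GG GC).
- by move=> x Ux; rewrite -(GG Ux); exact: Gp.
- exact: xC.
- exact: (Ck_ext oU e1 C1).
- exact: (Ck_ext oU e2 C2).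
- by move=> x Ux; rewrite -(e1 x Ux) -(e2 x Ux); exact: s.
- by move=> x Ux; rewrite -(e1 x Ux) -(e2 x Ux); exact: h12.
- by move=> x Ux; rewrite -(e1 x Ux) -(e2 x Ux); exact: h21.
- by move=> x Ux; rewrite -(e1 x Ux); exact: h11.
- by move=> x Ux; rewrite -(e2 x Ux); exact: h22.
- by move=> x Ux; rewrite -(e1 x Ux); exact: h1e.
- by move=> x Ux; rewrite -(e2 x Ux); exact: h2e.
- exact: hxe.
- by move=> x Ux; rewrite -(e1 x Ux); exact: hx1.
- by move=> x Ux; rewrite -(e2 x Ux); exact: hx2.
- by move=> x Ux; rewrite -(GG Ux) -(e1 x Ux); exact: s1.
- by move=> x Ux; rewrite -(GG Ux) -(e2 x Ux); exact: s2.
- by move=> x Ux; rewrite -(GG Ux); exact: he.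
- by move=> x Ux; rewrite -(GG Ux); exact: hs.
- by move=> x Ux; rewrite -(e1 x Ux); exact: hf1.
- by move=> x Ux; rewrite -(e2 x Ux); exact: hf2.
- exact: hxf.
- move=> x u Ux; have e := Gam_ext u Ux; have h := hn x u Ux.
  by move: h; rewrite e.
- move=> x u Ux; have e := Gam_ext u Ux; have h := hA x u Ux.
  have d := eq_on_derive u oU e1 Ux.
  by move: h; rewrite d e (e1 x Ux) (e2 x Ux).
Qed.

End LocalExtension.
Opaque christoffel.

(** * Iterated Lebesgue integrals in charts *)

Section LebesgueRow.
Variable R : realType.
Local Open Scope ereal_scope.

(* The library has the Lebesgue measure on [R] only; [integral_rV] iterates it
   over the coordinates, so measurability is with respect to cylinders. *)
Definition cylinder m : set (set 'rV[R]_m) :=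
  [set A | exists (j : 'I_m) (B : set (measurableTypeR R)),
     measurable B /\ A = [set x : 'rV[R]_m | B (x 0 j)]%R].
Definition rowB m := g_sigma_algebraType (@cylinder m).

Lemma measurable_coord m (j : 'I_m) :
  measurable_fun setT (fun x : rowB m => (x : 'rV[R]_m) 0%R j : measurableTypeR R).
Proof.
move=> _ B mB; rewrite setTI; apply: sub_sigma_algebra.
by exists j, B.
Qed.

Lemma measurable_to_row d (T : measurableType d) m (f : T -> rowB m) :
  (forall j, measurable_fun setT (fun t => (f t : 'rV[R]_m) 0%R j : measurableTypeR R)) ->
  measurable_fun setT f.
Proof.
move=> mf; apply: (@measurability _ _ T (rowB m) setT f (@cylinder m)) => //.
by move=> _ [_ [j [B [mB ->]]] <-]; exact: mf.
Qed.

Definition row_cons m (p : measurableTypeR R * rowB m) : rowB m.+1 :=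
  row_mx (p.1%:M : 'rV[R]_1) (p.2 : 'rV[R]_m).

Lemma measurable_row_cons m : measurable_fun setT (@row_cons m).
Proof.
apply: measurable_to_row => j.
case: (split_ordP (j : 'I_(1 + m))) => k jE.
  have e : (fun p => (row_cons p : 'rV[R]_m.+1) 0%R j) = fst.
    apply/funext => p; rewrite jE; apply: etrans (row_mxEl _ _ _ _) _.
    by rewrite ord1 mxE eqxx.
  by rewrite e; exact: measurable_fst.
have e : (fun p => (row_cons p : 'rV[R]_m.+1) 0%R j) = (fun p => (p.2 : 'rV[R]_m) 0%R k).
  by apply/funext => p; rewrite jE; exact: row_mxEr.
rewrite e; exact: (measurableT_comp (measurable_coord k) measurable_snd).
Qed.

Definition row_uncons m (x : rowB m.+1) : measurableTypeR R * rowB m :=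
  ((x : 'rV[R]_(1 + m)) 0%R (lshift m 0%R), rsubmx (x : 'rV[R]_(1 + m))).

Lemma row_consK m (x : rowB m.+1) : row_cons (row_uncons x) = x.
Proof.
pose y : 'rV[R]_(1 + m) := x.
have e : (y 0%R (lshift m 0%R))%:M = lsubmx y.
  by apply/rowP => j; rewrite !mxE !ord1 eqxx.
apply: etrans (hsubmxK y); exact: (f_equal (fun a => row_mx a (rsubmx y)) e).
Qed.

Lemma row_uncons_K m (p : measurableTypeR R * rowB m) : row_uncons (row_cons p) = p.
Proof.
case: p => t v; apply: injective_projections => /=.
  by apply: etrans (row_mxEl _ _ _ _) _; rewrite mxE eqxx.
by apply/rowP => j; rewrite mxE; exact: row_mxEr.
Qed.

Section Step.
Let leb : {sigma_finite_measure set (measurableTypeR R) -> \bar R} := @lebesgue_measure R.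
Variables (m : nat) (mu : {sigma_finite_measure set (rowB m) -> \bar R}).

(** The pushforward carries the product measure to row vectors, matching the recursion of
    [integral_rV]. Sigma-finiteness is carried along the recursion since the product and Tonelli's
    theorem require it. *)
Definition lambda_step : set (rowB m.+1) -> \bar R :=
  pushforward (leb \x mu) (@row_cons m).

Let step : {measure set (rowB m.+1) -> \bar R} :=
  measure_function_pushforward__canonical__measure_function_Measure
    (leb \x mu) (@measurable_row_cons m).

HB.instance Definition _ := isMeasure.Build _ _ _ lambda_step
  (measure0 step) (measure_ge0 step) (@measure_semi_sigma_additive _ _ _ step).

Lemma lambda_step_sigma_finite : sigma_finite setT lambda_step.
Proof.
have /sigma_finiteP[F1 [TF1 ndF1 Foo1]] := sigma_finiteT leb.
have /sigma_finiteP[F2 [TF2 ndF2 Foo2]] := sigma_finiteT mu.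
pose F n := F1 n `*` F2 n.
have TF : \bigcup_n F n = setT.
  apply/seteqP; split=> // -[t v] _.
  have [k _ k1] : (\bigcup_n F1 n) t by rewrite -TF1.
  have [l _ l2] : (\bigcup_n F2 n) v by rewrite -TF2.
  exists (maxn k l) => //; split=> /=.
    by move: t k1; exact/subsetPset/ndF1/leq_maxl.
  by move: v l2; exact/subsetPset/ndF2/leq_maxr.
have Foo n : measurable (F n) /\ (leb \x mu) (F n) < +oo.
  have [? ?] := Foo1 n; have [? ?] := Foo2 n; split; first exact: measurableX.
  by rewrite product_measure1E// lte_mul_pinfty// ge0_fin_numE.
have mproj : measurable_fun setT (@row_uncons m).
  apply/measurable_fun_pairP; split; first exact: measurable_coord.
  apply: measurable_to_row => j.
  rewrite (_ : (fun _ => _) = (fun x : rowB m.+1 => (x : 'rV[R]_m.+1) 0%R (rshift 1 j))).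
    exact: measurable_coord.
  by apply/funext => x; rewrite mxE.
exists (fun n => @row_uncons m @^-1` F n).
  by rewrite -preimage_bigcup TF preimage_setT.
move=> n; have [mF Fn] := Foo n; split.
  by rewrite -[X in measurable X]setTI; exact: mproj.
rewrite /lambda_step /pushforward (_ : _ @^-1` _ = F n)//.
by apply/seteqP; split=> p; rewrite /preimage /= row_uncons_K.
Qed.

HB.instance Definition _ := Measure_isSigmaFinite.Build _ _ _ lambda_step
  lambda_step_sigma_finite.

Definition lambda_succ : {sigma_finite_measure set (rowB m.+1) -> \bar R} := lambda_step.
End Step.

Fixpoint lambda m : {sigma_finite_measure set (rowB m) -> \bar R} :=
  match m with 0%N => \d_(0%R : rowB 0) | k.+1 => lambda_succ (lambda k) end.

End LebesgueRow.

Section RowMeasure.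
Variable R : realType.
Local Open Scope ereal_scope.

(** An open set is a countable union of sup-norm balls with rational centres and radii
    [1 / (n + 1)], and each such ball is a finite intersection of cylinders. *)
Lemma measurable_row_open m (O : set 'rV[R]_m) : open O -> measurable (O : set (rowB R m)).
Proof.
move=> oO; pose c (q : 'rV[rat]_m) : 'rV[R]_m := map_mx ratr q.
pose P := [set p : 'rV[rat]_m * nat | ball (c p.1) (p.2.+1%:R^-1 : R) `<=` O].
have -> : O = \bigcup_(p in P) ball (c p.1) (p.2.+1%:R^-1 : R).
  apply/seteqP; split=> [x Ox|x [p Pp]]; last exact: Pp.
  have /nbhs_ballP[e /= e0 eO] := near_open oO Ox.
  (* The factor 2: a ball of this radius that contains [x] lies in the ball of twice the radius
     about [x]. *)
  have [n ne] : exists n : nat, (2 * n.+1%:R^-1 < e)%R.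
    have e2 : (0 < e / 2)%R by rewrite divr_gt0.
    have [N _ h] := near_infty_natSinv_lt (PosNum e2).
    by exists N; have := h N (leqnn _); rewrite /= ltr_pdivlMr// mulrC.
  have H j : exists q : rat, ball (x 0%R j) (n.+1%:R^-1 : R) (ratr q : R).
    have n0 : (0 < n.+1%:R^-1 :> R)%R by rewrite invr_gt0 ltr0n.
    have /rat_in_itvoo[q] : (x 0%R j < x 0%R j + n.+1%:R^-1)%R by rewrite ltrDl.
    rewrite in_itv /= => /andP[q1 q2]; exists q; rewrite /ball /= distrC ger0_norm.
      by rewrite ltrBlDl.
    by rewrite subr_ge0 ltW.
  have [q hq] := choice H.
  exists (\row_j q j, n) => /=.
    move=> y yb; apply: eO; apply: le_ball (ltW ne) _ _.
    rewrite mulr_natl mulr2n; apply: ball_triangle _ yb; split=> [|i j].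
      by rewrite invr_gt0.
    by rewrite ord1 !mxE; exact: hq.
  apply: ball_sym; split=> [|i j]; first by rewrite invr_gt0.
  by rewrite ord1 !mxE; exact: hq.
rewrite bigcup_mkcond; apply: countable_bigcupT_measurable; first exact: countableP.
move=> [q n]; case: ifP => // _ /=.
have -> : ball (c q) (n.+1%:R^-1 : R) =
    ~` \bigcup_(j in [set: 'I_m])
      [set x : 'rV[R]_m | (~` ball (c q 0%R j) (n.+1%:R^-1 : R)) (x 0%R j)].
  apply/seteqP; split=> [x [_ h] [j _ /= nb]|x h]; first by apply: nb; exact: h.
  split=> [|i j]; first by rewrite invr_gt0.
  by rewrite ord1; apply: contrapT => nb; apply: h; exists j.
apply: measurableC; apply: fin_bigcup_measurable; first exact: finite_finset.
move=> j _; rewrite -[X in measurable X]setTI.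
apply: (measurable_coord j) => //; apply: measurableC.
exact: (open_measurable (ball_open _ _)).
Qed.

Lemma continuous_measurable_row m (F : 'rV[R]_m -> R) : continuous F ->
  measurable_fun setT (F : rowB R m -> measurableTypeR R).
Proof.
move=> cF; apply: (@measurability _ _ (rowB R m) (measurableTypeR R) setT F _ (RGenOpens.measurableE R)).
move=> _ [_ [a [b ->]] <-]; rewrite setTI; apply: measurable_row_open.
by move/continuousP: cF; apply; exact: itv_open.
Qed.
End RowMeasure.

Section RowIntegral.
Variable R : realType.
Local Open Scope ereal_scope.

Lemma integral_lambdaS m (F : rowB R m.+1 -> \bar R) :
  measurable_fun setT F -> (forall x, 0 <= F x) ->
  \int[lambda R m.+1]_x F x =
  \int[lebesgue_measure]_t \int[lambda R m]_v F (row_cons (t, v)).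
Proof.
move=> mF F0; have mc := @measurable_row_cons R m.
have mFc : measurable_fun setT (fun p => F (row_cons p)).
  exact: measurableT_comp mF mc.
transitivity (\int[pushforward (@lebesgue_measure R \x lambda R m) (@row_cons R m)]_x F x).
  by [].
rewrite (ge0_integral_pushforward mc)// preimage_setT fubini_tonelli1//.
by move=> p; exact: F0.
Qed.

(** Ties the iterated integral that defines the Riemannian volume to an actual measure, so that
    convergence theorems become applicable. *)
Lemma integral_rV_lambda m (F : 'rV[R]_m -> \bar R) :
  @measurable_fun _ _ (rowB R m) (\bar R) setT F -> (forall x, 0 <= F x) ->
  integral_rV F = \int[lambda R m]_x F x.
Proof.
elim: m F => [|m IH] F mF F0.
  rewrite /= integral_dirac// diracT mul1e.
  by congr F.
rewrite integral_lambdaS//=; apply: eq_integral => t _; rewrite IH//.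
have mFc := measurableT_comp mF (@measurable_row_cons R m).
exact: (measurableT_comp mFc (pair1_measurable t)).
Qed.

(** The translated measure agrees with Lebesgue measure on half-open intervals, hence everywhere by
    uniqueness. *)
Lemma lebesgue_shift (a : R) (f : measurableTypeR R -> \bar R) : measurable_fun setT f ->
  (forall t, 0 <= f t) ->
  \int[lebesgue_measure]_t f (t + a)%R = \int[@lebesgue_measure R]_t f t.
Proof.
move=> mf f0.
have ms : measurable_fun setT (fun t : measurableTypeR R => (t + a)%R : measurableTypeR R).
  by apply: measurable_funD => //; exact: measurable_cst.
rewrite -[LHS](@ge0_integral_pushforward _ _ _ _ R _ ms lebesgue_measure setT f)//.
apply/esym/eq_measure_integral => A mA _.
apply: lebesgue_measure_unique => // _ [[x y]] _ <-.
have E : (fun t : R => t + a)%R @^-1` [set` Interval (BRight x) (BRight y)] =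
    [set` Interval (BRight (x - a)%R) (BRight (y - a)%R)].
  by apply/seteqP; split=> t /=; rewrite !in_itv /= ltrBlDr lerBrDr.
apply: etrans _ (f_equal (@lebesgue_measure R) (esym E)).
rewrite !lebesgue_measure_itv /= !lte_fin ltrD2r; case: ifP => // _.
by rewrite -!EFinB; congr EFin; lra.
Qed.
Lemma measurable_row_shift m (v : 'rV[R]_m) :
  measurable_fun setT (fun x : rowB R m => (x : 'rV[R]_m) + v : rowB R m)%R.
Proof.
apply: measurable_to_row => j.
rewrite (_ : (fun _ => _) = (fun x : rowB R m => (x : 'rV[R]_m) 0 j + v 0 j))%R.
  by apply: measurable_funD; [exact: measurable_coord|exact: measurable_cst].
by apply/funext => x; rewrite mxE.
Qed.

Lemma lambda_shift m (v : 'rV[R]_m) (F : rowB R m -> \bar R) :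
  measurable_fun setT F -> (forall x, 0 <= F x) ->
  \int[lambda R m]_x F ((x : 'rV[R]_m) + v)%R = \int[lambda R m]_x F x.
Proof.
elim: m v F => [|m IH] v F mF F0.
  have -> : v = 0%R by apply/rowP => -[].
  by apply: eq_integral => x _; rewrite addr0.
have mFs := measurableT_comp mF (measurable_row_shift v).
rewrite (integral_lambdaS mF F0) (integral_lambdaS mFs (fun x => F0 _)).
pose w := row_uncons (v : rowB R m.+1).
pose g t := \int[lambda R m]_x F (row_cons (t, x)).
have mc := measurableT_comp mF (@measurable_row_cons R m).
transitivity (\int[lebesgue_measure]_t g (t + w.1)%R); last first.
  apply: lebesgue_shift => [|t].
    by apply: (measurable_fun_fubini_tonelli_F _ mc) => p; exact: F0.
  by apply: integral_ge0 => x _; exact: F0.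
apply: eq_integral => t _; rewrite /g.
have mt := measurableT_comp mc (pair1_measurable (t + w.1)%R).
apply: etrans _ (IH w.2 _ mt (fun x => F0 _)).
have add (a b : R) (y z : 'rV[R]_m) : row_mx (a + b)%:M (y + z)%R =
    (row_mx a%:M y + row_mx b%:M z)%R :> 'rV[R]_(1 + m).
  by rewrite add_row_mx -raddfD.
apply: eq_integral => x _; congr F.
apply: etrans _ (esym (add t w.1 x w.2)).
by rewrite -[in LHS](row_consK (v : rowB R m.+1)).
Qed.

Definition rowbox m (N : R) := [set x : 'rV[R]_m | forall j, (`|x 0%R j| <= N)%R].

Arguments rowbox m N : clear implicits.

Lemma measurable_rowbox m N : measurable (rowbox m N : set (rowB R m)).
Proof.
rewrite (_ : rowbox m N = ~` \bigcup_(j in [set: 'I_m])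
    [set x : 'rV[R]_m | (~` [set` `[(- N)%R, N]%R]) (x 0%R j)]).
  apply: measurableC; apply: fin_bigcup_measurable; first exact: finite_finset.
  move=> j _; rewrite -[X in measurable X]setTI.
  by apply: (measurable_coord j) => //; apply: measurableC; exact: measurable_itv.
apply/seteqP; split=> [x h [j _ /=]|x h j].
  by rewrite in_itv /= -ler_norml h.
apply: contrapT => nb; apply: h; exists j => //=.
by rewrite in_itv /= -ler_norml.
Qed.

Lemma lambda_rowbox m N : lambda R m (rowbox m N) < +oo.
Proof.
elim: m => [|m IH].
  have -> : lambda R 0 (rowbox 0 N) = (((0%R : rowB R 0) \in (rowbox 0 N : set (rowB R 0)))%:R%:E : \bar R) by [].
  by rewrite ltry.
have E : @row_cons R m @^-1` rowbox m.+1 N = [set` `[(- N)%R, N]%R] `*` rowbox m N.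
  apply/seteqP; split=> -[t x] /=.
    move=> h; split=> /=.
      rewrite in_itv /= -ler_norml; have := h (lshift m 0%R : 'I_(1 + m)).
      suff -> : (row_cons (t, x) : 'rV[R]_m.+1) 0%R (lshift m 0%R : 'I_(1 + m)) = t by [].
      by apply: etrans (row_mxEl _ _ _ _) _; rewrite mxE eqxx.
    move=> j; have := h (rshift 1 j).
    suff -> : (row_cons (t, x) : 'rV[R]_m.+1) 0%R (rshift 1 j) = (x : 'rV[R]_m) 0%R j by [].
    exact: row_mxEr.
  rewrite in_itv /= -ler_norml => -[ht hx] j.
  case: (split_ordP (j : 'I_(1 + m))) => k ->.
    suff -> : (row_cons (t, x) : 'rV[R]_m.+1) 0%R (lshift m k : 'I_(1 + m)) = t by [].
    by apply: etrans (row_mxEl _ _ _ _) _; rewrite ord1 mxE eqxx.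
  suff -> : (row_cons (t, x) : 'rV[R]_m.+1) 0%R (rshift 1 k) = (x : 'rV[R]_m) 0%R k by [].
  exact: row_mxEr.
have -> : lambda R m.+1 (rowbox m.+1 N) =
    (@lebesgue_measure R \x lambda R m) ([set` `[(- N)%R, N]%R] `*` rowbox m N).
  exact: (f_equal (@lebesgue_measure R \x lambda R m) E).
rewrite product_measure1E//; last exact: measurable_rowbox.
have h : @lebesgue_measure R [set` `[(- N)%R, N]%R] < +oo.
  by rewrite lebesgue_measure_itv /=; case: ifP => // _; rewrite -EFinB ltry.
by apply: lte_mul_pinfty => //; rewrite ge0_fin_numE.
Qed.
End RowIntegral.

Arguments rowbox {R} m N.

Section BoxIntegral.
Variables (R : realType) (m : nat).
Local Notation row := ('rV[R]_m).
Local Notation lam := (lambda R m).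
Implicit Types (u : row -> R) (N B : R).

Lemma box_integrable u N B : measurable_fun setT (u : rowB R m -> measurableTypeR R) ->
  (forall x, `|u x| <= B) -> (forall x, ~ rowbox m N x -> u x = 0) ->
  lam.-integrable setT (EFin \o u).
Proof.
move=> mu uB u0.
have mb : lam.-integrable (rowbox m N) (EFin \o u).
  apply: measurable_bounded_integrable.
  - exact: measurable_rowbox.
  - exact: lambda_rowbox.
  - exact: measurable_funS mu.
  - by exists B; split=> [|c Bc x _ /=]; [exact: num_real|exact: le_trans (uB x) (ltW Bc)].
move: mb; rewrite integrable_mkcond; last exact: measurable_rowbox.
apply: eq_integrable => // x _; rewrite /patch; case: ifPn => // /negP xN.
by rewrite /= u0// => /mem_set.
Qed.

(** Dominated differentiation under the integral sign, with the dominating function [G] equal to [B]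
    on the box and to 0 elsewhere. Off the box [f] is 0 for all nearby times, so its derivative
    vanishes there too. *)
Lemma derive_under_box (f : R -> row -> R) (d N B : R) : 0 < d ->
  (forall t, `|t| < d -> measurable_fun setT (f t : rowB R m -> measurableTypeR R)) ->
  (forall t x, `|t| < d -> `|f t x| <= B) ->
  (forall t x, `|t| < d -> ~ rowbox m N x -> f t x = 0) ->
  (forall t x, `|t| < d -> derivable (f ^~ x) t 1) ->
  (forall t x, `|t| < d -> `|'D_1 (f ^~ x) t| <= B) ->
  is_derive (0 : R) 1 (fun t => \int[lam]_x f t x) (\int[lam]_x 'D_1 (f ^~ x) 0).
Proof.
move=> d0 mf fB f0 df dfB.
have I t : [set` `]- d, d[] t -> `|t| < d by rewrite /= in_itv /= ltr_norml.
have I0 : [set` `]- d, d[] (0 : R) by rewrite /= in_itv /= d0 oppr_lt0 d0.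
have B0 : 0 <= B by apply: le_trans (fB 0 0 _); rewrite ?normr0.
pose G (x : row) := B * \1_(rowbox m N) x.
have G0 x : 0 <= G x by rewrite mulr_ge0.
have GB x : `|G x| <= B.
  by rewrite ger0_norm// /G ler_piMr// indicE; case: (_ \in _); rewrite ?lexx.
have mG : measurable_fun setT (G : rowB R m -> measurableTypeR R).
  apply: measurable_funM; first exact: measurable_cst.
  by apply: measurable_indic; exact: measurable_rowbox.
have Gout x : ~ rowbox m N x -> G x = 0.
  move=> nx; rewrite /G indicE.
  by case: (boolP (x \in _)) => [/set_mem//|_]; rewrite mulr0.
have Gin x : rowbox m N x -> G x = B by move=> bx; rewrite /G indicE mem_set// mulr1.
have iG : lam.-integrable setT (EFin \o G).
  exact: (box_integrable mG GB Gout).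
have ub t x : [set` `]- d, d[] t -> setT x -> `|partial1of2 f t x| <= G x.
  move=> /I td _; rewrite partial1of2E; have [bx|nbx] := pselect (rowbox m N x).
    by rewrite Gin//; exact: dfB.
  rewrite Gout// normr_le0; apply/eqP.
  rewrite -[RHS](derive_cst (0 : R) t 1); apply: near_eq_derive; near=> s.
  apply: f0 => //; near: s.
  have := @ball_open R R^o 0 d; rewrite openE => /(_ t).
  rewrite /interior /ball /= sub0r normrN => /(_ td).
  by apply: filterS => s /=; rewrite sub0r normrN.
have H1 := @cvg_differentiation_under_integral R _ (rowB R m) lam f setT measurableT 0 (- d) d I0
  (fun t td => box_integrable (mf t (I t td)) (fun x => fB t x (I t td)) (fun x => f0 t x (I t td)))
  (fun t x td _ => df t x (I t td)) G G0 iG ub.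
have -> : (\int[lam]_x 'D_1 (f ^~ x) 0) = \int[lam]_x partial1of2 f 0 x.
  by congr Rintegral; apply/funext => x; rewrite partial1of2E.
have H2 : h^-1 *: (((fun t => \int[lam]_x f t x) \o shift 0) (h *: (1 : R))
    - \int[lam]_x f 0 x) @[h --> 0^'] --> \int[lam]_x partial1of2 f 0 x.
  by under eq_fun do rewrite /= [_ *: 1]mulr1.
split; first by apply/cvg_ex; eexists; exact: H2.
exact: cvg_lim H2.
Unshelve. all: end_near. Qed.
End BoxIntegral.

Section BoxCompact.
Variables (R : realType) (m : nat).
Local Notation row := ('rV[R]_m).
Local Notation lam := (lambda R m).
Implicit Types (u : row -> R) (N B : R).

Lemma compact_rowbox N : compact (rowbox m N : set row).
Proof.
have := @rV_compact R m (fun=> [set` `[- N, N]]) (fun=> @segment_compact R _ _).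
congr compact; apply/seteqP; split=> x h j /=; have := h j; rewrite /= in_itv /= ler_norml//.
Qed.

Lemma closed_rowbox N : closed (rowbox m N : set row).
Proof. by apply: compact_closed; [exact: norm_hausdorff|exact: compact_rowbox]. Qed.

Lemma box_bounded u N : continuous u -> (forall x, ~ rowbox m N x -> u x = 0) ->
  exists B, forall x, `|u x| <= B.
Proof.
move=> cu u0; have : bounded_set (u @` rowbox m N).
  apply: compact_bounded; apply: continuous_compact; last exact: compact_rowbox.
  exact: continuous_subspaceT.
move=> [B [_ h]]; exists (`|B| + 1) => x; have [bx|nbx] := pselect (rowbox m N x).
  by apply: (h (`|B| + 1)) => /=; [rewrite ltr_pwDr// ler_norm|exists x].
by rewrite u0// normr0 addr_ge0.
Qed.

Lemma Rintegral_shift u (v : row) :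
  measurable_fun setT (u : rowB R m -> measurableTypeR R) ->
  \int[lam]_x u (x + v) = \int[lam]_x u x.
Proof.
move=> mu; have mEu : measurable_fun setT (EFin \o u : rowB R m -> \bar R).
  exact/measurable_EFinP.
congr fine; rewrite [LHS]integralE [RHS]integralE; congr (_ - _)%E.
  apply: etrans _ (lambda_shift v (measurable_funepos mEu) _).
    by apply: eq_integral => x _; rewrite !funeposE.
  by move=> x; exact: funepos_ge0.
apply: etrans _ (lambda_shift v (measurable_funeneg mEu) _).
  by apply: eq_integral => x _; rewrite !funenegE.
by move=> x; exact: funeneg_ge0.
Qed.

(** The integral of [u (x + t *: v)] does not depend on [t]; its derivative at 0, taken under the
    integral sign, is the integral of ['D_v u]. *)
Lemma integral_derive0 u (v : row) N : Ck 1 setT u -> (forall x, ~ rowbox m N x -> u x = 0) ->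
  \int[lam]_x 'D_v u x = 0.
Proof.
move=> Cu u0; have oT : open [set: row] := openT.
have cu : continuous u by move=> x; exact: (Ck_continuous Cu I).
have cDu : continuous ('D_v u) by move=> x; exact: (Ck_continuous (Ck_derive v Cu) I).
have ob : open (~` (rowbox m N : set row)) := closed_openC (@closed_rowbox N).
have Du0 x : ~ rowbox m N x -> 'D_v u x = 0.
  move=> nx; rewrite -[RHS](derive_cst (0 : R) x v).
  exact: (eq_on_derive v ob u0 nx).
have [B1 uB] := box_bounded cu u0; have [B2 DuB] := box_bounded cDu Du0.
pose f (t : R) x := u (x + t *: v).
have df (t : R) (x : row) : is_derive t (1 : R) (f ^~ x) ('D_v u (x + t *: v)).
  exact: is_derive_line (Ck_derivable Cu I).
(* The box is enlarged so that all translates with [|t| < 1] still vanish outside it. *)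
pose N' := N + \sum_j `|v 0 j|.
have out t x : `|t| < 1 -> ~ rowbox m N' x -> ~ rowbox m N (x + t *: v).
  move=> t1 nx h; apply: nx => j; have := h j; rewrite !mxE => hj.
  rewrite -[x 0 j](addrK (t * v 0 j)) (le_trans (ler_normB _ _))// lerD//.
  rewrite normrM (le_trans (ler_piMl _ (ltW t1)))// (bigD1 j)//= lerDl.
  by apply: sumr_ge0.
have ms t := measurable_row_shift (t *: v).
have mu := continuous_measurable_row cu.
have mf t : measurable_fun setT (f t : rowB R m -> measurableTypeR R).
  exact: (measurableT_comp mu (ms t)).
have b1 t x : `|t| < 1 -> `|f t x| <= `|B1| + `|B2|.
  by move=> _; rewrite (le_trans (uB _))// (le_trans (ler_norm _))// lerDl.
have b2 t x : `|t| < 1 -> `|'D_1 (f ^~ x) t| <= `|B1| + `|B2|.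
  move=> _; have [_ ->] := df t x.
  by rewrite (le_trans (DuB _))// (le_trans (ler_norm _))// lerDr.
have d1 t x : `|t| < 1 -> derivable (f ^~ x) t 1 by move=> _; have [] := df t x.
have [_ e] := @derive_under_box R m f 1 N' (`|B1| + `|B2|) ltr01 (fun t _ => mf t)
  b1 (fun t x t1 nx => u0 _ (out t x t1 nx)) d1 b2.
have c : (fun t => \int[lam]_x f t x) = cst (\int[lam]_x u x).
  by apply/funext => t; exact: Rintegral_shift.
rewrite c derive_cst in e; rewrite [RHS]e; congr Rintegral; apply/funext => x.
by have [_ ->] := df 0 x; rewrite scale0r addr0.
Qed.
End BoxCompact.

(** * Integrals on the manifold computed in charts *)

Section Transfer.
Local Open Scope ereal_scope.
Context d1 d2 (X : measurableType d1) (Y : measurableType d2) (R : realType).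
Variables (mu : {measure set X -> \bar R}) (nu : {measure set Y -> \bar R}).
Variables (D : set X) (c : X -> Y) (w : Y -> R).
Hypotheses (mD : measurable D) (mc : measurable_fun setT c).
Hypotheses (mw : measurable_fun setT w) (w0 : forall y, (0 <= w y)%R).
Hypothesis density : forall A, measurable A ->
  mu (c @^-1` A `&` D) = \int[nu]_y (\1_A y * w y)%:E.

Import HBNNSimple.

(** The first stage of the usual passage from sets to simple, nonnegative and finally real
    functions, starting from the density formula for sets. *)
Lemma integral_transfer_nnsfun (f : {nnsfun Y >-> R}) :
  \int[mu]_(p in D) (f (c p))%:E = \int[nu]_y (f y * w y)%:E.
Proof.
have mpre A : measurable A -> measurable (c @^-1` A).
  by move=> mA; rewrite -[X in measurable X]setTI; exact: mc.
have mf r : measurable (f @^-1` [set r]) by exact: measurable_funPTI.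
under [LHS]eq_integral do rewrite fimfunE -fsumEFin//.
rewrite [LHS]ge0_integral_fsum//; last 2 first.
  - move=> r; apply/measurable_EFinP/measurable_funM; first exact: measurable_cst.
    by apply: measurable_funTS; apply: (measurableT_comp _ mc); exact: measurable_indic.
  - by move=> n x _; rewrite EFinM nnfun_muleindic_ge0.
under [RHS]eq_integral.
  move=> y _; rewrite EFinM fimfunE -fsumEFin// ge0_mule_fsuml; last first.
    by move=> r; rewrite EFinM nnfun_muleindic_ge0.
  over.
rewrite [RHS]ge0_integral_fsum//; last 2 first.
  - move=> r; apply: emeasurable_funM; apply/measurable_EFinP => //.
    by apply: measurable_funM => //; exact: measurable_indic.
  - move=> n x _; apply: mule_ge0; last by rewrite lee_fin.
    by rewrite EFinM nnfun_muleindic_ge0.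
apply: eq_fsbigr => r; rewrite inE => -[y _ <-].
have r0 : (0 <= f y)%R by [].
transitivity ((f y)%:E * mu (c @^-1` (f @^-1` [set f y]) `&` D)).
  under eq_integral do rewrite EFinM.
  rewrite ge0_integralZl//.
  - by congr (_ * _); rewrite -integral_indic//; exact: mpre.
  - apply/measurable_EFinP/measurable_funTS.
    by apply: (measurableT_comp _ mc); exact: measurable_indic.
rewrite density// -ge0_integralZl//.
- by apply: eq_integral => x _; rewrite -EFinM mulrA EFinM.
- by apply/measurable_EFinP/measurable_funM => //; exact: measurable_indic.
- by move=> x _; rewrite lee_fin mulr_ge0.
Qed.

Lemma ge0_integral_transfer (F : Y -> \bar R) : measurable_fun setT F ->
  (forall y, 0 <= F y) -> \int[mu]_(p in D) F (c p) = \int[nu]_y (F y * (w y)%:E).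
Proof.
move=> mF F0; pose f_ := nnsfun_approx measurableT mF.
have mfc n : measurable_fun setT (fun p => f_ n (c p)) by exact: (measurableT_comp _ mc).
transitivity (limn (fun n => \int[mu]_(p in D) (f_ n (c p))%:E)).
  rewrite -monotone_convergence//=.
  - by apply: eq_integral => p _; apply/esym/cvg_lim => //; exact: cvg_nnsfun_approx.
  - by move=> n; exact/measurable_EFinP/measurable_funTS.
  - by move=> n p _; rewrite lee_fin.
  - by move=> p _ ? ? mn; rewrite lee_fin; exact/lefP/nd_nnsfun_approx.
transitivity (limn (fun n => \int[nu]_y (f_ n y * w y)%:E)).
  by congr (limn _); apply/funext => n; exact: integral_transfer_nnsfun.
rewrite -monotone_convergence//=.
- apply: eq_integral => y _; apply/cvg_lim => //.
  under eq_fun do rewrite EFinM.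
  by apply: cvgeZr => //; exact: cvg_nnsfun_approx.
- by move=> n; apply/measurable_EFinP/measurable_funM => //; exact/measurable_funTS.
- by move=> n p _; rewrite lee_fin mulr_ge0.
- move=> p _ ? ? mn; rewrite lee_fin ler_wpM2r//; exact/lefP/nd_nnsfun_approx.
Qed.

Lemma integral_transfer (u : Y -> R) : measurable_fun setT u ->
  \int[mu]_(p in D) (u (c p))%:E = \int[nu]_y (u y * w y)%:E.
Proof.
move=> mu'; have mEu : measurable_fun setT (EFin \o u) by exact/measurable_EFinP.
rewrite [LHS]integralE [RHS]integralE; congr (_ - _).
  transitivity (\int[mu]_(p in D) (EFin \o u)^\+ (c p)).
    by apply: eq_integral => p _; rewrite !funeposE.
  rewrite ge0_integral_transfer//; last exact: measurable_funepos.
  by apply: eq_integral => y _; rewrite !funeposE /= EFinM maxe_pMl ?lee_fin// mul0e.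
transitivity (\int[mu]_(p in D) (EFin \o u)^\- (c p)).
  by apply: eq_integral => p _; rewrite !funenegE.
rewrite ge0_integral_transfer//; last exact: measurable_funeneg.
by apply: eq_integral => y _; rewrite !funenegE /= maxe_pMl ?lee_fin// mul0e -EFinM mulNr.
Qed.
End Transfer.

Section OpenMeasurable.
Variables (R : realType) (T : topologicalType) (d : measure_display) (S : measurableType d).
Variable e : S -> T.
Hypothesis me : forall O : set T, open O -> measurable (e @^-1` O).

(** In its uses [e] is the identity between a measurable copy of a space and the topological
    original. The function is continuous on [U] only, hence the indicator. *)
Lemma measurable_open_restrict (U : set T) (F : T -> R) : open U ->
  (forall x, U x -> {for x, continuous F}) ->
  measurable_fun setT (fun s => (\1_U (e s) * F (e s)) : measurableTypeR R).
Proof.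
move=> oU cF.
have -> : (fun s => \1_U (e s) * F (e s)) = (fun s => if e s \in U then F (e s) else 0).
  by apply/funext => s; rewrite indicE; case: (_ \in _); rewrite ?mul1r ?mul0r.
have mU := me oU.
apply: (@measurable_fun_if _ _ S (measurableTypeR R) (fun s => F (e s)) (fun=> 0) setT
  measurableT (fun s => e s \in U)); last exact: (@measurable_cst _ _ S (measurableTypeR R)).
  apply: (measurable_fun_bool true); rewrite setTI (_ : _ @^-1` _ = e @^-1` U)//.
  by apply/seteqP; split=> s /=; [move=> /set_mem|move=> /mem_set].
rewrite setTI (_ : _ @^-1` _ = e @^-1` U); last first.
  by apply/seteqP; split=> s /=; [move=> /set_mem|move=> /mem_set].
apply: (@measurability _ _ S (measurableTypeR R) (e @^-1` U) _ _ (RGenOpens.measurableE R)).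
move=> _ [_ [a [b ->]] <-].
rewrite (_ : _ `&` _ = e @^-1` (U `&` F @^-1` `]a, b[%classic)) //; apply: me.
rewrite openE => x [Ux Fx]; apply: filterI; first exact: open_nbhs_nbhs.
have := cF x Ux; apply; apply: open_nbhs_nbhs; split=> //; exact: itv_open.
Qed.
End OpenMeasurable.

Section ChartIntegral.
Variables (R : realType) (m : nat) (M : manifold R m).
Variables (g : field M 'M[R]_m) (mu : {measure set (borel M) -> \bar R}).
Hypotheses (gm : is_metric g) (vol : is_riemannian_volume g mu).
Variable i : idx M.

Definition volume_density (x : 'rV[R]_m) : R := Num.sqrt (\det (g i x)).

Lemma metric_posdef x : im i x -> posdef (g i x).
Proof. by case: gm => _ _ gs gp ix; split; [exact: gs|exact: gp]. Qed.

Lemma continuous_density x : im i x -> {for x, continuous volume_density}.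
Proof.
move=> ix; have [gC _ _ _] := gm.
have C := Ck_continuous (Ck_det (@im_open _ _ M i) (smooth_Ck 0 (gC i))) ix.
exact: (continuous_comp C (@sqrt_continuous R _)).
Qed.

Lemma open_measurable_borel (O : set M) : open O -> measurable (O : set (borel M)).
Proof. exact: sub_sigma_algebra. Qed.

(** The chart has no controlled values off its domain; setting it to 0 there makes it measurable on
    the whole manifold. *)
Let c (p : borel M) : rowB R m := if p \in dom i then chart i p else 0.

Let mc : measurable_fun setT c.
Proof.
apply: measurable_to_row => j.
have := @measurable_open_restrict R M _ (borel M) id open_measurable_borel (dom i)
  (fun p => chart i p 0 j) (@dom_open _ _ M i).
rewrite (_ : (fun p => _ * _) = (fun t => (c t : 'rV[R]_m) 0 j)); last first.
  apply/funext => p; rewrite indicE /c; case: (_ \in _); rewrite ?mul1r ?mul0r//.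
  by rewrite mxE.
apply=> p ip; have cc := chart_continuous ip.
exact: (continuous_comp cc (@coord_continuous R 1 m 0 j _)).
Qed.

Let w (x : rowB R m) := \1_(im i) x * volume_density x.

Lemma measurable_density : measurable_fun setT (w : rowB R m -> measurableTypeR R).
Proof.
apply: (@measurable_open_restrict R 'rV[R]_m _ (rowB R m) id (@measurable_row_open R m)).
  exact: im_open.
exact: continuous_density.
Qed.

Lemma density_ge0 x : 0 <= w x.
Proof. by rewrite mulr_ge0// sqrtr_ge0. Qed.

Lemma chart_integral (u : 'rV[R]_m -> R) :
  measurable_fun setT (u : rowB R m -> measurableTypeR R) ->
  (\int[mu]_(p in dom i) (u (chart i p))%:E =
   \int[lambda R m]_x (u x * (\1_(im i) x * volume_density x))%:E)%E.
Proof.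
move=> mu'; have md := open_measurable_borel (@dom_open _ _ M i).
have D A : measurable A -> (mu (c @^-1` A `&` dom i) =
    \int[lambda R m]_y (\1_A y * w y)%:E)%E.
  move=> mA; have mcA : measurable (c @^-1` A).
    by rewrite -[X in measurable X]setTI; exact: mc.
  rewrite (vol (i := i)); [|exact: measurableI|exact: subIsetr].
  rewrite (_ : (fun x => _) = (fun y : 'rV[R]_m => (\1_A y * w y)%:E)).
    apply: integral_rV_lambda => [|x].
      apply/measurable_EFinP/measurable_funM; first exact: measurable_indic.
      exact: measurable_density.
    by rewrite lee_fin mulr_ge0// density_ge0.
  apply/funext => x; rewrite /w mulrA.
  have <- : \1_(A `&` im i) x = \1_A x * \1_(im i) x :> R by rewrite indicI.
  congr (\1_ _ x * _)%:E; apply/seteqP; split=> y /=.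
    by move=> [iy [Ay _]]; split=> //; move: Ay; rewrite /c mem_set ?paramK//; exact: param_dom.
  move=> [Ay iy]; split=> //; have dy := param_dom iy; split=> //.
  by rewrite /c mem_set// paramK.
have := @integral_transfer _ _ _ _ R mu (lambda R m) (dom i) c w md mc measurable_density
  density_ge0 D u mu'.
apply: etrans; apply: eq_integral => p ip.
by rewrite /c ip.
Qed.
End ChartIntegral.

(** * Riemannian divergence *)

Section Jacobi.
Variables (R : realType) (V : normedModType R).

Lemma is_derive_prod_seq (I : eqType) (r : seq I) (f : I -> V -> R) (df : I -> R) x v :
  uniq r -> (forall i, is_derive x v (f i) (df i)) ->
  is_derive x v (fun y => \prod_(i <- r) f i y)
    (\sum_(l <- r) \prod_(i <- r) (if i == l then df i else f i x)).
Proof.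
move=> + hf; elim: r => [_|a r IH /= /andP[ar ur]].
  rewrite big_nil (_ : (fun y => _) = cst 1); first exact: is_derive_cst.
  by apply/funext => y; rewrite big_nil.
have [da ea] := hf a; have [dr er] := IH ur.
have [d e] := is_derive_mul da dr.
rewrite (_ : (fun y => _) = (fun y => f a y * \prod_(i <- r) f i y)); last first.
  by apply/funext => y; rewrite big_cons.
split; first exact: d.
apply: (etrans e); rewrite ea er [RHS]big_cons big_cons eqxx; congr (_ * _ + _).
  apply: eq_big_seq => i ir.
  by case: eqP => // ia; rewrite -ia ir in ar.
rewrite mulr_sumr; apply: eq_big_seq => l lr.
by rewrite big_cons; case: eqP => // al; rewrite al lr in ar.
Qed.

Lemma is_derive_sum_seq (I : Type) (r : seq I) (f : I -> V -> R) (df : I -> R) x v :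
  (forall i, is_derive x v (f i) (df i)) ->
  is_derive x v (fun y => \sum_(i <- r) f i y) (\sum_(i <- r) df i).
Proof.
move=> hf; elim: r => [|a r IH].
  rewrite big_nil (_ : (fun y => _) = cst 0); first exact: is_derive_cst.
  by apply/funext => y; rewrite big_nil.
rewrite big_cons (_ : (fun y => _) = f a + (fun y => \sum_(i <- r) f i y)).
  exact: is_deriveD.
by apply/funext => y; rewrite big_cons.
Qed.

(** Jacobi's formula. The product rule replaces one row at a time by its derivative, and expanding
    each determinant along that row produces the adjugate. *)
Lemma is_derive_det n (A : V -> 'M[R]_n) (dA : 'M[R]_n) x v : is_derive x v A dA ->
  is_derive x v (fun y => \det (A y)) (\tr (dA *m \adj (A x))).
Proof.
move=> hA; have dE i j := is_derive_entry i j hA.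
have dP (s : 'S_n) := is_derive_prod_seq (index_enum_uniq 'I_n) (fun i => dE i (s i)).
have dS (s : 'S_n) := is_deriveZ ((-1) ^+ s : R) (dP s).
have [d e] := is_derive_sum_seq (index_enum _) dS.
split; first exact: d.
apply: (etrans e).
pose B l : 'M[R]_n := \matrix_(i, j) if i == l then dA i j else A x i j.
transitivity (\sum_l \det (B l)).
  rewrite [RHS]exchange_big /=; apply: eq_bigr => s _.
  rewrite scaler_sumr; apply: eq_bigr => l _; congr (_ * _).
  by apply: eq_bigr => i _; rewrite mxE.
apply: eq_bigr => l _; rewrite (expand_det_row _ l) mxE; apply: eq_bigr => j _.
rewrite !mxE eqxx; congr (_ * (_ * \det _)).
apply/matrixP => a b; rewrite !mxE; case: eqP => // h.
by have := neq_lift l a; rewrite h eqxx.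
Qed.
End Jacobi.

Transparent derive.

Section SquareRoot.
Variables (R : realType) (V : normedModType R).

Lemma is_derive_of_line (W : normedModType R) (f : V -> W) x v df :
  is_derive (0 : R) (1 : R) (fun t : R => f (x + t *: v)) df -> is_derive x v f df.
Proof.
have E : (fun h => h^-1 *: (((fun t : R => f (x + t *: v)) \o shift 0) (h *: (1 : R))
               - f (x + (0 : R) *: v))) =
       (fun h => h^-1 *: ((f \o shift x) (h *: v) - f x)).
  apply/funext => h /=; rewrite [h *: 1]mulr1 addr0 scale0r addr0.
  by rewrite [x + _]addrC.
move=> [d e]; split; first by move: d; rewrite /derivable E.
by move: e; rewrite /derive E.
Qed.

Opaque derive.

Lemma is_derive_sqrt (a : V -> R) (da : R) x v : 0 < a x -> is_derive x v a da ->
  is_derive x v (fun y => Num.sqrt (a y)) (da / (2 * Num.sqrt (a x))).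
Proof.
move=> a0 [d e]; apply: is_derive_of_line.
have a0' : 0 < a (x + (0 : R) *: v) by rewrite scale0r addr0.
have dl : derivable a (x + (0 : R) *: v) v by rewrite scale0r addr0.
have h := is_derive_line dl.
have c := @is_derive1_comp R Num.sqrt (fun t : R => a (x + t *: v)) 0 _ _
  (is_derive1_sqrt a0') h.
apply: is_derive_eq c _.
by rewrite scale0r addr0 e mulrC.
Qed.

Lemma Ck1_sqrt (U : set V) (a : V -> R) : open U -> (forall x, U x -> 0 < a x) ->
  Ck 1 U a -> Ck 1 U (fun y => Num.sqrt (a y)).
Proof.
move=> oU a0 Ca.
have cs : Ck 0 U (fun y => Num.sqrt (a y)).
  split=> // x Ux.
  exact: (continuous_comp (Ck_continuous Ca Ux) (@sqrt_continuous R _)).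
have ds x v (Ux : U x) := is_derive_sqrt (a0 x Ux) (derivableP (Ck_derivable (v := v) Ca Ux)).
have s0 x : U x -> 2 * Num.sqrt (a x) != 0.
  by move=> Ux; rewrite mulf_neq0// gt_eqF// sqrtr_gt0; exact: a0.
split; [by case: cs|split=> [x v Ux|v]]; first by have [] := ds x v Ux.
have C2 := CkM oU (Ck_cst 0 U (2 : R)) cs.
have C := CkM oU (Ck_derive v Ca) (CkV oU s0 C2).
apply: (Ck_ext oU _ C) => x Ux.
by have [_ e] := ds x v Ux; exact: esym e.
Qed.
End SquareRoot.

Lemma posdef_det (R : realType) m (A : 'M[R]_m) : posdef A -> 0 < \det A.
Proof.
move=> /posdef_orthonormalize[T /(congr1 determinant)].
rewrite !det_mulmx det_tr det1 mulrAC -expr2 => e.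
have t0 : 0 <= \det T ^+ 2 by rewrite exprn_even_ge0.
by rewrite -(pmulr_rgt0 _ (_ : 0 < \det T ^+ 2)) ?e ?ltr01// lt0r t0 andbT;
  apply: contra_eq_neq e => ->; rewrite mul0r eq_sym oner_neq0.
Qed.

Lemma Rintegral_sum d (T : measurableType d) (R : realType) (mu : {measure set T -> \bar R})
    (I : Type) (s : seq I) (f : I -> T -> R) :
  (forall i, mu.-integrable setT (EFin \o f i)) ->
  mu.-integrable setT (EFin \o (fun x => \sum_(i <- s) f i x)) /\
  \int[mu]_x (\sum_(i <- s) f i x) = \sum_(i <- s) \int[mu]_x f i x.
Proof.
move=> hf; elim: s => [|a s [iS eS]].
  rewrite big_nil; split.
    apply: (@eq_integrable _ _ _ mu _ measurableT (cst 0%E)); last exact: integrable0.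
    by move=> x _; rewrite /= big_nil.
  rewrite (_ : (fun x => _) = cst 0); first by rewrite Rintegral_cst// mul0r.
  by apply/funext => x; rewrite big_nil.
have E : (fun x => \sum_(i <- a :: s) f i x) = (fun x => f a x + \sum_(i <- s) f i x).
  by apply/funext => x; rewrite big_cons.
rewrite E; split; last by rewrite RintegralD// big_cons eS.
exact: (@integrableD _ _ _ mu _ measurableT _ _ (hf a) iS).
Qed.

Section Divergence.
Variables (R : realType) (m : nat) (U : set 'rV[R]_m) (G : 'rV[R]_m -> 'M[R]_m).
Hypotheses (oU : open U) (GC : Ck 3 U G) (Gpos : forall x, U x -> posdef (G x)).
Local Notation e_ i := (delta_mx 0 i : 'rV[R]_m).
Let w x := Num.sqrt (\det (G x)).

(** By Jacobi's formula and metric compatibility the determinant has derivative [2 \det G] times the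
    trace of [Gam]; the square root removes the factor 2. *)
Lemma is_derive_density x u : U x -> is_derive x u w (w x * \tr (Gam G x u)).
Proof.
move=> Ux; have dG := derivableP (Ck_derivable (v := u) GC Ux).
have [dd e] := is_derive_det dG.
have g0 := posdef_det (Gpos Ux).
have E : \tr ('D_u G x *m \adj (G x)) = \det (G x) * (\tr (Gam G x u) *+ 2).
  rewrite (Gam_metric oU GC Gpos u Ux) mulmxDl mxtraceD -mulmxA mul_mx_adj.
  rewrite mul_mx_scalar mxtraceZ -mulmxA mxtrace_mulC -mulmxA mul_adj_mx.
  by rewrite mul_mx_scalar mxtraceZ mxtrace_tr -mulrDr mulr2n.
have h := @is_derive_sqrt R _ (fun y => \det (G y)) _ x u g0 (DeriveDef dd e).
apply: is_derive_eq h _; rewrite E /w.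
rewrite -{1}(sqr_sqrtr (ltW g0)); have : Num.sqrt (\det (G x)) != 0.
  by rewrite gt_eqF// sqrtr_gt0.
move: (Num.sqrt _) (\tr _) => s t s0.
by rewrite -mulr_natl; field.
Qed.

Lemma Ck_density : Ck 1 U w.
Proof.
apply: Ck1_sqrt => //; first by move=> x /Gpos/posdef_det.
exact: (Ck_det oU (Ck_le (isT : (1 <= 3)%N) GC)).
Qed.

(** Torsion-freeness identifies the trace in the covariant divergence with the one in the derivative
    of the density. *)
Lemma trace_divergence x (v : 'rV[R]_m) : U x ->
  \sum_k (v *m Gam G x (e_ k)) 0 k = \sum_k v 0 k * \tr (Gam G x (e_ k)).
Proof.
move=> Ux; under eq_bigr do rewrite mxE.
under [RHS]eq_bigr do rewrite mulr_sumr.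
rewrite exchange_big; apply: eq_bigr => j _; apply: eq_bigr => k _; congr (_ * _).
have := Gam_sym oU Gpos (e_ k) (e_ j) Ux => /rowP/(_ k).
by rewrite -!rowE !mxE.
Qed.

(** The components of [h V w] are C^1 with compact support, so their partial derivatives integrate
    to 0. The product rule splits their sum into [h] times the divergence of [V] and the derivative
    of [h] along [V], both weighted by [w]. *)
Lemma chart_divergence (V : 'rV[R]_m -> 'rV[R]_m) (h : 'rV[R]_m -> R) (K : set 'rV[R]_m) N :
  Ck 1 U V -> Ck 1 setT h -> closed K -> K `<=` U -> K `<=` rowbox m N ->
  (forall x, ~ K x -> h x = 0) ->
  (\int[lambda R m]_x (h x * (\sum_k ('D_(e_ k) V x 0 k + (V x *m Gam G x (e_ k)) 0 k))
     * (\1_U x * w x)))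
  = - \int[lambda R m]_x ('D_(V x) h x * (\1_U x * w x)).
Proof.
move=> CV Ch cK KU KN h0; have oT : open [set: 'rV[R]_m] := openT.
have oK : open (~` K) := closed_openC cK.
have Dh0 x v : ~ K x -> 'D_v h x = 0.
  move=> nK; rewrite -[RHS](derive_cst (0 : R) x v); exact: (eq_on_derive v oK h0 nK).
have CVk k := Ck_entry 0 k oU CV.
pose a k x := V x 0 k * w x.
have Ca k : Ck 1 U (a k) := CkM oU (CVk k) Ck_density.
(* A product whose first factor vanishes off the closed [K] is regular on the whole space as soon as
   it is so on [U], since [U] and the complement of [K] cover it. *)
have glue0 (c b : 'rV[R]_m -> R) : Ck 0 setT c -> (forall x, ~ K x -> c x = 0) ->
    Ck 0 U b -> Ck 0 setT (fun x => c x * b x).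
  move=> Cc c0 Cb; apply: Ck_local => x _; have [Kx|nKx] := pselect (K x).
    exists U; split; [exact: oU|exact: KU|].
    exact: (CkM oU (Ck_sub (fun _ _ => I) Cc) Cb).
  exists (~` K); split; [exact: oK|exact: nKx|].
  apply: (Ck_ext oK _ (Ck_cst 0 _ (0 : R))) => y nKy.
  by rewrite c0// mul0r.
have glue (b : 'rV[R]_m -> R) : Ck 1 U b -> Ck 1 setT (fun x => h x * b x).
  move=> Cb; apply: Ck_local => x _; have [Kx|nKx] := pselect (K x).
    exists U; split; [exact: oU|exact: KU|].
    exact: (CkM oU (Ck_sub (fun _ _ => I) Ch) Cb).
  exists (~` K); split; [exact: oK|exact: nKx|].
  apply: (Ck_ext oK _ (Ck_cst 1 _ (0 : R))) => y nKy.
  by rewrite h0// mul0r.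
have Cu k := glue _ (Ca k).
have u0 k x : ~ rowbox m N x -> h x * a k x = 0.
  by move=> nx; rewrite h0 ?mul0r// => /KN.
have Z k := integral_derive0 (e_ k) (Cu k) (u0 k).
have cD k : continuous ('D_(e_ k) (fun x => h x * a k x)).
  by move=> x; exact: (Ck_continuous (Ck_derive (e_ k) (Cu k)) I).
have D0 k x : ~ K x -> 'D_(e_ k) (fun x => h x * a k x) x = 0.
  move=> nK; rewrite -[RHS](derive_cst (0 : R) x (e_ k)).
  by apply: (eq_on_derive _ oK _ nK) => y nKy; rewrite h0 ?mul0r.
have iD k : (lambda R m).-integrable setT
    (EFin \o 'D_(e_ k) (fun x => h x * a k x)).
  have o x : ~ rowbox m N x -> 'D_(e_ k) (fun x => h x * a k x) x = 0.
    by move=> nx; apply: D0 => /KN.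
  have [B hB] := box_bounded (cD k) o.
  exact: (box_integrable (continuous_measurable_row (cD k)) hB o).
have split_k k x : K x -> 'D_(e_ k) (fun x => h x * a k x) x =
    'D_(e_ k) h x * a k x
    + h x * ('D_(e_ k) V x 0 k * w x + V x 0 k * (w x * \tr (Gam G x (e_ k)))).
  move=> Kx; have Ux := KU x Kx.
  have dh := Ck_derivable (v := e_ k) Ch (I : [set: 'rV[R]_m] x).
  have da := Ck_derivable (v := e_ k) (Ca k) Ux.
  have [_ e] := is_derive_mul dh da; apply: (etrans e); congr (_ + _ * _).
  have [dw ew] := is_derive_density (e_ k) Ux.
  have dVk := Ck_derivable (v := e_ k) (CVk k) Ux.
  have [_ e2] := is_derive_mul dVk dw; apply: (etrans e2).
  rewrite ew; congr (_ * _ + _).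
  exact: (derive_entry 0 k (Ck_derivable (v := e_ k) CV Ux)).
have sumDa x : \sum_i 'D_(e_ i) h x * a i x = 'D_(V x) h x * w x.
  have dh : differentiable h x := Ck_differentiable_real oT Ch I.
  rewrite (deriveE _ dh) {1}[V x]row_sum_delta linear_sum mulr_suml.
  apply: eq_bigr => k _; rewrite (deriveE _ dh) linearZ /= /a.
  rewrite [X in _ = X * _](_ : _ = V x 0 k * 'd h x (e_ k)) //.
  by rewrite mulrA [X in X * _]mulrC.
have key x : h x * (\sum_k ('D_(e_ k) V x 0 k + (V x *m Gam G x (e_ k)) 0 k)) * (\1_U x * w x)
    = - ('D_(V x) h x * (\1_U x * w x)) + \sum_k 'D_(e_ k) (fun x => h x * a k x) x.
  have [Kx|nKx] := pselect (K x); last first.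
    rewrite h0// Dh0// !mul0r oppr0 add0r big1// => k _; exact: D0.
  have Ux := KU x Kx.
  rewrite indicE mem_set// mul1r (eq_bigr _ (fun k _ => split_k k x Kx)).
  rewrite [in RHS]big_split /=.
  rewrite sumDa.
  rewrite addKr.
  have E : \sum_k ('D_(e_ k) V x 0 k + (V x *m Gam G x (e_ k)) 0 k) =
      \sum_k ('D_(e_ k) V x 0 k + V x 0 k * \tr (Gam G x (e_ k))).
    apply: etrans (big_split _ _ _ _ _) _; rewrite (trace_divergence _ Ux).
    exact/esym/big_split.
  apply: (etrans (f_equal (fun z => h x * z * w x) E)).
  rewrite mulr_sumr mulr_suml; apply: eq_bigr => k _.
  by ring.
pose b x := 'D_(V x) h x * (\1_U x * w x).
have bE x : b x = \sum_k 'D_(e_ k) h x * a k x.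
  rewrite /b; have [Kx|nKx] := pselect (K x); last first.
    by rewrite Dh0// mul0r big1// => k _; rewrite Dh0// mul0r.
  by rewrite indicE (mem_set (KU x Kx)) mul1r sumDa.
have ib : (lambda R m).-integrable setT (EFin \o b).
  have Cb k := glue0 _ _ (Ck_derive (e_ k) Ch) (fun x => Dh0 x (e_ k)) (Ck_pred (Ca k)).
  have iba k : (lambda R m).-integrable setT (EFin \o (fun x => 'D_(e_ k) h x * a k x)).
    have o x : ~ rowbox m N x -> 'D_(e_ k) h x * a k x = 0.
      by move=> nx; rewrite Dh0 ?mul0r// => /KN.
    have cb : continuous (fun x => 'D_(e_ k) h x * a k x).
      by move=> x; exact: (Ck_continuous (Cb k) I).
    have [B hB] := box_bounded cb o.
    exact: (box_integrable (continuous_measurable_row cb) hB o).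
  have [i1 _] := Rintegral_sum (index_enum 'I_m) iba.
  by apply: eq_integrable i1 => // x _; rewrite /= bE.
have [iS eS] := Rintegral_sum (index_enum 'I_m) iD.
under [LHS]eq_Rintegral do rewrite key addrC.
rewrite RintegralB// eS big1 ?sub0r// => k _; exact: Z.
Qed.
End Divergence.

(** * Independence of the chart *)

Lemma cofr_transition (R : realType) m (A A' J D D' : 'M[R]_m) :
  posdef A -> posdef A' -> A = J *m A' *m J^T -> (D' == D *m J)%MS ->
  J^T *m cofr A D *m J = cofr A' D'.
Proof.
move=> pA pA' AE /eqmxP eD; apply: cofr_uniq => //.
- by rewrite trmx_mul (trmx_mul J^T) trmxK cofr_sym (mulmxA J^T (cofr _ _) J).
- rewrite eD -mulmxA; apply: submx_trans (submxMl _ _) _.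
  by apply: submxMr; exact: cofr_sub.
have /submxP[Y eY] : (D' <= D *m J)%MS by rewrite eD.
have e : D *m A *m cofr A D = D by apply: cofr_id.
have -> : D' *m A' *m (J^T *m cofr A D *m J) = Y *m (D *m (J *m A' *m J^T) *m cofr A D) *m J.
  by rewrite {1}eY -!mulmxA.
by rewrite -AE e eY mulmxA.
Qed.

Section ContractionInvariance.
Variables (R : realType) (m : nat).
Local Notation e_ i := (delta_mx 0 i : 'rV[R]_m).
Variable J : 'M[R]_m.
Hypothesis uJ : J \in unitmx.
Let K := invmx J.

Let contract (B : 'rV[R]_m -> 'rV[R]_m -> R) : (forall v, linear (B ^~ v : _ -> R^o)) ->
  (forall u, linear (B u : _ -> R^o)) ->
  \sum_r B (e_ r *m J) (e_ r *m K^T) = \sum_r B (e_ r) (e_ r).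
Proof.
move=> B1 B2; have bB : bilin (B : _ -> _ -> R^o) by split.
have := bilin_contract J^T K^T bB; rewrite trmxK => ->.
by rewrite -trmx_mul mulVmx// trmx1; apply: eq_bigr => r _; rewrite mulmx1.
Qed.

(** After conjugation each summed index occurs once with [J] and once with the inverse transpose of
    [J]; [contract] cancels the two, first over [p] and then over [r]. *)
Lemma curvature_trace_invariance (C P C' P' : 'M[R]_m) (Rc Rc' : 'rV[R]_m -> 'rV[R]_m -> 'M[R]_m) :
  bilin Rc' -> J^T *m C *m J = C' -> P *m J = J *m P' ->
  (forall u v, Rc u v *m J = J *m Rc' (u *m J) (v *m J)) ->
  \sum_r \sum_p (C *m Rc (e_ p) (e_ r) *m P) r p =
  \sum_r \sum_p (C' *m Rc' (e_ p) (e_ r) *m P') r p.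
Proof.
move=> [Rl Rr] CE PE RE.
have entry (M : 'M[R]_m) r p : M r p = (e_ r *m M *m (e_ p)^T) 0 0.
  by rewrite trmx_delta -rowE -colE !mxE.
have JK : J *m K = 1%:M by rewrite mulmxV.
pose Q (a b c d : 'rV[R]_m) := (c *m C' *m Rc' a b *m P' *m d^T) 0 0.
have lin1 (z : R) (X Y : 'M[R]_1) : (z *: X + Y) 0 0 = z * X 0 0 + Y 0 0.
  by rewrite !mxE.
transitivity (\sum_r \sum_p Q (e_ p *m J) (e_ r *m J) (e_ r *m K^T) (e_ p *m K^T)).
  apply: eq_bigr => r _; apply: eq_bigr => p _.
  have -> : C *m Rc (e_ p) (e_ r) *m P =
      K^T *m C' *m Rc' (e_ p *m J) (e_ r *m J) *m P' *m K.
    have P1 : P = J *m P' *m K by rewrite -PE -mulmxA JK mulmx1.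
    rewrite P1 !mulmxA -(mulmxA C) RE -CE !mulmxA.
    by rewrite -trmx_mul JK trmx1 mul1mx.
  by rewrite entry /Q trmx_mul trmxK !mulmxA.
transitivity (\sum_r \sum_p Q (e_ p) (e_ r *m J) (e_ r *m K^T) (e_ p)).
  apply: eq_bigr => r _.
  apply: (contract (B := fun a d => Q a (e_ r *m J) (e_ r *m K^T) d)) => [d z a b|a z d b].
    by rewrite /Q Rl mulmxDr -scalemxAr !mulmxDl -!scalemxAl lin1.
  by rewrite /Q linearD linearZ /= mulmxDr -scalemxAr lin1.
rewrite exchange_big [RHS]exchange_big; apply: eq_bigr => p _ /=.
transitivity (\sum_r Q (e_ p) (e_ r) (e_ r) (e_ p)).
  apply: (contract (B := fun b c => Q (e_ p) b c (e_ p))) => [c z a b|b z a c].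
    by rewrite /Q Rr mulmxDr -scalemxAr !mulmxDl -!scalemxAl lin1.
  by rewrite /Q !mulmxDl -!scalemxAl lin1.
by apply: eq_bigr => r _; rewrite entry /Q !mulmxA.
Qed.

(** Writing the field as the sum of [e_r *m (M r - (M r)^T)] handles both traces at once; the
    contracted index cancels against [J] and the free one transforms by [J]. *)
Lemma variation_field_invariance (C P C' P' : 'M[R]_m) (Q Q' : 'I_m -> 'M[R]_m) :
  J^T *m C *m J = C' -> P *m J = J *m P' ->
  (forall r, Q r *m J = J *m \sum_s J r s *: Q' s) ->
  (\row_k \sum_r ((C *m Q r *m P) r k - (C *m Q r *m P) k r)) *m J =
  \row_k \sum_r ((C' *m Q' r *m P') r k - (C' *m Q' r *m P') k r).
Proof.
move=> CE PE QE.
have rowE' (M : 'I_m -> 'M[R]_m) :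
    \row_k \sum_r (M r r k - M r k r) = \sum_r e_ r *m (M r - (M r)^T).
  apply/rowP => k; rewrite mxE summxE; apply: eq_bigr => r _.
  by rewrite -rowE !mxE.
rewrite !rowE'; have JK : J *m K = 1%:M by rewrite mulmxV.
have KJ : K *m J = 1%:M by rewrite mulVmx.
pose M' s := C' *m Q' s *m P'.
have ME r : C *m Q r *m P = K^T *m (\sum_s J r s *: M' s) *m K.
  have P1 : P = J *m P' *m K by rewrite -PE -mulmxA JK mulmx1.
  rewrite P1 !mulmxA -(mulmxA C) QE mulmxA.
  have -> : C *m J = K^T *m C' by rewrite -CE !mulmxA -trmx_mul JK trmx1 mul1mx.
  congr (_ *m _); rewrite -!mulmxA; congr (_ *m _).
  rewrite mulmx_suml mulmx_sumr; apply: eq_bigr => s _.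
  by rewrite -scalemxAl -scalemxAr /M' mulmxA.
have NE r : (C *m Q r *m P - (C *m Q r *m P)^T) =
    K^T *m (\sum_s J r s *: (M' s - (M' s)^T)) *m K.
  rewrite ME !trmx_mul trmxK mulmxA -mulmxBl -mulmxBr; congr (_ *m _ *m _).
  rewrite linear_sum /= -sumrB; apply: eq_bigr => s _.
  by rewrite linearZ /= scalerBr.
rewrite mulmx_suml.
under eq_bigr => r _ do rewrite NE -!mulmxA KJ mulmx1 mulmxA mulmx_sumr.
rewrite exchange_big /=; apply: eq_bigr => s _.
transitivity (\sum_r J r s *: (e_ r *m K^T *m (M' s - (M' s)^T))).
  by apply: eq_bigr => r _; rewrite -scalemxAr.
under eq_bigr => r _ do rewrite scalemxAl scalemxAl.
rewrite -!mulmx_suml; congr (_ *m _).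
have -> : \sum_r J r s *: e_ r = e_ s *m J^T.
  by rewrite [RHS]row_sum_delta; apply: eq_bigr => r _; rewrite -rowE !mxE.
by rewrite -mulmxA -trmx_mul KJ trmx1 mulmx1.
Qed.
End ContractionInvariance.

Section FamilyTransition.
Variables (R : realType) (m : nat) (eps : R) (U U' : set 'rV[R]_m).
Local Notation e_ i := (delta_mx 0 i : 'rV[R]_m).
Local Notation V := (R * 'rV[R]_m)%type.
Variables (phi : 'rV[R]_m -> 'rV[R]_m) (Gt Gt' : V -> 'M[R]_m).
Variables (D1 D2 D1' D2' : 'rV[R]_m -> 'M[R]_m).
Hypotheses (eps0 : 0 < eps) (oU : open U) (oU' : open U').
Hypotheses (phiC : Ck 4 U phi) (phiU : forall x, U x -> U' (phi x)).
Hypotheses (GtC : Ck 3 (tube eps U) Gt) (GtC' : Ck 3 (tube eps U') Gt').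
Hypothesis Gtpos : forall q, tube eps U q -> posdef (Gt q).
Hypothesis Gtpos' : forall q, tube eps U' q -> posdef (Gt' q).
Let J := jacobian phi.
Hypothesis GJ : forall t x, `|t| < eps -> U x ->
  Gt (t, x) = J x *m Gt' (t, phi x) *m (J x)^T.
Hypothesis DJ1 : forall x, U x -> (D1' (phi x) == D1 x *m J x)%MS.
Hypothesis DJ2 : forall x, U x -> (D2' (phi x) == D2 x *m J x)%MS.

Let uJ x : U x -> J x \in unitmx.
Proof.
move=> Ux; have T0 : tube eps U (0, x) by split=> //=; rewrite normr0.
have := posdef_unit (Gtpos T0); rewrite GJ ?normr0// unitmx_mul => /andP[].
by rewrite unitmx_mul => /andP[].
Qed.

Let tr_ t x : `|t| < eps -> U x ->
  (J x)^T *m cofr (Gt (t, x)) (D2 x) *m J x = cofr (Gt' (t, phi x)) (D2' (phi x)) /\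
  Gt (t, x) *m cofr (Gt (t, x)) (D1 x) *m J x =
    J x *m (Gt' (t, phi x) *m cofr (Gt' (t, phi x)) (D1' (phi x))).
Proof.
move=> te Ux; have p : posdef (Gt (t, x)) by apply: Gtpos; split.
have p' : posdef (Gt' (t, phi x)) by apply: Gtpos'; split=> //; exact: phiU.
split; first exact: cofr_transition p p' (GJ te Ux) (DJ2 Ux).
rewrite -(cofr_transition p p' (GJ te Ux) (DJ1 Ux)).
have E := GJ te Ux; move: (cofr _ _) => C; rewrite E.
by rewrite !mulmxA.
Qed.

Lemma chart_curvature_transition t x : `|t| < eps -> U x ->
  chart_curvature Gt D1 D2 (t, x) = chart_curvature Gt' D1' D2' (t, phi x).
Proof.
move=> te Ux; have T : tube eps U (t, x) by split.
have T' : tube eps U' (t, phi x) by split=> //; exact: phiU.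
rewrite (chart_curvatureE oU GtC Gtpos _ _ T) (chart_curvatureE oU' GtC' Gtpos' _ _ T').
have GC := Ck_slice oU te GtC; have GC' := Ck_slice oU' te GtC'.
have gp y : U y -> posdef (Gt (t, y)) by move=> Uy; exact: Gtpos.
have gp' y : U' y -> posdef (Gt' (t, y)) by move=> Uy; exact: Gtpos'.
have [e2 e1] := tr_ te Ux.
apply: (curvature_trace_invariance (uJ Ux)) e2 e1 _.
  by split=> v; [exact: Rm_linl oU' GC' gp' (phiU Ux)|exact: Rm_linr oU' GC' gp' (phiU Ux)].
move=> u v.
exact: (Rm_transition oU oU' phiC phiU GC GC' gp gp' (fun y Uy => GJ te Uy) u v Ux).
Qed.

(** The inhomogeneous term ['D_(e_ r) J] in the law for Christoffel symbols does not depend on time,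
    so it disappears under the time derivative, which is therefore a tensor. *)
Let Pi_transition x r : U x ->
  dGam_dt Gt r x *m J x = J x *m \sum_s J x r s *: dGam_dt Gt' s (phi x).
Proof.
move=> Ux; have te0 : `|0 : R| < eps by rewrite normr0.
have T : tube eps U (0, x) by split.
have T' : tube eps U' (0, phi x) by split=> //; exact: phiU.
have d := @is_derive_slice_time _ _ _ (Gam_family Gt (e_ r)) 0 x
  (Ck_derivable (Ck_Gam_family oU GtC Gtpos (e_ r)) T).
have d' s := @is_derive_slice_time _ _ _ (Gam_family Gt' (e_ s)) 0 (phi x)
  (Ck_derivable (Ck_Gam_family oU' GtC' Gtpos' (e_ s)) T').
have tr t : `|t| < eps -> Gam_family Gt (e_ r) (t, x) *m J x =
    'D_(e_ r) J x + J x *m \sum_s J x r s *: Gam_family Gt' (e_ s) (t, phi x).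
  move=> te; have GC := Ck_slice oU te GtC; have GC' := Ck_slice oU' te GtC'.
  have gp y : U y -> posdef (Gt (t, y)) by move=> Uy; exact: Gtpos.
  have gp' y : U' y -> posdef (Gt' (t, y)) by move=> Uy; exact: Gtpos'.
  have h := Gam_transition oU oU' phiC phiU GC GC' gp gp' (fun y Uy => GJ te Uy) (e_ r) Ux.
  apply: (etrans h); congr (_ + _ *m _); rewrite Gam_sum; apply: eq_bigr => s _.
  by rewrite -rowE mxE.
have [dL eL] := d; have cJ := derivable_cst (V := R) (J x) 0 1.
have [_ e1] := is_derive_mulmx dL cJ.
have dS : is_derive (0 : R) 1 (fun t => \sum_s J x r s *: Gam_family Gt' (e_ s) (t, phi x))
    (\sum_s J x r s *: dGam_dt Gt' s (phi x)).
  have := is_derive_sum (fun s => is_deriveZ (J x r s) (d' s)).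
  apply: near_eq_is_derive; near=> t; by rewrite fct_sumE.
have [dS1 eS] := dS.
have [dM eM] := is_derive_mulmx cJ dS1.
have [_ e2] := is_deriveD (is_derive_cst ('D_(e_ r) J x) (0 : R) 1) (DeriveDef dM eM).
have E : 'D_1 (fun t => Gam_family Gt (e_ r) (t, x) *m J x) (0 : R) =
    'D_1 (fun t => 'D_(e_ r) J x + J x *m \sum_s J x r s *: Gam_family Gt' (e_ s) (t, phi x)) (0 : R).
  by apply: near_eq_derive; near=> t; rewrite tr//; near: t; exact: nbhs0_lt.
have := etrans (esym e1) (etrans E e2).
have dc : 'D_1 (cst (J x)) (0 : R) = 0 := derive_cst _ _ _.
by rewrite eL eS dc mulmx0 mul0mx addr0 !add0r.
Unshelve. all: end_near. Qed.

Lemma variation_vector_transition x : U x -> variation_vector Gt D1 D2 x *m J x = variation_vector Gt' D1' D2' (phi x).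
Proof.
move=> Ux; have te0 : `|0 : R| < eps by rewrite normr0.
have [e2 e1] := tr_ te0 Ux.
exact: (variation_field_invariance (uJ Ux) e2 e1 (fun r => Pi_transition r Ux)).
Qed.
End FamilyTransition.

(** * Cutoff functions of class C^1 *)

Section Bump.
Variables (R : realType).

(** The square makes the positive part C^1. That is enough for cutoffs, since the divergence theorem
    differentiates them only once. *)
Definition pos_sqr (s : R) : R := Num.max 0 s ^+ 2.

Lemma pos_sqr_le0 (s : R) : s <= 0 -> pos_sqr s = 0.
Proof. by move=> s0; rewrite /pos_sqr max_l// expr0n. Qed.

Lemma pos_sqr_ge0 (s : R) : 0 <= s -> pos_sqr s = s ^+ 2.
Proof. by move=> s0; rewrite /pos_sqr max_r. Qed.

Lemma is_derive_pos_sqr (s : R) : is_derive s (1 : R) pos_sqr (2 * Num.max 0 s).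
Proof.
(* A quadratic bound on the remainder, uniform across the signs of [s] and [s + h], avoids treating
   [s = 0] separately. *)
have bnd (h : R) : `|pos_sqr (s + h) - pos_sqr s - 2 * Num.max 0 s * h| <= h ^+ 2.
  rewrite /pos_sqr ler_norml; case: (leP 0 s) => s0; case: (leP 0 (s + h)) => sh; rewrite ?expr0n /=;
    apply/andP; split; nra.
have C : h^-1 *: ((pos_sqr \o shift s) (h *: (1 : R)) - pos_sqr s) @[h --> 0^'] --> 2 * Num.max 0 s.
  apply/cvgrPdist_le => /= e e0; near=> h.
  have h0 : h != 0 by near: h; exact: nbhs_dnbhs_neq.
  have he : `|h| <= e.
    by near: h; apply: dnbhs0_le.
  rewrite distrC [h *: 1]mulr1 [h + s]addrC.
  have -> : h^-1 *: (pos_sqr (s + h) - pos_sqr s) - 2 * Num.max 0 s =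
      h^-1 * (pos_sqr (s + h) - pos_sqr s - 2 * Num.max 0 s * h).
    by rewrite [RHS]mulrBr [X in _ = _ - X]mulrC mulfK.
  rewrite normrM normfV ler_pdivrMl ?normr_gt0//.
  by apply: (le_trans (bnd h)); rewrite -(real_normK (num_real h)) expr2 ler_wpM2l.
by split; [apply/cvg_ex; eexists; exact: C|exact: cvg_lim C].
Unshelve. all: end_near. Qed.

Lemma continuous_pos_sqr : continuous pos_sqr.
Proof.
by move=> s; apply: differentiable_continuous; apply/derivable1_diffP; have [] := is_derive_pos_sqr s.
Qed.

Lemma continuous_max0 : continuous (fun s : R => Num.max 0 s).
Proof.
move=> s; have c0 : {for s, continuous (fun=> 0 : R)} by exact: cst_continuous.
exact: (@continuous_max _ R (fun=> 0) id s c0 (@cvg_id _ _)).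
Qed.

Lemma Ck1_pos_sqr (V : normedModType R) (U : set V) (a : V -> R) : open U ->
  Ck 1 U a -> Ck 1 U (fun y => pos_sqr (a y)).
Proof.
move=> oU Ca; have ca x (Ux : U x) := Ck_continuous Ca Ux.
have ds x v : U x -> is_derive x v (fun y => pos_sqr (a y)) ('D_v a x * (2 * Num.max 0 (a x))).
  move=> Ux; apply: is_derive_of_line.
  have dl : derivable a (x + (0 : R) *: v) v.
    by rewrite scale0r addr0; exact: Ck_derivable Ca Ux.
  have c := @is_derive1_comp R pos_sqr (fun t : R => a (x + t *: v)) 0 _ _
    (is_derive_pos_sqr _) (is_derive_line dl).
  by apply: is_derive_eq c _; rewrite scale0r addr0 mulrC.
have cs : Ck 0 U (fun y => pos_sqr (a y)).
  by split=> // x Ux; exact: (continuous_comp (ca x Ux) (@continuous_pos_sqr _)).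
have cm : Ck 0 U (fun y => Num.max 0 (a y)).
  by split=> // x Ux; exact: (continuous_comp (ca x Ux) (@continuous_max0 _)).
split; [by case: cs|split=> [x v Ux|v]]; first by have [] := ds x v Ux.
have C := CkM oU (Ck_derive v Ca) (CkM oU (Ck_cst 0 U (2 : R)) cm).
apply: (Ck_ext oU _ C) => x Ux.
by have [_ e] := ds x v Ux; exact: esym e.
Qed.

Lemma Ck1_comp_row m n (U : set 'rV[R]_m) (U' : set 'rV[R]_n) (f : 'rV[R]_m -> 'rV[R]_n)
    (b : 'rV[R]_n -> R) : open U -> open U' -> Ck 1 U f -> Ck 1 U' b ->
  (forall x, U x -> U' (f x)) -> Ck 1 U (fun x => b (f x)).
Proof.
move=> oU oU' Cf Cb fU.
have df x (Ux : U x) := Ck_differentiable oU Cf Ux.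
have d x v : U x -> is_derive x v (fun y => b (f y)) ('D_('D_v f x) b (f x)).
  by move=> Ux; exact: (is_derive_comp_row v oU' Cb (fU x Ux) (df x Ux)).
have cc (a : 'rV[R]_n -> R) : Ck 0 U' a -> Ck 0 U (fun x => a (f x)).
  move=> Ca; split=> // x Ux.
  exact: (continuous_comp (Ck_continuous Cf Ux) (Ck_continuous Ca (fU x Ux))).
split; [by case: (cc b (Ck_pred Cb))|split=> [x v Ux|v]]; first by have [] := d x v Ux.
have C k := CkM oU (Ck_entry 0 k oU (Ck_derive v Cf))
  (cc _ (Ck_derive (delta_mx 0 k : 'rV[R]_n) Cb)).
apply: (Ck_ext oU _ (@Ck_sum _ _ _ 0 U _ (index_enum 'I_n) xpredT
  (fun k x => 'D_v f x 0 k * 'D_(delta_mx 0 k) b (f x)) oU (fun k _ => C k))) => x Ux.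
have [_ ->] := d x v Ux; have db := Ck_differentiable_real oU' Cb (fU x Ux).
rewrite (deriveE _ db) [X in 'd _ _ X]row_sum_delta linear_sum; apply: eq_bigr => k _.
by rewrite linearZ /= (deriveE _ db).
Qed.

Variable m : nat.
Variables (c : 'rV[R]_m) (r : R).
Hypothesis r0 : 0 < r.

Definition sqdist (x : 'rV[R]_m) := \sum_j (x 0 j - c 0 j) ^+ 2.
(** At the centre the inner term equals 2, so near it the outer [pos_sqr] has a negative argument
    and the value is 1. Outside the ball the inner [pos_sqr] vanishes and the value is [1 - 1 = 0].
    Squared Euclidean distance is used because the sup norm is not differentiable. *)
Definition bump (x : 'rV[R]_m) : R :=
  1 - pos_sqr (1 - 2 / r ^+ 4 * pos_sqr (r ^+ 2 - sqdist x)).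
Definition bump_ball := [set x | sqdist x <= r ^+ 2].
Definition bump_core := [set x | 1 < 2 / r ^+ 4 * pos_sqr (r ^+ 2 - sqdist x)].

Lemma Ck_sqdist n : Ck n setT sqdist.
Proof.
have oT : open [set: 'rV[R]_m] := openT.
apply: (Ck_sum _ oT) => j _.
have C1 : Ck n setT (fun x : 'rV[R]_m => x 0 j - c 0 j).
  exact: (CkB oT (Ck_entry 0 j oT (Ck_id n setT)) (Ck_cst n _ _)).
exact: (CkM oT C1 C1).
Qed.

Lemma Ck_bump : Ck 1 setT bump.
Proof.
have oT : open [set: 'rV[R]_m] := openT.
have c1 (z : R) := Ck_cst 1 [set: 'rV[R]_m] z.
apply: (CkB oT (c1 1)); apply: (Ck1_pos_sqr oT); apply: (CkB oT (c1 1)).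
apply: (CkM oT (c1 _)); apply: (Ck1_pos_sqr oT).
exact: (CkB oT (c1 _) (Ck_sqdist 1)).
Qed.

Lemma bump_out x : ~ bump_ball x -> bump x = 0.
Proof.
move=> /negP; rewrite -ltNge => h; rewrite /bump [pos_sqr (r ^+ 2 - _)]pos_sqr_le0.
  by rewrite mulr0 subr0 pos_sqr_ge0// expr1n subrr.
by rewrite subr_le0 ltW.
Qed.

Lemma bump_in x : bump_core x -> bump x = 1.
Proof.
by move=> h; rewrite /bump pos_sqr_le0 ?subr0// subr_le0 ltW.
Qed.

Lemma bump_core_center : bump_core c.
Proof.
rewrite /bump_core /= /sqdist big1 => [|j _]; last by rewrite subrr expr0n.
rewrite subr0 pos_sqr_ge0 ?exprn_ge0 ?(ltW r0)//.
by rewrite -exprM divfK ?ltr1n// expf_neq0// gt_eqF.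
Qed.

Lemma open_bump_core : open bump_core.
Proof.
have oT : open [set: 'rV[R]_m] := openT.
have C : Ck 1 setT (fun x => 2 / r ^+ 4 * pos_sqr (r ^+ 2 - sqdist x)).
  have c1 (z : R) := Ck_cst 1 [set: 'rV[R]_m] z.
  apply: (CkM oT (c1 _)); apply: (Ck1_pos_sqr oT); exact: (CkB oT (c1 _) (Ck_sqdist 1)).
have cC : continuous (fun x => 2 / r ^+ 4 * pos_sqr (r ^+ 2 - sqdist x)).
  by move=> x; exact: (Ck_continuous C I).
by have := (continuousP _).1 cC _ (@open_gt R 1).
Qed.

Lemma bump_ball_coord x j : bump_ball x -> `|x 0 j - c 0 j| <= r.
Proof.
rewrite /bump_ball /= /sqdist (bigD1 j)//= => h.
rewrite -(ler_pXn2r (ltn0Sn 1)) ?nnegrE ?(ltW r0)// -normrX ger0_norm ?exprn_even_ge0//.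
by apply: le_trans h; rewrite lerDl sumr_ge0// => k _; rewrite exprn_even_ge0.
Qed.

Lemma compact_bump_ball : compact (bump_ball : set 'rV[R]_m).
Proof.
have cd : continuous sqdist by move=> x; exact: (Ck_continuous (Ck_sqdist 1) I).
have cl : closed bump_ball.
  by have := (continuous_closedP _).1 cd _ (@closed_le R (r ^+ 2)).
apply: (subclosed_compact cl (@compact_rowbox R m (r + \sum_j `|c 0 j|))) => x bx j.
rewrite -[x 0 j](subrK (c 0 j)) (le_trans (ler_normD _ _))// lerD//; first exact: bump_ball_coord.
by rewrite (bigD1 j)//= lerDl sumr_ge0.
Qed.
End Bump.

Section ChartFunction.
Variables (R : realType) (m : nat) (M : manifold R m).
Variables (g : field M 'M[R]_m) (mu : {measure set (borel M) -> \bar R}).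
Hypotheses (gm : is_metric g) (vol : is_riemannian_volume g mu).
Variables (i : idx M) (B : set 'rV[R]_m).
Hypotheses (cB : compact B) (Bi : B `<=` im i).

Lemma compact_in_rowbox : exists N, B `<=` rowbox m N.
Proof.
have [N [_ h]] := compact_bounded cB; exists (`|N| + 1) => x Bx j.
apply: le_trans (h (`|N| + 1) _ x Bx); last by rewrite ltr_pwDr// ler_norm.
rewrite [leRHS]mx_normrE.
exact: (@le_bigmax _ _ _ 0 (fun ij : 'I_1 * 'I_m => `|x ij.1 ij.2|) (0, j)).
Qed.

Let closedB : closed B. Proof. by apply: compact_closed => //; exact: norm_hausdorff. Qed.
Let openB : open (~` B) := closed_openC closedB.

Lemma glue_Ck n (U : set 'rV[R]_m) (u : 'rV[R]_m -> R) : open U -> B `<=` U ->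
  Ck n U u -> (forall x, ~ B x -> u x = 0) -> Ck n setT u.
Proof.
move=> oU BU Cu u0; apply: Ck_local => x _; have [Bx|nBx] := pselect (B x).
  by exists U; split; [exact: oU|exact: BU|exact: Cu].
exists (~` B); split; [exact: openB|exact: nBx|].
by apply: (Ck_ext openB _ (Ck_cst n _ (0 : R))) => y nB; rewrite u0.
Qed.

(** The bridge for functions supported in a compact part of one chart; integrability comes from the
    density being continuous, hence bounded, on that part. *)
Lemma chart_function (u : 'rV[R]_m -> R) (a : M -> R) : Ck 0 setT u ->
  (forall x, ~ B x -> u x = 0) ->
  (forall p, dom i p -> a p = u (chart i p)) -> (forall p, ~ dom i p -> a p = 0) ->
  mu.-integrable setT (EFin \o a) /\
  \int[mu]_p a p = \int[lambda R m]_x (u x * (\1_(im i) x * volume_density g i x)).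
Proof.
move=> Cu u0 ad an.
have cu : continuous u by move=> x; exact: (Ck_continuous Cu I).
have mu_u := continuous_measurable_row cu.
have [N BN] := compact_in_rowbox.
have aE : a = (fun p => \1_(dom i) p * u (chart i p)).
  apply/funext => p; rewrite indicE; have [dp|ndp] := pselect (dom i p).
    by rewrite ad// mem_set// mul1r.
  by rewrite an//; case: (boolP (p \in _)) => [/set_mem//|_]; rewrite mul0r.
have ma : measurable_fun setT (a : borel M -> measurableTypeR R).
  rewrite aE; apply: (@measurable_open_restrict R M _ (borel M) id
    (@open_measurable_borel R m M) (dom i) (fun p => u (chart i p))).
    exact: dom_open.
  by move=> p dp; exact: (continuous_comp (chart_continuous dp) (cu _)).
have restr (b : R -> R) : b 0 = 0 ->
    (\int[mu]_p (b (a p))%:E = \int[mu]_(p in dom i) (b (u (chart i p)))%:E)%E.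
  move=> b0; rewrite [RHS]integral_mkcond; apply: eq_integral => p _.
  rewrite patchE; have [dp|ndp] := pselect (dom i p).
    by rewrite mem_set// ad.
  by rewrite an// b0; case: (boolP (p \in _)) => [/set_mem//|_].
split; last first.
  rewrite /Rintegral (restr id)//; congr fine.
  exact: (chart_integral gm vol i mu_u).
apply/integrableP; split; first exact/measurable_EFinP.
have e : (\int[mu]_p `|(EFin \o a) p| = \int[mu]_(p in dom i) `|u (chart i p)|%:E)%E.
  exact: (restr (fun z : R => `|z|) (normr0 _)).
rewrite e.
have mnu : measurable_fun setT ((fun x => `|u x|) : rowB R m -> measurableTypeR R).
  apply: continuous_measurable_row => x.
  exact: (continuous_comp (cu x) (@norm_continuous _ R _)).
rewrite (chart_integral gm vol i mnu).
have Cw : Ck 0 (im i) (volume_density g i).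
  by split=> // x ix; exact: (continuous_density gm ix).
have oi := @im_open _ _ M i.
pose v x := u x * (\1_(im i) x * volume_density g i x).
have Cv : Ck 0 setT v.
  apply: (glue_Ck oi Bi); last by move=> x /u0; rewrite /v => ->; rewrite mul0r.
  apply: (Ck_ext oi _ (CkM oi (Ck_sub (fun _ _ => I) Cu) Cw)) => x ix.
  by rewrite /v indicE mem_set// mul1r.
have cv : continuous v by move=> x; exact: (Ck_continuous Cv I).
have v0 x : ~ rowbox m N x -> v x = 0.
  by move=> nx; rewrite /v u0 ?mul0r// => /BN.
have [b hb] := box_bounded cv v0.
have /integrableP[_] := box_integrable (continuous_measurable_row cv) hb v0.
congr (_ < _)%E; apply: eq_integral => x _; rewrite /= /v normrM; congr (_ * _)%:E.
by rewrite ger0_norm// density_ge0.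
Qed.
End ChartFunction.

(** * Variation of the action *)

Section MetricVariation.
Variables (R : realType) (m : nat) (M : manifold R m).
Variables (D1 D2 : field M 'M[R]_m) (gt : R -> field M 'M[R]_m) (eps : R).
Variables (mu : R -> {measure set (borel M) -> \bar R}).
Variables (f : field M 'M[R]_m) (xi : field M 'rV[R]_m) (eta : field M 'cV[R]_m).
Let Gt i (q : (R * 'rV[R]_m)%type) : 'M[R]_m := gt q.1 i q.2.
Hypothesis eps0 : 0 < eps.
Hypothesis gtm : forall t, `|t| < eps -> is_metric (gt t).
Hypothesis gts : forall i, smooth_on (tube eps (@im _ _ M i)) (Gt i).
Hypothesis orth : forall t, `|t| < eps -> orthogonal_distr (gt t) D1 D2.
Hypothesis vol : forall t, `|t| < eps -> is_riemannian_volume (gt t) (mu t).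
Hypotheses (hD1 : is_distribution D1) (hD2 : is_distribution D2).
Hypothesis kc : forall i, kc_chart (@im _ _ M i) (fun x => Gt i (0, x)) (f i) (xi i) (eta i)
  (proj0 (Gt i) (D1 i)) (proj0 (Gt i) (D2 i)).

Let oim i : open (@im _ _ M i) := @im_open _ _ M i.
Let te0 : `|0 : R| < eps. Proof. by rewrite normr0. Qed.
Let GtC i : Ck 3 (tube eps (@im _ _ M i)) (Gt i) := smooth_Ck 3 (@gts i).
Let Gtpos i q : tube eps (@im _ _ M i) q -> posdef (Gt i q).
Proof. by case: q => t x [/= te ix]; exact: (metric_posdef (gtm te) ix). Qed.

Let span D i : is_distribution D -> smooth_span (@im _ _ M i) (D i).
Proof. by move=> [_ [k h]]; exists k => x; exact: h. Qed.

Let S t p := mutual_curvature (gt t) D1 D2 p.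
Let ch i := chart_curvature (Gt i) (D1 i) (D2 i).
Let vf i := variation_vector (Gt i) (D1 i) (D2 i).

Section Overlap.
Variables i j : idx M.
Definition overlap := [set x | im i x /\ dom j (param i x)].

Lemma open_overlap : open overlap.
Proof.
rewrite openE => x [ix dx]; apply: filterI; first exact: open_nbhs_nbhs.
exact: (param_continuous ix (open_nbhs_nbhs (conj (@dom_open _ _ M j) dx))).
Qed.

Lemma transition_im x : overlap x -> im j (transition i j x).
Proof. by move=> [ix dx]; exact: chart_im. Qed.

Let sub : overlap `<=` im i. Proof. by move=> x []. Qed.
Let phiC n : Ck n overlap (transition i j) := smooth_Ck n (@transition_smooth _ _ M i j).
Let GC : Ck 3 (tube eps overlap) (Gt i).
Proof. by apply: (Ck_sub _ (@GtC i)) => q [? /sub]. Qed.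
Let Gp q : tube eps overlap q -> posdef (Gt i q).
Proof. by move=> [? /sub ?]; exact: Gtpos. Qed.
Let GJ t x : `|t| < eps -> overlap x -> Gt i (t, x) =
  jacobian (transition i j) x *m Gt j (t, transition i j x) *m (jacobian (transition i j) x)^T.
Proof. by move=> te [ix dx]; have [_ h _ _] := gtm te; exact: h. Qed.
Let DJ D x : is_distribution D -> overlap x ->
  (D j (transition i j x) == D i x *m jacobian (transition i j) x)%MS.
Proof. by move=> [h _] [ix dx]; exact: h. Qed.

Lemma curvature_overlap t x : `|t| < eps -> overlap x -> ch i (t, x) = ch j (t, transition i j x).
Proof.
move=> te ox.
exact: (chart_curvature_transition eps0 open_overlap (@oim j) (phiC 4) transition_im GC (@GtC j) Gp
  (@Gtpos j) GJ (fun y => DJ hD1) (fun y => DJ hD2) te ox).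
Qed.

Lemma vector_overlap x : overlap x ->
  vf i x *m jacobian (transition i j) x = vf j (transition i j x).
Proof.
move=> ox.
exact: (variation_vector_transition eps0 open_overlap (@oim j) (phiC 4) transition_im GC (@GtC j) Gp
  (@Gtpos j) GJ (fun y => DJ hD1) (fun y => DJ hD2) ox).
Qed.

(** The chain rule for the transition map and the transformation law of the field match, so the
    derivative along the field is a function on the manifold. *)
Lemma directional_transition (phi : M -> R) x : Ck 1 (im j) (phi \o param j) -> overlap x ->
  'D_(vf i x) (phi \o param i) x =
  'D_(vf j (transition i j x)) (phi \o param j) (transition i j x).
Proof.
move=> Cphi ox; have [ix dx] := ox.
have dT := Ck_differentiable open_overlap (phiC 1) ox.
have [_ e] := is_derive_comp_row (vf i x) (@oim j) Cphi (transition_im ox) dT.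
rewrite (derive_jacobian open_overlap (phiC 4) _ ox) (vector_overlap ox) in e.
apply: (etrans _ e); apply: (eq_on_derive _ open_overlap _ ox) => y [iy dy].
by rewrite /= /transition /= chartK.
Qed.
End Overlap.

Definition C1_function (phi : M -> R) := forall i, Ck 1 (@im _ _ M i) (phi \o param i).
Definition along_vf (phi : M -> R) (p : M) : R :=
  let i := chart_at p in 'D_(vf i (chart i p)) (phi \o param i) (chart i p).

Let dom_at (p : M) : dom (chart_at p) p.
Proof. by rewrite /chart_at; case: cid. Qed.

Lemma mutual_curvature_chart t p i : `|t| < eps -> dom i p ->
  S t p = ch i (t, chart i p).
Proof.
move=> te dp; have ix := chart_im dp.
have o : overlap i (chart_at p) (chart i p) by split=> //; rewrite chartK.
by rewrite (curvature_overlap te o) /transition /= chartK.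
Qed.

Lemma along_vf_chart phi p i : C1_function phi -> dom i p ->
  along_vf phi p = 'D_(vf i (chart i p)) (phi \o param i) (chart i p).
Proof.
move=> Cphi dp; have ix := chart_im dp.
have o : overlap i (chart_at p) (chart i p) by split=> //; rewrite chartK.
by rewrite (directional_transition (Cphi _) o) /transition /= chartK.
Qed.

Lemma along_vfD phi psi p : C1_function phi -> C1_function psi ->
  along_vf (phi \+ psi) p = along_vf phi p + along_vf psi p.
Proof.
move=> Cphi Cpsi; have ix := chart_im (dom_at p).
pose i := chart_at p; pose v := vf i (chart i p).
have d1 := derivableP (Ck_derivable (v := v) (Cphi i) ix).
have d2 := derivableP (Ck_derivable (v := v) (Cpsi i) ix).
have [_ e] := is_deriveD d1 d2.
exact: e.
Qed.

Lemma mutual_curvature_static p : S 0 p = 0.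
Proof.
have ix := chart_im (dom_at p).
exact: (chart_curvature_static (@oim _) (@GtC _) (@Gtpos _) eps0 (@kc _) ix).
Qed.

Let bounded_on_compact (V : normedModType R) (C : set V) (a : V -> R) : compact C ->
  (forall x, C x -> {for x, continuous a}) -> exists b, 0 <= b /\ forall x, C x -> `|a x| <= b.
Proof.
move=> cC ca; have : bounded_set (a @` C).
  apply: compact_bounded; apply: continuous_compact cC.
  apply: continuous_in_subspaceT => x /set_mem; exact: ca.
move=> [b [_ h]]; exists (`|b| + 1); split=> [|x Cx]; first by rewrite addr_ge0.
by apply: (h (`|b| + 1)) => /=; [rewrite ltr_pwDr// ler_norm|exists x].
Qed.

(** The divergence theorem in weak form, with weight [phi]. Integrability is part of it so that the
    formula is additive in [phi]; the bound [eps / 2] leaves a compact time interval for uniform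
    estimates. *)
Definition first_variation_formula (phi : M -> R) : Prop :=
  [/\ C1_function phi,
      forall t, `|t| < eps / 2 -> (mu t).-integrable setT (EFin \o (fun p => phi p * S t p)),
      (mu 0).-integrable setT (EFin \o along_vf phi) &
      is_derive (0 : R) (1 : R) (fun t => \int[mu t]_p (phi p * S t p))
        (- \int[mu 0]_p along_vf phi p)].

Lemma first_variation_add phi psi : first_variation_formula phi ->
  first_variation_formula psi -> first_variation_formula (phi \+ psi).
Proof.
move=> [Cp ip vp dp] [Cq iq vq dq].
have E t : (fun p => (phi \+ psi) p * S t p) = (fun p => phi p * S t p + psi p * S t p).
  by apply/funext => p; rewrite /= mulrDl.
have Ev : along_vf (phi \+ psi) = (fun p => along_vf phi p + along_vf psi p).
  by apply/funext => p; exact: along_vfD.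
have e2 : 0 < eps / 2 by rewrite divr_gt0.
split.
- by move=> i; exact: (CkD (@oim i) (Cp i) (Cq i)).
- move=> t te; rewrite E.
  exact: (@integrableD _ _ _ (mu t) _ measurableT _ _ (ip t te) (iq t te)).
- by rewrite Ev; exact: (@integrableD _ _ _ (mu 0) _ measurableT _ _ vp vq).
rewrite Ev RintegralD// opprD; apply: near_eq_is_derive (is_deriveD dp dq).
near=> t; have te : `|t| < eps / 2 by near: t; exact: (nbhs0_lt (V := R^o) e2).
by rewrite E; apply/esym/RintegralD => //; [exact: ip|exact: iq].
Unshelve. all: end_near. Qed.

Section Localized.
Variables (i : idx M) (B : set 'rV[R]_m) (phi : M -> R).
Hypotheses (cB : compact B) (Bi : B `<=` im i) (Cphi : C1_function phi).
Hypothesis phi0 : forall p, ~ (dom i p /\ B (chart i p)) -> phi p = 0.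

Let h x := \1_(im i) x * phi (param i x).

Let hE x : im i x -> h x = phi (param i x).
Proof. by move=> ix; rewrite /h indicE mem_set// mul1r. Qed.

Let h0 x : ~ B x -> h x = 0.
Proof.
move=> nB; have [ix|nix] := pselect (im i x).
  by rewrite hE// phi0// => -[_]; rewrite paramK.
by rewrite /h indicE; case: (boolP (x \in _)) => [/set_mem//|_]; rewrite mul0r.
Qed.

Let Ch : Ck 1 setT h.
Proof.
apply: (glue_Ck cB (@oim i) Bi) h0.
by apply: (Ck_ext (@oim i) _ (Cphi i)) => x ix; rewrite hE.
Qed.

Let support := param i @` B.
Let closed_support : closed support.
Proof.
apply: compact_closed; first exact: (@carrier_hausdorff _ _ M).
apply: continuous_compact cB; apply: continuous_in_subspaceT => x /set_mem/Bi.
exact: param_continuous.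
Qed.

Let off_support p : ~ support p -> phi p = 0.
Proof.
move=> ns; apply: phi0 => -[dp Bp]; apply: ns; exists (chart i p) => //.
exact: chartK.
Qed.

Let along0 p : ~ support p -> along_vf phi p = 0.
Proof.
move=> ns; have ix := chart_im (dom_at p); set a := chart_at p in ix *.
pose O := [set x | im a x /\ (~` support) (param a x)].
have oO : open O.
  rewrite openE => x [iax nsx]; apply: filterI; first exact: open_nbhs_nbhs.
  exact: (param_continuous iax (open_nbhs_nbhs (conj (closed_openC closed_support) nsx))).
have Oy : O (chart a p) by split=> //; rewrite /= chartK//; exact: dom_at.
apply: (etrans _ (derive_cst (0 : R) (chart a p) (vf a (chart a p)))).
by apply: (eq_on_derive _ oO _ Oy) => x [_ nsx]; exact: off_support.
Qed.

Let F0 q := ch i q * Num.sqrt (\det (Gt i q)).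
Let Cch : Ck 1 (tube eps (im i)) (ch i) :=
  Ck_chart_curvature (@oim i) (@GtC i) (@Gtpos i) (@span D1 i hD1) (@span D2 i hD2).
Let oT : open (tube eps (im i)) := tube_open (eps := eps) (@oim i).
Let CF0 : Ck 1 (tube eps (im i)) F0.
Proof.
apply: (CkM oT Cch); apply: (Ck1_sqrt oT) => [q /Gtpos/posdef_det//|].
exact: (Ck_det oT (Ck_le (isT : (1 <= 3)%N) (@GtC i))).
Qed.

Let F t x := h x * F0 (t, x).
Let glue_t n (a : (R * 'rV[R]_m)%type -> R) t : `|t| < eps -> (n <= 1)%N ->
  Ck n (tube eps (im i)) a -> Ck n setT (fun x => h x * a (t, x)).
Proof.
move=> te n1 Ca; apply: (glue_Ck cB (@oim i) Bi) => [|x /h0 ->]; last by rewrite mul0r.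
exact: (CkM (@oim i) (Ck_sub (fun _ _ => I) (Ck_le n1 Ch)) (Ck_slice (@oim i) te Ca)).
Qed.

Let transfer t : `|t| < eps ->
  (mu t).-integrable setT (EFin \o (fun p => phi p * S t p)) /\
  \int[mu t]_p (phi p * S t p) = \int[lambda R m]_x F t x.
Proof.
move=> te; have Cu := glue_t te (isT : (0 <= 1)%N) (Ck_pred Cch).
have [|p dp|p ndp|I1 ->] := @chart_function R m M (gt t) (mu t) (gtm te) (vol te) i B cB Bi
  (fun x => h x * ch i (t, x)) (fun p => phi p * S t p) Cu.
- by move=> x /h0 ->; rewrite mul0r.
- by rewrite hE ?chartK//; [rewrite (mutual_curvature_chart te dp)|exact: chart_im].
- by rewrite phi0 ?mul0r// => -[].
split=> //; apply: eq_Rintegral => x _.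
have [ix|nix] := pselect (im i x); last by rewrite /F h0 ?mul0r// => /Bi.
by rewrite indicE mem_set// mul1r /F /F0 mulrA.
Qed.

Let u' x := 'D_(vf i x) h x.
Let transfer_vf : (mu 0).-integrable setT (EFin \o along_vf phi) /\
  \int[mu 0]_p along_vf phi p =
  \int[lambda R m]_x (u' x * (\1_(im i) x * volume_density (gt 0) i x)).
Proof.
have openB : open (~` B) := closed_openC (compact_closed (@norm_hausdorff _ _) cB).
have u0 x : ~ B x -> u' x = 0.
  move=> nB; apply: (etrans _ (derive_cst (0 : R) x (vf i x))).
  exact: (eq_on_derive _ openB h0 nB).
have Cv : Ck 1 (im i) (vf i) :=
  Ck_variation_vector (@oim i) (@GtC i) (@Gtpos i) (@span D2 i hD2) eps0 (@kc i).
have Cu : Ck 0 setT u'.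
  apply: (glue_Ck cB (@oim i) Bi) u0.
  have C k : Ck 0 (im i) (fun x => vf i x 0 k * 'D_(delta_mx 0 k : 'rV[R]_m) h x).
    have Cd := Ck_sub (@subsetT _ (@im _ _ M i)) (Ck_derive (delta_mx 0 k : 'rV[R]_m) Ch).
    exact: (CkM (@oim i) (Ck_entry 0 k (@oim i) (Ck_pred Cv)) Cd).
  have Cs : Ck 0 (im i) (fun x => \sum_k vf i x 0 k * 'D_(delta_mx 0 k : 'rV[R]_m) h x).
    by apply: (Ck_sum _ (@oim i)) => k _; exact: C.
  apply: (Ck_ext (@oim i) _ Cs) => x ix.
  have dh : differentiable h x := Ck_differentiable_real openT Ch I.
  rewrite /u' (deriveE _ dh) [X in _ = 'd _ _ X]row_sum_delta linear_sum.
  apply: eq_bigr => k _.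
  by rewrite linearZ /= (deriveE _ dh).
apply: (chart_function (gtm te0) (vol te0) cB Bi Cu u0) => [p dp|p ndp].
  rewrite (along_vf_chart Cphi dp); apply/esym.
  by apply: (eq_on_derive _ (@oim i) _ (chart_im dp)) => y iy; rewrite hE.
by apply: along0 => -[x Bx xp]; apply: ndp; rewrite -xp; apply: param_dom; exact: Bi.
Qed.

Let deriveF t x : `|t| < eps ->
  is_derive t (1 : R) (F ^~ x) (h x * 'D_(1, 0) F0 (t, x)).
Proof.
move=> te; have [ix|nix] := pselect (im i x).
  have d := @is_derive_slice_time _ _ _ F0 t x
    (Ck_derivable CF0 (conj te ix : tube eps (im i) (t, x))).
  exact: (is_deriveZ (h x) d).
have hx : h x = 0 by apply: h0 => /Bi.
rewrite hx mul0r (_ : F ^~ x = cst 0); first exact: is_derive_cst.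
by apply/funext => s; rewrite /F hx mul0r.
Qed.

(** For a weight supported in one chart the integral becomes a Lebesgue integral over a box,
    differentiated under the integral sign; [derive_chart_curvature] and [chart_divergence] then
    apply in that chart. *)
Lemma localized_variation : first_variation_formula phi.
Proof.
have e2 : 0 < eps / 2 by rewrite divr_gt0.
have half (t : R) : `|t| <= eps / 2 -> `|t| < eps.
  by move=> te; apply: le_lt_trans te _; rewrite ltr_pdivrMr// ltr_pMr// ltr1n.
have [N BN] := compact_in_rowbox cB.
have F_0 t x : ~ rowbox m N x -> F t x = 0.
  by move=> nx; rewrite /F h0 ?mul0r// => /BN.
have ch_ : continuous h by move=> x; exact: (Ck_continuous Ch I).
have hN x : ~ rowbox m N x -> h x = 0 by move=> nx; apply: h0 => /BN.
have [bh hbh] := box_bounded ch_ hN.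
have bh0 : 0 <= bh := le_trans (normr_ge0 _) (hbh 0).
(* A compact subset of the tube, on which the integrand without its weight and its time derivative
   are bounded uniformly. *)
pose C : set (R * 'rV[R]_m)%type := [set` `[- (eps / 2), eps / 2]] `*` B.
have cC : compact C by apply: compact_setX => //; exact: segment_compact.
have CT q : C q -> tube eps (im i) q.
  move=> [/=]; rewrite in_itv /= -ler_norml => /half te /Bi ib; split=> //.
have [b0 [b00 hb0]] := bounded_on_compact cC (fun q Cq => Ck_continuous CF0 (CT q Cq)).
have [b1 [b10 hb1]] := bounded_on_compact cC
  (fun q Cq => Ck_continuous (Ck_derive ((1, 0) : (R * 'rV[R]_m)%type) CF0) (CT q Cq)).
have inC t x : `|t| < eps / 2 -> B x -> C (t, x).
  by move=> te Bx; split=> //=; rewrite in_itv /= -ler_norml ltW.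
have bound (a : (R * 'rV[R]_m)%type -> R) b : 0 <= b -> (forall q, C q -> `|a q| <= b) ->
    b <= b0 + b1 -> forall t x, `|t| < eps / 2 -> `|h x * a (t, x)| <= bh * (b0 + b1).
  move=> b_0 hb bb t x te; have [Bx|nBx] := pselect (B x); last first.
    by rewrite h0// mul0r normr0 mulr_ge0// addr_ge0.
  rewrite normrM ler_pM//; apply: le_trans bb; apply: hb; exact: inC.
have mF t : `|t| < eps / 2 -> measurable_fun setT (F t : rowB R m -> measurableTypeR R).
  move=> /ltW/half te; apply: continuous_measurable_row => x.
  exact: (Ck_continuous (glue_t te (isT : (0 <= 1)%N) (Ck_pred CF0)) I).
have D t x : `|t| < eps / 2 -> derivable (F ^~ x) t 1.
  by move=> /ltW/half te; have [] := deriveF x te.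
have DB t x : `|t| < eps / 2 -> `|'D_1 (F ^~ x) t| <= bh * (b0 + b1).
  move=> te; have [_ ->] := deriveF x (half t (ltW te)).
  by apply: (bound _ b1 b10 hb1) => //; rewrite lerDr.
have FB : forall t x, `|t| < eps / 2 -> `|F t x| <= bh * (b0 + b1).
  by apply: (bound _ b0 b00 hb0); rewrite lerDl.
have main := derive_under_box e2 mF FB (fun t x _ => F_0 t x) D DB.
have [I2 E2] := transfer_vf.
split=> //; first by move=> t /ltW/half te; have [] := transfer te.
apply: near_eq_is_derive (is_derive_eq main _).
  near=> t; have te : `|t| < eps / 2 by near: t; exact: (nbhs0_lt (V := R^o) e2).
  by have [_ ->] := transfer (half t (ltW te)).
have G03 := Ck_slice (@oim i) te0 (@GtC i).
have Gp0 x : im i x -> posdef (Gt i (0, x)) by move=> ix; exact: Gtpos.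
have Cv : Ck 1 (im i) (vf i) :=
  Ck_variation_vector (@oim i) (@GtC i) (@Gtpos i) (@span D2 i hD2) eps0 (@kc i).
have cl : closed B := compact_closed (@norm_hausdorff _ _) cB.
have div := chart_divergence (@oim i) G03 Gp0 Cv Ch cl Bi BN h0.
rewrite E2; apply: (etrans _ div); apply: eq_Rintegral => x _.
have [_ ->] := deriveF x te0.
have [Bx|nBx] := pselect (B x); last by rewrite h0// !mul0r.
have ix := Bi Bx; rewrite indicE mem_set// mul1r -mulrA; congr (_ * _).
have T0 : tube eps (im i) (0, x) by [].
have orthT q : tube eps (im i) q -> D1 i q.2 *m Gt i q *m (D2 i q.2)^T = 0.
  by move=> [te iq]; exact: orth.
have dS := derive_chart_curvature (@oim i) (@GtC i) (@Gtpos i) (@span D1 i hD1) (@span D2 i hD2)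
  eps0 orthT (@kc i) ix.
have Cw : Ck 1 (tube eps (im i)) (fun q => Num.sqrt (\det (Gt i q))).
  apply: (Ck1_sqrt oT) => [q /Gtpos/posdef_det//|].
  exact: (Ck_det oT (Ck_le (isT : (1 <= 3)%N) (@GtC i))).
have [_ e] := is_derive_mul (Ck_derivable (v := ((1, 0) : (R * 'rV[R]_m)%type)) Cch T0)
  (Ck_derivable (v := ((1, 0) : (R * 'rV[R]_m)%type)) Cw T0).
have S0 : ch i (0, x) = 0 := chart_curvature_static (@oim i) (@GtC i) (@Gtpos i) eps0 (@kc i) ix.
apply: (etrans e); rewrite S0 mul0r addr0; congr (_ * _).
exact: dS.
Unshelve. all: end_near. Qed.
End Localized.

(** A bump is read in the chart at [p] and extended by 0. Radius half that of a ball inside the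
    chart image keeps the closed support compact and inside. *)
Lemma exists_bump (p : M) : exists (psi : M -> R) (O : set M) (B : set 'rV[R]_m),
  [/\ C1_function psi, open O, O p & forall q, O q -> psi q = 1] /\
  [/\ compact B, B `<=` im (chart_at p) &
      forall q, ~ (dom (chart_at p) q /\ B (chart (chart_at p) q)) -> psi q = 0].
Proof.
set i := chart_at p; set c := chart i p.
have ic : im i c := chart_im (dom_at p).
have /nbhs_ballP[e /= e0 eB] : nbhs c (im i) by exact: open_nbhs_nbhs.
pose r := e / 2; have r0 : 0 < r by rewrite divr_gt0.
have Bi : bump_ball c r `<=` im i.
  move=> x bx; apply: eB; split=> // a j; rewrite !ord1 /ball /= distrC.
  by apply: le_lt_trans (bump_ball_coord r0 j bx) _; rewrite /r ltr_pdivrMr// ltr_pMr// ltr1n.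
have cB := @compact_bump_ball R m c r r0.
pose psi (q : M) := \1_(dom i) q * bump c r (chart i q).
have pin q : dom i q -> psi q = bump c r (chart i q).
  by move=> dq; rewrite /psi indicE mem_set// mul1r.
have pout q : ~ (dom i q /\ bump_ball c r (chart i q)) -> psi q = 0.
  move=> nq; have [dq|ndq] := pselect (dom i q).
    by rewrite pin// bump_out// => h; apply: nq.
  by rewrite /psi indicE; case: (boolP (q \in _)) => [/set_mem//|_]; rewrite mul0r.
pose O := [set q : M | dom i q /\ bump_core c r (chart i q)].
exists psi, O, (bump_ball c r); split; last by split.
split; last first.
- by move=> q [dq bq]; rewrite pin// bump_in.
- by split; [exact: dom_at|exact: bump_core_center].
- rewrite openE => q [dq bq]; apply: filterI.
    by apply: open_nbhs_nbhs; split=> //; exact: dom_open.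
  exact: (chart_continuous dq (open_nbhs_nbhs (conj (@open_bump_core R m c r) bq))).
(* In a chart that leaves the domain, [psi] is locally 0: its support is compact, hence closed as
   the manifold is Hausdorff. *)
have cs : closed (param i @` bump_ball c r).
  apply: compact_closed; first exact: (@carrier_hausdorff _ _ M).
  apply: continuous_compact cB; apply: continuous_in_subspaceT => x /set_mem/Bi.
  exact: param_continuous.
move=> j; apply: Ck_local => x jx; have [dq|ndq] := pselect (dom i (param j x)).
  exists (overlap j i); split; [exact: open_overlap|by split|].
  have CT := smooth_Ck 1 (@transition_smooth _ _ M j i).
  have C := Ck1_comp_row (@open_overlap j i) openT CT (@Ck_bump R m c r) (fun _ _ => I).
  by apply: (Ck_ext (@open_overlap j i) _ C) => y [jy dy]; rewrite /= pin.
exists [set y | im j y /\ (~` (param i @` bump_ball c r)) (param j y)].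
have ns : (~` (param i @` bump_ball c r)) (param j x).
  by move=> [y /Bi iy yx]; apply: ndq; rewrite -yx; exact: param_dom.
have oO : open [set y | im j y /\ (~` (param i @` bump_ball c r)) (param j y)].
  rewrite openE => y [jy nsy]; apply: filterI; first exact: open_nbhs_nbhs.
  exact: (param_continuous jy (open_nbhs_nbhs (conj (closed_openC cs) nsy))).
split; [exact: oO|by split|].
apply: (Ck_ext oO _ (Ck_cst 1 _ (0 : R))) => y [jy nsy] /=.
rewrite pout// => -[dy by_]; apply: nsy; exists (chart i (param j y)) => //.
exact: chartK.
Qed.

(* [1 - \prod_p (1 - psi p)] is [1] where some [psi p] is, and expands into
   summands [psi p * chi] with [psi p] supported in one chart; this replaces
   a normalized partition of unity. *)
Lemma partition_variation (s : seq M) (psi : M -> M -> R) (chi : M -> R) :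
  (forall p, C1_function (psi p) /\ exists B : set 'rV[R]_m,
    [/\ compact B, B `<=` im (chart_at p) &
      forall q, ~ (dom (chart_at p) q /\ B (chart (chart_at p) q)) -> psi p q = 0]) ->
  C1_function chi ->
  first_variation_formula (fun q => chi q * (1 - \prod_(p <- s) (1 - psi p q))).
Proof.
move=> hpsi; elim: s chi => [|p s IH] chi Cchi.
  have C0 : C1_function (fun=> 0 : R) by move=> i; exact: (Ck_cst 1 _ (0 : R)).
  rewrite (_ : (fun q => _) = (fun=> 0)).
    (* The empty product gives the zero weight, supported in the empty part of any chart. *)
    apply: (@localized_variation (chart_at (point : M)) set0) => //; exact: compact0.
  by apply/funext => q; rewrite big_nil subrr mulr0.
have [Cp [B [cB Bi psi0]]] := hpsi p.
have Cchi' : C1_function (fun q => chi q * (1 - psi p q)).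
  by move=> i; exact: (CkM (@oim i) (Cchi i) (CkB (@oim i) (Ck_cst 1 _ (1 : R)) (Cp i))).
have L : first_variation_formula (fun q => chi q * psi p q).
  apply: (localized_variation cB Bi) => [i|q nq]; first exact: (CkM (@oim i) (Cchi i) (Cp i)).
  by rewrite psi0// mulr0.
have := first_variation_add L (IH _ Cchi').
congr first_variation_formula; apply/funext => q; rewrite /= big_cons.
move: (\prod_(_ <- _) _) (psi p q) (chi q) => P a b; ring.
Qed.

Section Conclusion.
Variables (Omega K : set M).
Hypotheses (cK : compact K) (KO : K `<=` Omega).
Hypothesis static : forall t i x, `|t| < eps -> im i x -> ~ K (param i x) ->
  gt t i x = gt 0 i x.

Let closedK : closed K.
Proof. by apply: compact_closed => //; exact: (@carrier_hausdorff _ _ M). Qed.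

Let off i := [set x | im i x /\ (~` K) (param i x)].
Let open_off i : open (off i).
Proof.
rewrite openE => x [ix nK]; apply: filterI; first exact: open_nbhs_nbhs.
exact: (param_continuous ix (open_nbhs_nbhs (conj (closed_openC closedK) nK))).
Qed.

Let Gam_static t i x u : `|t| < eps -> off i x ->
  Gam_family (Gt i) u (t, x) = Gam_family (Gt i) u (0, x).
Proof.
move=> te ox; have E y : off i y -> Gt i (t, y) = Gt i (0, y).
  by move=> [iy nK]; exact: static.
exact: (@Gam_ext R m (off i) (fun y => Gt i (t, y)) (fun y => Gt i (0, y)) (@open_off i) E x u ox).
Qed.

(** Off the closed [K] the metric is unchanged on an open set, so its curvature is that of time 0,
    where the mutual curvature vanishes. *)
Let curvature_static t p : `|t| < eps -> ~ K p -> S t p = 0.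
Proof.
move=> te nK; rewrite -(mutual_curvature_static p).
set i := chart_at p; set x := chart i p.
have ox : off i x by split; [exact: chart_im (dom_at p)|rewrite /= chartK//; exact: dom_at].
have ix := ox.1.
rewrite (mutual_curvature_chart te (dom_at p)) (mutual_curvature_chart te0 (dom_at p)).
rewrite -/i -/x /ch (chart_curvatureE (@oim i) (@GtC i) (@Gtpos i) _ _ (conj te ix : tube eps (im i) (t, x))).
rewrite (chart_curvatureE (@oim i) (@GtC i) (@Gtpos i) _ _ (conj te0 ix : tube eps (im i) (0, x))).
have g0 : Gt i (t, x) = Gt i (0, x) by apply: static => //; case: ox.
have RE u v : Rm_family (Gt i) u v (t, x) = Rm_family (Gt i) u v (0, x).
  have e a b : 'D_a (fun y => Gam_family (Gt i) b (t, y)) x = 'D_a (fun y => Gam_family (Gt i) b (0, y)) x.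
    by apply: (eq_on_derive _ (@open_off i) _ ox) => y oy; exact: Gam_static.
  have ga := Gam_static u te ox; have gb := Gam_static v te ox.
  apply: (etrans (f_equal2 (fun A B => A - B + Gam_family (Gt i) v (t, x) *m Gam_family (Gt i) u (t, x)
    - Gam_family (Gt i) u (t, x) *m Gam_family (Gt i) v (t, x)) (e u v) (e v u))).
  by rewrite ga gb.
by apply: eq_bigr => r _; apply: eq_bigr => a _; rewrite RE g0.
Qed.

Let vf_static i x : off i x -> vf i x = 0.
Proof.
move=> ox; have ix := ox.1.
have P0 r : dGam_dt (Gt i) r x = 0.
  have [_ e] := @is_derive_slice_time _ _ _ (Gam_family (Gt i) (delta_mx 0 r)) 0 x
    (Ck_derivable (Ck_Gam_family (@oim i) (@GtC i) (@Gtpos i) (delta_mx 0 r))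
      (conj te0 ix : tube eps (im i) (0, x))).
  apply: (etrans (esym e)).
  apply: (etrans _ (derive_cst (Gam_family (Gt i) (delta_mx 0 r) (0, x)) (0 : R) (1 : R))).
  apply: near_eq_derive; near=> t.
  by apply: Gam_static => //; near: t; exact: (nbhs0_lt (V := R^o) eps0).
apply/rowP => k; rewrite mxE [RHS]mxE big1// => r _.
by rewrite P0 mulmx0 mul0mx !mxE subrr.
Unshelve. all: end_near. Qed.

(** Finitely many bumps cover [K], and the resulting weight [Phi] is 1 on a neighbourhood [W] of
    [K]. As the mutual curvature vanishes off [K] at all small times, weighting by [Phi] and
    restricting to [Omega] give the same integral. *)
Lemma action_critical :
  is_derive (0 : R) (1 : R) (fun t => action (mu t) Omega (gt t) D1 D2) 0.
Proof.
have [F hF] := choice (fun p => exists_bump p).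
pose psi p := F p.
have [N hN] := choice hF.
have hpsi p : C1_function (psi p) /\ exists B : set 'rV[R]_m,
    [/\ compact B, B `<=` im (chart_at p) &
      forall q, ~ (dom (chart_at p) q /\ B (chart (chart_at p) q)) -> psi p q = 0].
  by have [B [[C _ _ _] hB]] := hN p; split=> //; exists B.
have oN p : open (N p) by have [B [[]]] := hN p.
have Np p : N p p by have [B [[]]] := hN p.
have psi1 p q : N p q -> psi p q = 1 by have [B [[_ _ _ h] _]] := hN p; exact: h.
have [D _ KD] : finite_subset_cover [set: M] N K.
  have := cK; rewrite compact_cover; apply; first by move=> p _; exact: oN.
  move=> p Kp.
  by exists p.
pose s := finmap.enum_fset D.
have C1 : C1_function (fun=> 1 : R) by move=> i; exact: (Ck_cst 1 _ (1 : R)).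
have [_ _ _ H] := partition_variation s hpsi C1.
pose Phi q := 1 * (1 - \prod_(p <- s) (1 - psi p q)).
pose W := \bigcup_(p in [set p | p \in s]) N p.
have oW : open W by apply: bigcup_open => p _.
have KW : K `<=` W by move=> q /KD[p /= pD Nq]; exists p.
have Phi1 q : W q -> Phi q = 1.
  move=> [p /= ps Nq]; rewrite /Phi mul1r (perm_big _ (perm_to_rem ps)) big_cons psi1//.
  by rewrite /= subrr mul0r subr0.
(* Off [K] the vector field is 0 because the Christoffel symbols do not move; on [K] the weight is
   locally constant. *)
have av0 q : along_vf Phi q = 0.
  have iq := chart_im (dom_at q); set i := chart_at q in iq *.
  have [Kq|nKq] := pselect (K q); last first.
    have ox : off i (chart i q) by split=> //=; rewrite chartK//; exact: dom_at.
    by rewrite /along_vf -/i (vf_static ox) derive0.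
  pose U := [set x | im i x /\ W (param i x)].
  have oU : open U.
    rewrite openE => x [ix Wx]; apply: filterI; first exact: open_nbhs_nbhs.
    exact: (param_continuous ix (open_nbhs_nbhs (conj oW Wx))).
  have Ux : U (chart i q) by split=> //; rewrite chartK; [exact: KW|exact: dom_at].
  apply: (etrans _ (derive_cst (1 : R) (chart i q) (vf i (chart i q)))).
  by apply: (eq_on_derive _ oU _ Ux) => x [_ Wx]; exact: Phi1.
have E0 : - (\int[mu 0]_p along_vf Phi p) = 0.
  rewrite (_ : along_vf Phi = cst 0); first by rewrite Rintegral_cst// mul0r oppr0.
  exact/funext.
apply: near_eq_is_derive (is_derive_eq H E0).
near=> t; have te : `|t| < eps by near: t; exact: (nbhs0_lt (V := R^o) eps0).
rewrite /action [RHS]Rintegral_mkcond; congr Rintegral; apply/funext => p.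
rewrite patchE -/(S t p) -/(Phi p); have [Kp|nKp] := pselect (K p).
  by rewrite mem_set; [rewrite Phi1 ?mul1r//; exact: KW|exact: KO].
by rewrite curvature_static// mulr0; case: ifP.
Unshelve. all: end_near. Qed.
End Conclusion.
End MetricVariation.

Theorem proposition15 (R : realType) (n : nat) (M : manifold R (2 * n).+1)
    (f : field M 'M[R]_((2 * n).+1)) (xi : field M 'rV[R]_((2 * n).+1))
    (eta : field M 'cV[R]_((2 * n).+1)) (g : field M 'M[R]_((2 * n).+1))
    (D1 D2 : field M 'M[R]_((2 * n).+1))
    (D3 := fun i x => kermx (f i x))
    (P1 := fun i => orthoproj (g i) (D1 i))
    (P2 := fun i => orthoproj (g i) (D2 i))
    (P3 := fun i => orthoproj (g i) (D3 i))
    (hK : is_K_contact f xi eta g)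
    (hD1 : is_distribution D1) (hD2 : is_distribution D2)
    (hD12 : orthogonal_distr g D1 D2)
    (hD12f : forall i x, im i x -> (D1 i x + D2 i x == f i x)%MS)
    (hD1f : forall i x, im i x -> (D1 i x *m f i x <= D1 i x)%MS)
    (hD2f : forall i x, im i x -> (D2 i x *m f i x <= D2 i x)%MS)
    (hT13 : tensor_eq0 (fun i => Tmix (g i) (P1 i) (P3 i) (P2 i)))
    (hT23 : tensor_eq0 (fun i => Tmix (g i) (P2 i) (P3 i) (P1 i)))
    (hT1 : tensor_eq0 (fun i X Y => papply (P2 i) (Tten (g i) (P1 i) X Y)))
    (hT2 : tensor_eq0 (fun i X Y => papply (P1 i) (Tten (g i) (P2 i) X Y)))
    (hh2 : tensor_eq0 (fun i X Y => papply (P1 i) (hten (g i) (P2 i) X Y)))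
    (hh1 : tensor_eq0 (fun i X Y => papply (P2 i) (hten (g i) (P1 i) X Y))) :
  critical_volume_preserving g D1 D2.
Proof.
have gm := kc_g hK; have [gC _ _ _] := gm.
have [xiC _] := kc_xi hK; have [etaC _] := kc_eta hK.
(* All hypotheses are pointwise or local in the chart, so the structure is extracted chart by
   chart. *)
have kc i : kc_chart (@im _ _ M i) (g i) (f i) (xi i) (eta i) (P1 i) (P2 i).
  have Gp x : im i x -> posdef (g i x) by move=> ix; exact: (metric_posdef gm ix).
  have span D : is_distribution D -> smooth_span (@im _ _ M i) (D i).
    by move=> [_ [k h]]; exists k => x; exact: h.
  have PE D x : im i x -> orthoproj (g i) (D i) x = g i x *m cofr (g i x) (D i x).
    by move=> ix; exact: proj_cofr (Gp x ix).
  apply: (@kc_chartP R _ (im i) (g i) (f i) (xi i) (eta i) (D1 i) (D2 i) (P1 i) (P2 i) (P3 i)).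
  - exact: im_open.
  - exact: gC.
  - exact: xiC.
  - exact: etaC.
  - exact: Gp.
  - by move=> x; exact: (kc_eta_xi hK).
  - by move=> x; exact: (kc_f2 hK).
  - by move=> x; exact: (kc_f_xi hK).
  - by move=> x; exact: (kc_eta_f hK).
  - by move=> x; exact: (kc_compat hK).
  - exact: (kc_contact hK).
  - exact: (kc_killing hK).
  - exact: span.
  - exact: span.
  - by move=> x; exact: hD12.
  - by move=> x; exact: hD12f.
  - by move=> x; exact: hD1f.
  - by move=> x; exact: hD2f.
  - by move=> x; exact: PE.
  - by move=> x; exact: PE.
  - by move=> x; exact: (PE D3).
  - exact: hT13.
  - exact: hT1.
  - exact: hT2.
  - exact: hh2.
  - exact: hh1.
move=> Omega eps gt mu dO [eps0 gtm gts g0 supp] orth vol _.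
(* [K] is the support of the variation. It is compact in both cases of [is_domain]: closed in a
   compact manifold, or contained in the compact closure of [Omega]. *)
set K := closure _ in supp.
have cK : compact K.
  have clK : closed K by exact: closed_closure.
  case: dO => [[cM _]|[_ _ _ cO]]; first exact: subclosed_compact clK cM _.
  by apply: subclosed_compact clK cO _; apply: subset_trans supp _; exact: subset_closure.
have static t i x : `|t| < eps -> im i x -> ~ K (param i x) -> gt t i x = gt 0 i x.
  move=> te ix nK; rewrite g0//; apply/eqP; apply: contrapT => /negP ne.
  by apply: nK; apply: subset_closure; exists t, i; split; [|exact: param_dom|rewrite paramK].
have kc0 i : kc_chart (@im _ _ M i) (fun x => gt 0 i x) (f i) (xi i) (eta i)
    (proj0 (fun q => gt q.1 i q.2) (D1 i)) (proj0 (fun q => gt q.1 i q.2) (D2 i)).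
  have E x : im i x -> g i x = gt 0 i x by move=> ix; rewrite g0.
  have P0 D x : im i x -> orthoproj (g i) (D i) x = proj0 (fun q => gt q.1 i q.2) (D i) x.
    move=> ix; rewrite /proj0 /= -E//; exact: proj_cofr (metric_posdef gm ix).
  exact: (kc_chart_ext (@im_open _ _ M i) E (kc i) (fun x => P0 D1 x) (fun x => P0 D2 x)).
exact: (@action_critical R _ M D1 D2 gt eps mu f xi eta eps0 gtm gts orth vol hD1 hD2 kc0
  Omega K cK supp static).
Qed.
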